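(* Let $A>1$ be an integer and let $\ell_*\in\{\ell_g,\ell_w,\ell_{\max}\}$ be a standard length function. There exists $\sigma_*^2=\sigma^2(A,\ell_* )>0$ such that for any $-\infty\le a<b\le+\infty$, $$\lim_{N\to\infty}\frac{\left|\left\{C\in\Pi_A(N):\ a\le\frac{\Psi(C)}{\sqrt{\ell_*(C)}}\le b\right\}\right|}{\pi_A(N)}=\frac{1}{\sqrt{2\pi\sigma_*^2}}\int_a^b e^{-x^2/(2\sigma_*^2)}\,dx .$$
   Context: Let $\Gamma=\mathrm{PSL}_2(\mathbb{Z})$ and let $\mathcal{M}=\Gamma\backslash\mathbb{H}$ be the modular surface. A (oriented) primitive (i.e. traversed once) closed geodesic $C$ on $\mathcal{M}$ lifts to a geodesic on $\mathbb{H}$ joining two Galois conjugate quadratic irrationals $w,w'$; the lift can be chosen reduced, i.e. $-1<w'<0<1<w$, so that $w$ has a purely periodic continued fraction expansion $w=[\overline{a_1,\dots,a_n}]$ with positive integers $a_i$, where $n$ is taken to be the minimal even period of the expansion. The tuple $(a_1,\dots,a_n)$ is determined by $C$ up to cyclic shifts by an even number of places, and it characterizes $C$: primitive closed geodesics correspond bijectively to finite sequences $(a_1,\dots,a_n)$ of positive integers, with $n$ even and equal to the minimal even period of the infinite periodic sequence $\overline{a_1,\dots,a_n}$, modulo even cyclic shifts. The hyperbolic conjugacy class of $\Gamma$ associated with $C$ is that of $\gamma_C=\pm\prod_{i=1}^n\begin{pmatrix}a_i&1\\1&0\end{pmatrix}$, which fixes $w$. Period length: $\ell_p(C)=n$.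 Winding number about the cusp: $\Psi(C)=a_1-a_2+a_3-\dots+a_{n-1}-a_n$. $C$ is $A$-low-lying if $a_i\le A$ for all $i$. Define $\Pi_A(N)=\{\text{primitive } A\text{-low-lying closed geodesics } C:\ \ell_p(C)\le N\}$ and $\pi_A(N)=|\Pi_A(N)|$. Standard length functions on $\Pi_A(N)$: $\ell_g(C)$ is the geometric (hyperbolic) length of $C$; $\ell_w(C)$ is the word length of the conjugacy class of $\gamma_C$ in $\Gamma=\langle S,M\mid S^2=M^3=1\rangle\cong\mathbb{Z}_2*\mathbb{Z}_3$, i.e. the minimal word length of an element of the class with respect to $S^{\pm1},M^{\pm1}$, where $S=\pm\begin{pmatrix}0&-1\\1&0\end{pmatrix}$ and $M=\pm\begin{pmatrix}1&-1\\1&0\end{pmatrix}$; and $\ell_{\max}(C)=N$ for all $C\in\Pi_A(N)$. *)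

(* Defs.v *)
From HB Require Import structures.
From mathcomp Require Import all_boot all_order all_algebra finmap complex.
From mathcomp Require Import all_classical all_reals all_analysis.

Set Implicit Arguments.
Unset Strict Implicit.
Unset Printing Implicit Defensive.

Import Order.TTheory GRing.Theory Num.Theory.
Import numFieldNormedType.Exports.

Local Open Scope classical_set_scope.
Local Open Scope ring_scope.

Definition mat22 (a b c d : int) : 'M[int]_2 :=
  \matrix_(i < 2, j < 2)
    (if i == 0 then (if j == 0 then a else b) else (if j == 0 then c else d)).

(** PSL_2(Z) is handled through representatives: integer matrices of
    determinant 1, considered up to sign by means of [eq_pm]. *)
Definition SL2Z : set 'M[int]_2 := [set g | \det g = 1].

Definition eq_pm (g h : 'M[int]_2) : Prop := g = h \/ g = - h.

(** Used both for F = R (action on endpoints of geodesics) and for F = R[i]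
    (action on the upper half-plane).  Below, the real points it is applied to
    are irrational, so the denominator never vanishes. *)
Definition moebius (F : fieldType) (g : 'M[int]_2) (z : F) : F :=
  ((g 0 0)%:~R * z + (g 0 1)%:~R) / ((g 1 0)%:~R * z + (g 1 1)%:~R).

Section ClosedGeodesics.
Variable R : realType.

(** [(x, y)] stands for the oriented geodesic of the upper half-plane going
    from the boundary point x to the boundary point y.  It projects to a closed
    curve on the modular surface iff both endpoints are fixed by a common
    hyperbolic element of PSL_2(Z).  The fixed-point equation g x = x is written
    without division; together with \det g = 1 it forces g10 * x + g11 <> 0.
    Hyperbolic integer matrices do not fix infinity, hence real endpoints are
    enough. *)
Definition fixes_endpoint (g : 'M[int]_2) (x : R) : Prop :=
  (g 0 0)%:~R * x + (g 0 1)%:~R = x * ((g 1 0)%:~R * x + (g 1 1)%:~R).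

Definition closed_lift (p : R * R) : Prop :=
  p.1 <> p.2 /\
  exists g, [/\ SL2Z g, 2 < `|\tr g|, fixes_endpoint g p.1
              & fixes_endpoint g p.2].

Definition geodesic_orbit (p : R * R) : set (R * R) :=
  [set (moebius g p.1, moebius g p.2) | g in SL2Z].

(** A primitive oriented closed geodesic on the modular surface is the
    PSL_2(Z)-orbit of its lifts; an orbit carries no multiplicity, so that the
    curve it represents is the one traversed once. *)
Definition primitive_closed_geodesic (C : set (R * R)) : Prop :=
  exists2 p, closed_lift p & C = geodesic_orbit p.

(** [finite_cf [:: a1; ...; ak]] = a1 + 1/(a2 + 1/(... + 1/ak)), thanks to
    0^-1 = 0. *)
Definition finite_cf (s : seq nat) : R :=
  foldr (fun a x => a%:R + x^-1) 0 s.

Definition periodize (s : seq nat) (i : nat) : nat := nth 0%N s (i %% size s).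

Definition is_periodic_cf (w : R) (s : seq nat) : Prop :=
  (fun k : nat => finite_cf (mkseq (periodize s) k)) @ \oo --> w.

Definition even_period (s : seq nat) (m : nat) : Prop :=
  [/\ (0 < m)%N, ~~ odd m & forall i, periodize s (i + m) = periodize s i].

Definition minimal_even_period (s : seq nat) : Prop :=
  even_period s (size s) /\ forall m, even_period s m -> (size s <= m)%N.

(** The lift [p = (w', w)] is reduced and w = [\overline{a_1, ..., a_n}], where
    [s = [:: a_1; ...; a_n]] and n is the minimal even period. *)
Definition reduced_lift (p : R * R) (s : seq nat) : Prop :=
  [/\ -1 < p.1 < 0, 1 < p.2, all (fun a => 0 < a)%N s, minimal_even_period s
    & is_periodic_cf p.2 s].

Definition has_code (C : set (R * R)) (s : seq nat) : Prop :=
  exists2 p, C p & reduced_lift p s.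

(** A code of C, unique up to even cyclic shifts; nothing below depends on the
    choice. *)
Definition code (C : set (R * R)) : seq nat := xget [::] (has_code C).

Definition lift_of (C : set (R * R)) : R * R :=
  xget (0, 0) [set p | C p /\ reduced_lift p (code C)].

Definition period_length (C : set (R * R)) : nat := size (code C).

Definition winding (C : set (R * R)) : int :=
  \sum_(i < size (code C)) (-1) ^+ i * (nth 0%N (code C) i)%:Z.

Definition low_lying (A : nat) (C : set (R * R)) : Prop :=
  exists2 s, has_code C s & all (fun a => a <= A)%N s.

Definition Pi_ (A N : nat) : set (set (R * R)) :=
  [set C | [/\ primitive_closed_geodesic C, low_lying A C
             & (period_length C <= N)%N]].

Definition gamma (C : set (R * R)) : 'M[int]_2 :=
  \prod_(a <- code C) mat22 a%:Z 1 1 0.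

(** Hyperbolic distance on the upper half-plane:
    arcosh (1 + |z1 - z2|^2 / (2 Im z1 Im z2)). *)
Definition arcosh (u : R) : R := ln (u + Num.sqrt (u ^+ 2 - 1)).

Definition hyp_dist (z1 z2 : R[i]) : R :=
  arcosh (1 + ((complex.Re z1 - complex.Re z2) ^+ 2
               + (complex.Im z1 - complex.Im z2) ^+ 2)
              / (2 * complex.Im z1 * complex.Im z2)).

(** The highest point of the half-circle with endpoints p.1 and p.2. *)
Definition summit (p : R * R) : R[i] :=
  Complex ((p.1 + p.2) / 2) (`|p.2 - p.1| / 2).

(** C is covered exactly once by the segment of its lift that joins a point z of
    this lift to gamma z; the length of this segment does not depend on z. *)
Definition geometric_length (C : set (R * R)) : R :=
  let z := summit (lift_of C) in hyp_dist z (moebius (gamma C) z).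

Definition S_gen : 'M[int]_2 := mat22 0 (-1) 1 0.
Definition M_gen : 'M[int]_2 := mat22 1 (-1) 1 0.

Definition class_has_word (g : 'M[int]_2) (k : nat) : Prop :=
  exists u : seq 'M[int]_2,
    [/\ all (fun x => x \in [:: S_gen; S_gen^-1; M_gen; M_gen^-1]) u,
        size u = k
      & exists2 h, SL2Z h & eq_pm (\prod_(x <- u) x) (h * g * h^-1)].

Definition word_length (C : set (R * R)) : nat :=
  xget 0%N [set k | class_has_word (gamma C) k /\
                    forall j, class_has_word (gamma C) j -> (k <= j)%N].

Inductive standard_length := Lgeom | Lword | Lmax.

Definition length_of (l : standard_length) (N : nat) (C : set (R * R)) : R :=
  match l with
  | Lgeom => geometric_length C
  | Lword => (word_length C)%:R
  | Lmax => N%:R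
  end.

End ClosedGeodesics.

(** Cardinality of a finite set (0 if the set is infinite). *)
Definition ncard (T : choiceType) (X : set T) : nat := #|` fset_set X|%fset.

(* Main.v *)
(** A closed geodesic with code [s] of even length [n] corresponds to a word in
    the letters 1, ..., A that is not a proper power, and each geodesic has
    exactly [n / 2] such words (its even rotations).  So the counts over Pi_A(N)
    are averages over uniform random words of length [n = 2 m], weighted by
    [A ^ n / m]; these weights grow exponentially, so that only lengths [n]
    close to [N] matter, where almost all words are primitive.

    For random words, the winding number is an alternating sum of independent
    letters and satisfies a central limit theorem, proved by Lindeberg's method:
    replacing a letter by a Gaussian changes the heat flow of the limiting
    distribution function by a third order term.  Each length is concentrated
    around [c n] with [c > 0].  The word length is twice the sum of the letters.
    The geometric length is 2 ln of the continuant of the word, up to a bounded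
    error; the logarithm of the continuant is additive up to ln 2 and changes by
    a bounded amount when one letter changes, so that its variance is O(n).
    Hence the limit law is Gaussian with variance [letter_var / c].

    The coding follows a geodesic with one negative and one positive end point
    through its orbit under the additive continued fraction algorithm: two such
    geodesics are equivalent under SL_2(Z) iff one is an iterate of the other,
    and the iterates that are reduced are the even shifts of the expansion.  The
    same algorithm gives the lower bound for the word length: a word in S and M
    has a cyclically reduced form which is a product of [m] matrices
    [[1, 1], [0, 1]] and [[1, 0], [1, 1]], and the algorithm then returns to its
    starting point after [m] steps. *)

Require Import Defs.
From HB Require Import structures.
From mathcomp Require Import all_boot all_order all_algebra.
From mathcomp Require Import all_classical all_reals all_analysis.
From mathcomp Require Import finmap complex.
From mathcomp Require Import ring lra zify.

Import Order.TTheory GRing.Theory Num.Theory.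
Import numFieldNormedType.Exports.

Local Open Scope classical_set_scope.
Local Open Scope ring_scope.

Set Implicit Arguments.
Unset Strict Implicit.
Unset Printing Implicit Defensive.

(** * The Gaussian distribution function *)

(** The winding number is normalised by a random quantity, the length, so the condition on the ratio
    is not a threshold event with a fixed threshold. This shapes [clt]: it accepts any event that,
    off a set of small probability, is squeezed between two thresholds a small multiple of [sqrt n]
    apart. The three lengths then enter only through [length_concentrates]. For the geometric length
    the constant [c] is not explicit: it is twice a supremum of mean logarithms of continuants, and
    only its positivity matters.

    Heat flow is a convenient smoothing for Lindeberg's method because the smoothed indicator is a
    rescaled [gcdf 1], whose derivatives are explicit, and because adding a Gaussian letter just
    advances the time. The sharp threshold is recovered from a short initial time [t0].

    The definitions choose a code of a geodesic arbitrarily. The choice is harmless because all that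
    is read off a code (alternating sum, trace, digit sum) is invariant under even rotations. *)

Section GaussianCdf.
Variable R : realType.
Implicit Types (s x y : R).

Definition gcdf s x : R := fine (normal_prob 0 s `]-oo, x]%classic).

Lemma gcdf_fin s (X : set R) : measurable X -> normal_prob 0 s X \is a fin_num.
Proof. by apply: (fin_num_measure (normal_prob 0 s)). Qed.

Lemma gcdf_ge0 s x : 0 <= gcdf s x.
Proof. by apply: fine_ge0; exact: (measure_ge0 (normal_prob 0 s)). Qed.

Lemma gcdf_le1 s x : gcdf s x <= 1.
Proof.
rewrite -lee_fin /gcdf fineK; first exact: (probability_le1 (normal_prob 0 s)).
exact: gcdf_fin.
Qed.

Lemma is_derive_gcdf s x : s != 0 -> is_derive x 1 (gcdf s) (normal_pdf 0 s x).
Proof.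
move=> s0.
have [] := @continuous_FTC1 R (normal_pdf 0 s) -oo%O x (x + 1).
- by rewrite ltrDl.
- apply: integrableS (integrable_normal_pdf 0 s) => //.
- by rewrite ltNyr.
- exact: continuous_normal_pdf.
move=> h <-; rewrite derive1E; exact/derivableP.
Qed.

Lemma le_gcdf s x y : x <= y -> gcdf s x <= gcdf s y.
Proof.
move=> xy; apply: fine_le; [exact: gcdf_fin|exact: gcdf_fin|].
apply: le_measure; [by apply/mem_set; exact: measurable_itv|by apply/mem_set; exact: measurable_itv|].
by move=> z /=; rewrite !in_itv /= => /le_trans; exact.
Qed.

Let idR : measurableTypeR R -> R := idfun.
HB.instance Definition _ :=
  @isMeasurableFun.Build _ _ _ _ idR (@measurable_id _ _ setT).

Lemma gcdf_cvgy s : gcdf s x @[x --> +oo] --> (1 : R).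
Proof.
have := @cvg_cdfy1 _ _ R (normal_prob 0 s) (idR : {RV normal_prob 0 s >-> R}).
move=> /fine_cvgP[_]; exact.
Qed.

Lemma gcdf_cvgNy s : gcdf s x @[x --> -oo] --> (0 : R).
Proof.
have := @cvg_cdfNy0 _ _ R (normal_prob 0 s) (idR : {RV normal_prob 0 s >-> R}).
move=> /fine_cvgP[_]; exact.
Qed.

End GaussianCdf.

(** * Derivatives and Taylor remainders *)

Section Derivatives.
Variable R : realType.
Implicit Types (f g : R -> R) (x a b : R).

(* A plain definition: [is_derive] is a class, whose instance search would
   solve premises with unwanted derivative expressions. *)
Definition has_deriv f x a : Prop := is_derive x 1 f a.

Lemma has_derivD f g x a b : has_deriv f x a -> has_deriv g x b ->
  has_deriv (fun y => f y + g y) x (a + b).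
Proof. by move=> ? ?; exact: is_deriveD. Qed.

Lemma has_derivB f g x a b : has_deriv f x a -> has_deriv g x b ->
  has_deriv (fun y => f y - g y) x (a - b).
Proof. by move=> ? ?; exact: is_deriveB. Qed.

Lemma has_derivM f g x a b : has_deriv f x a -> has_deriv g x b ->
  has_deriv (fun y => f y * g y) x (a * g x + f x * b).
Proof.
move=> fa gb; have := @is_deriveM R R f g x 1 a b fa gb.
by rewrite /GRing.scale /= addrC [g x * a]mulrC; apply.
Qed.

Lemma has_deriv_comp f g x a b : has_deriv f (g x) a -> has_deriv g x b ->
  has_deriv (fun y => f (g y)) x (a * b).
Proof. by move=> ? ?; exact: is_derive1_comp. Qed.

Lemma has_deriv_cst (c x : R) : has_deriv (fun=> c) x 0.
Proof. exact: is_derive_cst. Qed.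

Lemma has_deriv_id x : has_deriv (fun y : R => y) x 1.
Proof. exact: is_derive_id. Qed.

Lemma has_derivN x : has_deriv (fun y : R => - y) x (-1).
Proof. exact: is_deriveNid. Qed.

Lemma has_deriv_conv f x a b : has_deriv f x a -> a = b -> has_deriv f x b.
Proof. by move=> + <-. Qed.

(** Iterated over successive derivatives, this gives Taylor estimates without integrals. It rests on
    the mean value theorem, so [K] is passed on unchanged instead of being divided by [k.+1]. *)
Lemma taylor_step f df (K c : R) k :
  0 <= c -> f 0 = 0 ->
  (forall x, 0 <= x <= c -> has_deriv f x (df x)) ->
  (forall x, 0 <= x <= c -> `|df x| <= K * x ^+ k) ->
  forall x, 0 <= x <= c -> `|f x| <= K * x ^+ k.+1.
Proof.
move=> c0 f0 fd dfK x /andP[x0 xc].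
have [||z] := @MVT_segment R f df 0 x x0.
- move=> z; rewrite in_itv /= => /andP[z0 zx]; apply: fd.
  by rewrite (ltW z0) (le_trans (ltW zx)).
- apply: derivable_within_continuous => z; rewrite in_itv /= => /andP[z0 zx].
  by have /fd[] // : 0 <= z <= c by rewrite z0 (le_trans zx).
rewrite in_itv /= => /andP[z0 zx]; rewrite f0 !subr0 => ->.
rewrite normrM (ger0_norm x0) exprSr mulrA ler_wpM2r//.
apply: le_trans (dfK z _) _; first by rewrite z0 (le_trans zx).
have K0 : 0 <= K * z ^+ k by apply: le_trans (dfK z _); rewrite ?z0 ?(le_trans zx).
(* The mean value point may be the left end 0, where the bound at [z] says nothing about the sign of
   [K] if [k > 0]; there the bound at [x] takes over. *)
have [->|zn0] := eqVneq z 0; last first.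
  have : 0 < z ^+ k by rewrite exprn_gt0// lt_neqAle eq_sym zn0.
  move=> zk; rewrite ler_wpM2l//; last by rewrite lerXn2r// nnegrE.
  by rewrite -(pmulr_lge0 _ zk).
have := dfK x; rewrite x0 xc => /(_ isT) K1.
case: k dfK K0 K1 => [|k] dfK K0 K1; first by rewrite !expr0.
rewrite expr0n mulr0; apply: le_trans K1; exact: normr_ge0.
Qed.

End Derivatives.

(** * The Gaussian density and the heat equation *)

Section Gaussian.
Variable R : realType.
Implicit Types (s x y z t : R).

(** [gphi], [gphi2] and [gphi3] are the first three derivatives of [gcdf 1], written as a polynomial
    times the density. *)
Definition gphi z : R := normal_pdf 0 1 z.
Definition gphi2 z : R := - z * gphi z.
Definition gphi3 z : R := (z ^+ 2 - 1) * gphi z.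

Lemma gphiE z : gphi z = normal_peak 1 * expR (- (z * z) * 2^-1).
Proof.
rewrite /gphi normal_pdfE// /normal_fun subr0 expr1n -mulr_natr mul1r.
by rewrite expr2.
Qed.

Lemma has_deriv_gphi z : has_deriv gphi z (gphi2 z).
Proof.
rewrite (_ : gphi = fun z => normal_peak 1 * expR ((- z) * z * 2^-1)); last first.
  by apply/funext => y; rewrite gphiE; congr (_ * expR _); lra.
apply: has_deriv_conv.
  apply: has_derivM; first exact: has_deriv_cst.
  apply: has_deriv_comp; first exact: is_derive_expR.
  apply: has_derivM; last exact: has_deriv_cst.
  apply: has_derivM; last exact: has_deriv_id.
  exact: has_derivN.
by rewrite /gphi2 gphiE !mulNr; lra.
Qed.

Lemma has_deriv_gphi2 z : has_deriv gphi2 z (gphi3 z).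
Proof.
apply: has_deriv_conv.
  apply: has_derivM; last exact: has_deriv_gphi.
  exact: has_derivN.
by rewrite /gphi3 /gphi2; ring.
Qed.

Lemma has_deriv_gcdf1 z : has_deriv (gcdf 1) z (gphi z).
Proof. exact: is_derive_gcdf. Qed.

(** Both sides have the same derivative, so they differ by a constant, which is 0 because both tend
    to 1 at [+oo]. This replaces a change of variables in the integral. *)
Lemma gcdf_scale s x : 0 < s -> gcdf s x = gcdf 1 (x * s^-1).
Proof.
move=> s0.
pose D y := gcdf s y - gcdf 1 (y * s^-1).
have D0 y : has_deriv D y 0.
  apply: has_deriv_conv.
    apply: has_derivB; first by apply: is_derive_gcdf; rewrite gt_eqF.
    apply: has_deriv_comp; first exact: has_deriv_gcdf1.
    apply: has_derivM; first exact: has_deriv_id.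
    exact: has_deriv_cst.
  rewrite gphiE normal_pdfE ?gt_eqF// /normal_fun /normal_peak subr0 expr1n !mul1r mulr0 addr0.
  rewrite -[s ^+ 2 * _ *+ 2]mulrnAr sqrtrM ?sqr_ge0// sqrtr_sqr gtr0_norm// invfM.
  rewrite (_ : - (y / s * (y / s)) / 2 = - y ^+ 2 / (s ^+ 2 *+ 2)); first by ring.
  by rewrite -mulr_natr; field; rewrite gt_eqF.
have Dcvg : D y @[y --> +oo] --> (1 - 1 : R).
  apply: cvgB; first exact: gcdf_cvgy.
  apply: (@cvg_comp _ _ _ (fun y => y * s^-1) (gcdf 1) _ +oo); last exact: gcdf_cvgy.
  by apply: gt0_cvgMly; [rewrite invr_gt0|exact: cvg_id].
have Dx : D y @[y --> +oo] --> D x.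
  rewrite (_ : D = fun=> D x); first exact: cvg_cst.
  by apply/funext => y; exact: is_derive_0_is_cst.
have : 1 - 1 = D x by apply: (cvg_unique _ Dcvg Dx).
by rewrite /D; lra.
Qed.

Lemma normal_peak1_le1 : normal_peak (1 : R) <= 1.
Proof.
rewrite /normal_peak expr1n mul1r invf_le1; last by rewrite sqrtr_gt0 mulrn_wgt0// pi_gt0.
rewrite -[leLHS]sqrtr1 ler_wsqrtr// -mulr_natr.
by have := pi_ge2 R; lra.
Qed.

Lemma gphi_ge0 z : 0 <= gphi z.
Proof. exact: normal_pdf_ge0. Qed.

(** The exponential of [- z^2 / 2] is the inverse square of that of [z^2 / 4], which is at least
    [1 + z^2 / 4]. The resulting rational bound of degree four dominates the polynomial factors
    below and turns their estimates into polynomial inequalities. *)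
Lemma gphi_decay z : gphi z * (1 + z ^+ 2 / 4) ^+ 2 <= 1.
Proof.
rewrite gphiE.
have -> : expR (- (z * z) * 2^-1) = (expR (z ^+ 2 / 4) ^+ 2)^-1.
  by rewrite expr2 -expRD -expRN; congr expR; rewrite expr2; lra.
have h := expR_ge1Dx (z ^+ 2 / 4).
have z0 : 0 <= z ^+ 2 / 4 by rewrite divr_ge0// sqr_ge0.
rewrite -mulrA; apply: le_trans (_ : 1 * 1 <= 1); last by rewrite mulr1.
apply: ler_pM normal_peak1_le1 _.
- exact: normal_peak_ge0.
- by rewrite mulr_ge0// ?sqr_ge0// invr_ge0 sqr_ge0.
- rewrite mulrC ler_pdivrMr ?exprn_gt0 ?expR_gt0// mul1r lerXn2r// nnegrE ?expR_ge0//.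
  by rewrite addr_ge0.
Qed.

Lemma gphi3_bound z : `|gphi3 z| <= 16.
Proof.
have h := gphi_decay z; have g0 := gphi_ge0 z.
rewrite /gphi3 normrM [X in _ * X]ger0_norm//.
apply: le_trans (_ : 16 * (gphi z * (1 + z ^+ 2 / 4) ^+ 2) <= _); last by lra.
rewrite mulrCA [leLHS]mulrC ler_wpM2l//.
have z0 := sqr_ge0 z; rewrite ler_norml; apply/andP; split; nra.
Qed.

Lemma gphi2_bound z : `|gphi2 z| <= 16.
Proof.
have h := gphi_decay z; have g0 := gphi_ge0 z.
rewrite /gphi2 normrM [X in _ * X]ger0_norm//.
apply: le_trans (_ : 16 * (gphi z * (1 + z ^+ 2 / 4) ^+ 2) <= _); last by lra.
rewrite mulrCA [leLHS]mulrC ler_wpM2l//.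
have z0 := sqr_ge0 z; have z1 := sqr_ge0 (z - 1); have z2 := sqr_ge0 (z + 1).
rewrite ler_norml; apply/andP; split; nra.
Qed.

Lemma zgphi3_bound z : `|z * gphi3 z| <= 32.
Proof.
have h := gphi_decay z; have g0 := gphi_ge0 z.
rewrite /gphi3 mulrA normrM [X in _ * X]ger0_norm//.
apply: le_trans (_ : 32 * (gphi z * (1 + z ^+ 2 / 4) ^+ 2) <= _); last by lra.
rewrite mulrCA [leLHS]mulrC ler_wpM2l//.
have z0 := sqr_ge0 z; have z1 := sqr_ge0 (z - 1); have z2 := sqr_ge0 (z + 1).
have z3 := sqr_ge0 (z * (z - 1)); have z4 := sqr_ge0 (z * (z + 1)).
rewrite ler_norml; apply/andP; split; nra.
Qed.

(** Three rounds of [taylor_step], starting from the bound on the third derivative. *)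
Lemma taylor_gcdf z w :
  `|gcdf 1 (z + w) - gcdf 1 z - w * gphi z - w ^+ 2 / 2 * gphi2 z| <= 16 * `|w| ^+ 3.
Proof.
(* [taylor_step] only looks to the right of 0, so [w] is split into a sign [e] and a size [y]. *)
wlog : z w / exists2 e : R, `|e| = 1 & exists2 y, 0 <= y & w = e * y.
  apply; have [w0|w0] := leP 0 w.
    by exists 1; rewrite ?normr1//; exists w; rewrite ?mul1r.
  exists (-1); rewrite ?normrN1//; exists (- w); last by rewrite mulN1r opprK.
  by rewrite oppr_ge0 ltW.
move=> [e e1 [y y0 ->]]; rewrite normrM e1 mul1r (ger0_norm y0).
have ee : e * e = 1.
  by move: e1 => /(congr1 (fun x => x ^+ 2)); rewrite real_normK ?num_real// expr1n expr2.
have dl x : has_deriv (fun u => z + e * u) x e.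
  apply: has_deriv_conv.
    apply: has_derivD; first exact: has_deriv_cst.
    apply: has_derivM; [exact: has_deriv_cst|exact: has_deriv_id].
  by rewrite mul0r !add0r mulr1.
have main : forall x, 0 <= x <= y -> `|gcdf 1 (z + e * x) - gcdf 1 z - e * x * gphi z - x ^+ 2 / 2 * gphi2 z| <= 16 * x ^+ 3.
  apply: (@taylor_step R _ (fun x => e * (gphi (z + e * x) - gphi z - e * x * gphi2 z))) => //.
  - by rewrite mulr0 addr0 subrr mul0r expr0n /= !mul0r !subr0.
  - move=> x _; apply: has_deriv_conv.
      apply: has_derivB; last first.
        apply: has_derivM; last exact: has_deriv_cst.
        apply: has_derivM; last exact: has_deriv_cst.
        by apply: has_derivM; exact: has_deriv_id.
      apply: has_derivB; last first.
        apply: has_derivM; last exact: has_deriv_cst.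
        apply: has_derivM; [exact: has_deriv_cst|exact: has_deriv_id].
      apply: has_derivB; last exact: has_deriv_cst.
      apply: has_deriv_comp (dl x); exact: has_deriv_gcdf1.
    rewrite !mulr0 !mul0r !addr0 mulrBr mulrBr !mulrA ee; lra.
  apply: (@taylor_step R _ (fun x => gphi2 (z + e * x) - gphi2 z)) => //.
  - by rewrite !mulr0 addr0 subrr !mul0r subr0 mulr0.
  - move=> x _; apply: has_deriv_conv.
      apply: has_derivM; first exact: has_deriv_cst.
      apply: has_derivB; last first.
        apply: has_derivM; last exact: has_deriv_cst.
        apply: has_derivM; [exact: has_deriv_cst|exact: has_deriv_id].
      apply: has_derivB; last exact: has_deriv_cst.
      apply: has_deriv_comp (dl x); exact: has_deriv_gphi.
    by transitivity ((e * e) * (gphi2 (z + e * x) - gphi2 z)); [rewrite /=; ring|rewrite ee mul1r].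
  apply: (@taylor_step R _ (fun x => e * gphi3 (z + e * x))); first exact: y0.
  - by rewrite mulr0 addr0 subrr.
  - move=> x _; apply: has_deriv_conv.
      apply: has_derivB; last exact: has_deriv_cst.
      apply: has_deriv_comp (dl x); exact: has_deriv_gphi2.
    by rewrite subr0 mulrC.
  - by move=> x _; rewrite expr0 mulr1 normrM e1 mul1r gphi3_bound.
have -> : (e * y) ^+ 2 = y ^+ 2 by rewrite exprMn [e ^+ 2]expr2 ee mul1r.
by apply: main; rewrite y0 lexx.
Qed.

Definition isqrt t : R := (Num.sqrt t)^-1.

Lemma has_deriv_isqrt t : 0 < t -> has_deriv isqrt t (- (isqrt t ^+ 3) / 2).
Proof.
move=> t0; apply: has_deriv_conv.
  apply: is_deriveV; first by rewrite gt_eqF// sqrtr_gt0.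
  exact: is_derive1_sqrt.
rewrite /isqrt /GRing.scale /= invfM exprS exprVn; lra.
Qed.

Lemma isqrt_gt0 t : 0 < t -> 0 < isqrt t.
Proof. by move=> t0; rewrite invr_gt0 sqrtr_gt0. Qed.

Lemma isqrt_le t s : 0 < t -> t <= s -> isqrt s <= isqrt t.
Proof.
move=> t0 ts; rewrite lef_pV2 ?posrE ?sqrtr_gt0//; last exact: lt_le_trans ts.
exact: ler_wsqrtr.
Qed.

(** The linear term is the heat equation: the time derivative of [gcdf 1 (x * isqrt t)] is half its
    second space derivative. It will cancel the second order term of [taylor_gcdf]. *)
Lemma taylor_time t x s : 0 < t -> 0 <= s ->
  `|gcdf 1 (x * isqrt (t + s)) - gcdf 1 (x * isqrt t)
     - s * (isqrt t ^+ 2 / 2 * gphi2 (x * isqrt t))| <= 16 * isqrt t ^+ 4 * s ^+ 2.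
Proof.
move=> t0 s0.
have dr u : 0 <= u <= s -> has_deriv (fun u => isqrt (t + u)) u (- (isqrt (t + u) ^+ 3) / 2).
  move=> /andP[u0 _]; apply: has_deriv_conv.
    apply: has_deriv_comp; first by apply: has_deriv_isqrt; rewrite ltr_wpDr.
    apply: has_derivD; [exact: has_deriv_cst|exact: has_deriv_id].
  by rewrite add0r mulr1.
have dxr u : 0 <= u <= s -> has_deriv (fun u => x * isqrt (t + u)) u (x * (- (isqrt (t + u) ^+ 3) / 2)).
  move=> us; apply: has_deriv_conv.
    apply: has_derivM; [exact: has_deriv_cst|exact: dr].
  by rewrite mul0r add0r.
pose h u := isqrt (t + u) ^+ 2 / 2 * gphi2 (x * isqrt (t + u)).
suff main : forall u, 0 <= u <= s -> `|gcdf 1 (x * isqrt (t + u)) - gcdf 1 (x * isqrt t)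
     - u * h 0| <= 16 * isqrt t ^+ 4 * u ^+ 2.
  by have := main s; rewrite s0 lexx /h addr0; apply.
apply: (@taylor_step R _ (fun u => h u - h 0)) => //.
- by rewrite addr0 subrr mul0r subr0.
- move=> u us; apply: has_deriv_conv.
    apply: has_derivB; last first.
      apply: has_derivM; [exact: has_deriv_id|exact: has_deriv_cst].
    apply: has_derivB; last exact: has_deriv_cst.
    apply: has_deriv_comp (dxr u us); exact: has_deriv_gcdf1.
  by rewrite /h /gphi2; ring.
apply: (@taylor_step R _ (fun u => - (isqrt (t + u) ^+ 4) *
   (gphi2 (x * isqrt (t + u)) / 2 + x * isqrt (t + u) * gphi3 (x * isqrt (t + u)) / 4))) => //.
- by rewrite subrr.
- move=> u us; apply: has_deriv_conv.
    apply: has_derivB; last exact: has_deriv_cst.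
    apply: has_derivM; last first.
      apply: has_deriv_comp (dxr u us); exact: has_deriv_gphi2.
    apply: has_derivM; last exact: has_deriv_cst.
    apply: has_derivM; exact: dr us.
  by rewrite /=; field.
move=> u /andP[u0 us]; rewrite expr0 mulr1.
have p0 : 0 < isqrt (t + u) by rewrite isqrt_gt0// ltr_wpDr.
have le4 : isqrt (t + u) ^+ 4 <= isqrt t ^+ 4.
  apply: lerXn2r; rewrite ?nnegrE; [exact: ltW|exact/ltW/isqrt_gt0|].
  by apply: isqrt_le => //; lra.
rewrite normrM normrN [X in X * _]ger0_norm; last exact/exprn_ge0/ltW.
rewrite mulrC; apply: ler_pM => //; first exact/exprn_ge0/ltW.
(* The constant is 16 / 2 + 32 / 4 = 16. *)
have := gphi2_bound (x * isqrt (t + u)); have := zgphi3_bound (x * isqrt (t + u)).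
rewrite !ler_norml => /andP[? ?] /andP[? ?]; apply/andP; split; lra.
Qed.

End Gaussian.

(** * Random words and the central limit theorem *)

Section Words.
Variables (R : realType) (A : nat).
Hypothesis A0 : (0 < A)%N.
Implicit Types (n : nat) (s : seq nat).

Fixpoint words n : seq (seq nat) :=
  if n is n'.+1 then [seq a :: s | a <- iota 1 A, s <- words n'] else [:: [::]].

Definition is_word n s := (size s == n) && all (fun a => 0 < a <= A)%N s.

Lemma mem_words n s : (s \in words n) = is_word n s.
Proof.
elim: n s => [|n IH] [|a s] //=.
  by apply/allpairsP => -[[? ?] []].
rewrite /is_word /= eqSS andbCA -/(is_word n s) -IH.
apply/allpairsP/andP => [[[b t] /= [bA tn [-> ->]]]|[aA sn]].
  by move: bA; rewrite mem_iota add1n ltnS => ->.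
by exists (a, s); rewrite mem_iota add1n ltnS.
Qed.

Lemma words_uniq n : uniq (words n).
Proof.
elim: n => //= n IH; apply: allpairs_uniq => //; first exact: iota_uniq.
by move=> [? ?] [? ?] _ _ /= [-> ->].
Qed.

Lemma size_words n : size (words n) = (A ^ n)%N.
Proof. by elim: n => //= n IH; rewrite size_allpairs size_iota IH expnS. Qed.

Definition avg n (f : seq nat -> R) : R := (\sum_(s <- words n) f s) / (A ^ n)%:R.

Lemma An_gt0 n : 0 < (A ^ n)%:R :> R.
Proof. by rewrite ltr0n expn_gt0 A0. Qed.

Lemma avg0 f : avg 0 f = f [::].
Proof. by rewrite /avg big_seq1 divr1. Qed.

Lemma avgS n f :
  avg n.+1 f = (\sum_(a <- iota 1 A) avg n (fun s => f (a :: s))) / A%:R.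
Proof.
rewrite /avg /= big_allpairs_dep -mulr_suml expnSr natrM invfM mulrA.
by [].
Qed.

Lemma eq_avg n f g : (forall s, is_word n s -> f s = g s) -> avg n f = avg n g.
Proof.
move=> fg; rewrite /avg; congr (_ / _); apply: eq_big_seq => s.
by rewrite mem_words => /fg.
Qed.

Lemma le_avg n f g : (forall s, is_word n s -> f s <= g s) -> avg n f <= avg n g.
Proof.
move=> fg; rewrite /avg ler_pM2r ?invr_gt0 ?An_gt0// big_seq [leRHS]big_seq.
by apply: ler_sum => s; rewrite mem_words => /fg.
Qed.

Lemma avgD n f g : avg n (fun s => f s + g s) = avg n f + avg n g.
Proof. by rewrite /avg big_split mulrDl. Qed.

Lemma avgZ n (c : R) f : avg n (fun s => c * f s) = c * avg n f.
Proof. by rewrite /avg -mulr_sumr mulrA. Qed.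

Lemma avgB n f g : avg n (fun s => f s - g s) = avg n f - avg n g.
Proof. by rewrite /avg sumrB mulrBl. Qed.

Lemma avg_cst n (c : R) : avg n (fun=> c) = c.
Proof.
by rewrite /avg big_const_seq count_predT iter_addr_0 size_words -[c *+ _]mulr_natr mulfK// gt_eqF// An_gt0.
Qed.

Lemma avg_norm n f : `|avg n f| <= avg n (fun s => `|f s|).
Proof.
rewrite /avg normrM [X in _ * X]ger0_norm; last by rewrite invr_ge0 ler0n.
by rewrite ler_pM2r ?invr_gt0 ?An_gt0// ler_norm_sum.
Qed.

Lemma avg_ge0 n f : (forall s, is_word n s -> 0 <= f s) -> 0 <= avg n f.
Proof. by move=> f0; rewrite -(avg_cst n 0); exact: le_avg. Qed.

Definition prob n (Q : pred (seq nat)) : R := avg n (fun s => (Q s)%:R).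

Lemma prob_count n Q : prob n Q = (count Q (words n))%:R / (A ^ n)%:R.
Proof.
rewrite /prob /avg -sum1_count natr_sum; congr (_ / _).
by rewrite [RHS]big_mkcond /=; apply: eq_bigr => s _; case: (Q s).
Qed.

Lemma le_prob n (Q Q' : pred (seq nat)) :
  (forall s, is_word n s -> Q s -> Q' s) -> prob n Q <= prob n Q'.
Proof.
move=> QQ; apply: le_avg => s ws; have := QQ s ws.
by case: (Q s) (Q' s) => -[] //= h; rewrite ?ler01//; have := h isT.
Qed.

Lemma prob_le1 n Q : prob n Q <= 1.
Proof. by rewrite -(avg_cst n 1); apply: le_avg => s _; case: (Q s). Qed.

Lemma prob_ge0 n Q : 0 <= prob n Q.
Proof. by apply: avg_ge0 => s _; case: (Q s). Qed.

Lemma prob_or n Q Q' : prob n (fun s => Q s || Q' s) <= prob n Q + prob n Q'.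
Proof.
rewrite -avgD; apply: le_avg => s _.
by case: (Q s) (Q' s) => -[] /=; lra.
Qed.

Lemma chebyshev n f (c : R) : 0 < c ->
  prob n (fun s => c < `|f s|) <= avg n (fun s => f s ^+ 2) / c ^+ 2.
Proof.
move=> c0; rewrite mulrC -avgZ; apply: le_avg => s _.
rewrite mulrC; have [cf|_] := ltP c `|f s|.
  rewrite ler_pdivlMr ?exprn_gt0// mul1r -[leRHS]real_normK ?num_real//.
  apply: lerXn2r; rewrite ?nnegrE; [exact: ltW|exact: normr_ge0|exact: ltW].
by rewrite divr_ge0 ?sqr_ge0.
Qed.

End Words.

(** * Replacement of letters by Gaussians *)

Section Lindeberg.
Variables (R : realType) (A : nat).
Hypothesis A1 : (1 < A)%N.
Let A0 : (0 < A)%N := ltnW A1.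
Implicit Types (n : nat) (s : seq nat) (t x r : R).

Definition letter_mean : R := A.+1%:R / 2.
Definition letter_var : R := (\sum_(a <- iota 1 A) (a%:R - letter_mean) ^+ 2) / A%:R.
Notation mean := letter_mean.
Notation var := letter_var.

(** The alternating sum of the centred letters, in a form where peeling off the first letter negates
    the rest. *)
Definition centered_sum s : R := foldr (fun a z => a%:R - mean - z) 0 s.

Lemma sum_letters : \sum_(a <- iota 1 A) (a%:R - mean) = 0 :> R.
Proof.
rewrite sumrB big_const_seq count_predT iter_addr_0 size_iota.
suff -> : \sum_(a <- iota 1 A) a%:R = A%:R * A.+1%:R / 2 :> R.
  by rewrite /mean -mulr_natr; field.
elim: (A) => [|k IH]; first by rewrite big_nil !mul0r.
rewrite -[in LHS](addn1 k) iotaD big_cat big_seq1 /= IH add1n -[k.+2%:R]natr1 -!natr1.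
by field.
Qed.

Lemma letter_bound a : a \in iota 1 A -> `|a%:R - mean| <= A%:R.
Proof.
rewrite mem_iota add1n ltnS => /andP[a1 aA].
have : 1 <= a%:R :> R by rewrite ler1n.
have : a%:R <= A%:R :> R by rewrite ler_nat.
by rewrite /mean -natr1 ler_norml => ? ?; apply/andP; split; lra.
Qed.

(** For [1 < A] the letter 1 differs from the mean; this makes the limit law nondegenerate. *)
Lemma letter_var_gt0 : 0 < var.
Proof.
rewrite divr_gt0 ?ltr0n//.
rewrite (bigD1_seq 1%N) ?iota_uniq ?mem_iota//=.
rewrite ltr_wpDr//; first by apply: sumr_ge0 => i _; exact: sqr_ge0.
rewrite exprn_even_gt0//= subr_eq0 /mean -natr1.
have : 2 <= A%:R :> R by rewrite ler_nat.
by move=> h; apply/negP => /eqP; lra.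
Qed.

(* The solution of the heat equation u_t = u_xx / 2 with initial value the
   indicator function of x > 0. *)
Definition heat t x : R := gcdf 1 (x * isqrt t).

(** The two summands come from the remainders of [taylor_gcdf], with [A] bounding a centred letter,
    and of [taylor_time]. *)
Definition lindeberg_const t0 : R :=
  16 * isqrt t0 ^+ 3 * A%:R ^+ 3 + 16 * isqrt t0 ^+ 4 * var ^+ 2.

Lemma lindeberg_const_ge0 t0 : 0 < t0 -> 0 <= lindeberg_const t0.
Proof.
move=> t00; have h := isqrt_gt0 t00.
rewrite addr_ge0// mulr_ge0 ?sqr_ge0 ?exprn_ge0// ?mulr_ge0// ?exprn_ge0//; exact: ltW.
Qed.

(** Averaging over one letter and advancing the time by its variance agree up to second order: the
    first order term vanishes because the letters are centred, and the second order term is [M] in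
    both expansions. *)
Lemma heat_step t0 t x r : 0 < t0 -> t0 <= t -> `|r| <= 1 ->
  `|(\sum_(a <- iota 1 A) heat t (x + r * (a%:R - mean))) / A%:R
    - heat (t + r ^+ 2 * var) x| <= lindeberg_const t0 * `|r| ^+ 3.
Proof.
move=> t00 t0t r1; have tp : 0 < t by apply: lt_le_trans t0t.
have AR : 0 < A%:R :> R by rewrite ltr0n.
have q0 := isqrt_gt0 tp; have q1 := isqrt_gt0 t00; have q01 := isqrt_le t00 t0t.
have v0 := letter_var_gt0.
set q := isqrt t in q0 q01 *; set z := x * q.
set M := r ^+ 2 * var * (q ^+ 2 / 2 * gphi2 z).
have H1 : `|(\sum_(a <- iota 1 A) heat t (x + r * (a%:R - mean))) / A%:R
     - gcdf 1 z - M| <= 16 * q ^+ 3 * A%:R ^+ 3 * `|r| ^+ 3.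
  have -> : (\sum_(a <- iota 1 A) heat t (x + r * (a%:R - mean))) / A%:R
     - gcdf 1 z - M = (\sum_(a <- iota 1 A) (gcdf 1 (z + r * q * (a%:R - mean)) - gcdf 1 z
        - r * q * (a%:R - mean) * gphi z - (r * q * (a%:R - mean)) ^+ 2 / 2 * gphi2 z)) / A%:R.
    rewrite !sumrB.
    have -> : \sum_(a <- iota 1 A) (r * q * (a%:R - mean)) * gphi z = 0.
      by rewrite -mulr_suml -mulr_sumr sum_letters mulr0 mul0r.
    have -> : \sum_(a <- iota 1 A) (r * q * (a%:R - mean)) ^+ 2 / 2 * gphi2 z = M * A%:R.
      transitivity (\sum_(a <- iota 1 A) (r ^+ 2 * q ^+ 2 / 2 * gphi2 z) * (a%:R - mean) ^+ 2).
        by apply: eq_bigr => a _; ring.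
      by rewrite -mulr_sumr /M /var; field; lra.
    have -> : \sum_(a <- iota 1 A) heat t (x + r * (a%:R - mean)) =
        \sum_(a <- iota 1 A) gcdf 1 (z + r * q * (a%:R - mean)).
      by apply: eq_bigr => a _; rewrite /heat /z -/q; congr gcdf; ring.
    rewrite big_const_seq count_predT iter_addr_0 size_iota subr0 -[_ *+ A]mulr_natr.
    by field; lra.
  rewrite normrM [X in _ * X]ger0_norm ?invr_ge0 ?ler0n// ler_pdivrMr//.
  apply: le_trans (ler_norm_sum _ _ _) _.
  apply: le_trans (_ : \sum_(a <- iota 1 A) (16 * q ^+ 3 * A%:R ^+ 3 * `|r| ^+ 3) <= _); last first.
    by rewrite big_const_seq count_predT iter_addr_0 size_iota mulr_natr.
  rewrite big_seq [leRHS]big_seq; apply: ler_sum => a /letter_bound aA.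
  apply: le_trans (taylor_gcdf _ _) _.
  have -> : 16 * `|r * q * (a%:R - mean)| ^+ 3 = 16 * q ^+ 3 * `|r| ^+ 3 * `|a%:R - mean| ^+ 3.
    by rewrite !normrM (gtr0_norm q0); ring.
  rewrite [leRHS]mulrAC ler_wpM2l//; first by rewrite !mulr_ge0 ?exprn_ge0// ltW.
  by apply: lerXn2r; rewrite ?nnegrE.
have V0 : 0 <= r ^+ 2 * var by rewrite mulr_ge0 ?sqr_ge0 ?ltW.
have H2 := taylor_time x tp V0; rewrite -/(heat _ _) -/q -/z -/M in H2.
apply: le_trans (_ : 16 * q ^+ 3 * A%:R ^+ 3 * `|r| ^+ 3 + 16 * q ^+ 4 * (r ^+ 2 * var) ^+ 2 <= _).
  apply: le_trans (lerD H1 H2); rewrite [X in _ <= _ + X]distrC.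
  set S := _ / A%:R; set Y := heat _ x.
  have -> : S - Y = (S - gcdf 1 z - M) + (M - (Y - gcdf 1 z)) by ring.
  exact: ler_normD.
have -> : lindeberg_const t0 * `|r| ^+ 3 = 16 * isqrt t0 ^+ 3 * A%:R ^+ 3 * `|r| ^+ 3 +
    16 * isqrt t0 ^+ 4 * var ^+ 2 * `|r| ^+ 3 by rewrite /lindeberg_const; ring.
apply: lerD.
  rewrite ler_wpM2r ?exprn_ge0// ler_wpM2r ?exprn_ge0// ler_pM2l//.
  apply: lerXn2r; rewrite ?nnegrE; [exact: ltW|exact: ltW|exact: q01].
(* The time remainder carries [|r| ^+ 4], which is at most [|r| ^+ 3] since [|r| <= 1]. *)
rewrite exprMn -[r ^+ 2]real_normK ?num_real// -exprM mulrA [leLHS]mulrAC.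
apply: ler_pM.
- by rewrite mulr_ge0 ?sqr_ge0// mulr_ge0// exprn_ge0// ltW.
- by rewrite exprn_ge0.
- rewrite ler_wpM2r ?sqr_ge0// ler_pM2l//.
  by apply: lerXn2r; rewrite ?nnegrE; [exact: ltW|exact: ltW|exact: q01].
- by rewrite (exprS _ 3) ler_piMl// exprn_ge0.
Qed.

(** The time only grows along the induction, so the constant at [t0] serves for every step. With [r]
    of order [n^(-1/2)] the total error is of the same order. *)
Lemma lindeberg n t0 t x r : 0 < t0 -> t0 <= t -> `|r| <= 1 ->
  `|avg A n (fun s => heat t (x + r * centered_sum s))
    - heat (t + n%:R * (r ^+ 2 * var)) x| <= n%:R * (lindeberg_const t0 * `|r| ^+ 3).
Proof.
move=> t00 t0t; elim: n x r => [|n IH] x r r1.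
  by rewrite avg0 /= mulr0 addr0 !mul0r addr0 subrr normr0.
have v0 := letter_var_gt0.
have AR : 0 < A%:R :> R by rewrite ltr0n.
have r2 : 0 <= n%:R * (r ^+ 2 * var) by rewrite mulr_ge0// mulr_ge0 ?sqr_ge0// ltW.
have := @heat_step t0 (t + n%:R * (r ^+ 2 * var)) x r t00 _ r1.
rewrite (le_trans t0t) ?lerDl// => /(_ isT).
have -> : t + n%:R * (r ^+ 2 * var) + r ^+ 2 * var = t + n.+1%:R * (r ^+ 2 * var).
  by rewrite -natr1; ring.
set T := t + n.+1%:R * _; set e := lindeberg_const t0 * `|r| ^+ 3 in IH *.
move=> step; rewrite avgS -natr1 mulrDl mul1r.
set S2 := _ / _ in step.
rewrite -[X in `|X|](subrKA S2); apply: le_trans (ler_normD _ _) _; apply: lerD => //.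
rewrite -mulrBl -sumrB normrM [X in _ * X]ger0_norm ?invr_ge0 ?ler0n// ler_pdivrMr//.
apply: le_trans (ler_norm_sum _ _ _) _.
apply: le_trans (_ : \sum_(a <- iota 1 A) (n%:R * e) <= _); last first.
  by rewrite big_const_seq count_predT iter_addr_0 size_iota mulr_natr.
apply: ler_sum => a _.
(* The alternation of signs is absorbed in [r], which enters the variance only through its
   square. *)
have := IH (x + r * (a%:R - mean)) (- r); rewrite normrN sqrrN => /(_ r1).
rewrite (@eq_avg _ _ _ _ (fun s => heat t (x + r * centered_sum (a :: s)))) => [|s _]; first exact.
by rewrite /=; congr heat; ring.
Qed.

(** The margin [kappa] leaves room for a random normalisation, and [B] collects the words without
    control. The error [4 * rho] has four sources: Lindeberg's bound, the displacement of [x] and of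
    the time, the tails of the smoothing, and [B]. *)
Lemma clt x rho : 0 < rho -> exists2 kappa : R, 0 < kappa &
  exists n0, forall n, (n0 <= n)%N -> forall Q B : pred (seq nat),
    prob R A n B <= rho ->
    (forall s, is_word A n s -> ~~ B s ->
       centered_sum s <= (x - kappa) * Num.sqrt n%:R -> Q s) ->
    (forall s, is_word A n s -> ~~ B s -> Q s ->
       centered_sum s <= (x + kappa) * Num.sqrt n%:R) ->
  `|prob R A n Q - heat var x| <= 4 * rho.
Proof.
move=> rho0.
have v0 := letter_var_gt0.
have [K K0 [GK GNK]] : exists2 K : R, 0 < K &
    (forall y, K <= y -> 1 - rho <= gcdf 1 y) /\ (forall y, y <= - K -> gcdf 1 y <= rho).
  have /cvgrPdist_le /(_ rho rho0)[K1 [_ HK1]] := gcdf_cvgy (1 : R).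
  have /cvgrPdist_le /(_ rho rho0)[K2 [_ HK2]] := gcdf_cvgNy (1 : R).
  exists (1 + `|K1| + `|K2|).
    by have := normr_ge0 K1; have := normr_ge0 K2; lra.
  have k1 := ler_norm K1; have k2 := ler_norm (- K2); rewrite normrN in k2.
  have k3 := normr_ge0 K1; have k4 := normr_ge0 K2.
  split=> y yK.
    have /HK1 : K1 < y by lra.
    by rewrite ler_norml => /andP[]; lra.
  have /HK2 : y < K2 by lra.
  by rewrite ler_norml => /andP[]; lra.
(* With initial time [(d / K)^2], the heat flow is within [rho] of the indicator of the positive
   axis at distance at least [d] from 0. One [d] pays for this smoothing and one for [kappa], whence
   the shift [2 * k]; [k = d] and [k = - d] give the upper and the lower bound. *)
pose h k := heat (k * K^-1 * (k * K^-1) + var) (x + 2 * k).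
have [d d0 Hd] : exists2 d : R, 0 < d & forall k, `|k| <= d -> `|h k - heat var x| <= rho.
  have hd : exists l, has_deriv h 0 l.
    eexists.
    apply: has_deriv_comp; first exact: has_deriv_gcdf1.
    apply: has_derivM.
      apply: has_derivD; first exact: has_deriv_cst.
      apply: has_derivM; [exact: has_deriv_cst|exact: has_deriv_id].
    apply: has_deriv_comp.
      by apply: has_deriv_isqrt; rewrite !mul0r add0r.
    apply: has_derivD; last exact: has_deriv_cst.
    apply: has_derivM; apply: has_derivM; by [exact: has_deriv_cst|exact: has_deriv_id].
  have hc : {for 0, continuous h}.
    by case: hd => l [hl _]; exact/differentiable_continuous/derivable1_diffP.
  have h0 : h 0 = heat var x by rewrite /h !mul0r add0r mulr0 addr0.
  move: hc => /cvgrPdist_le /(_ rho rho0)[d /= d0 Hd].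
  exists (d / 2); first by rewrite divr_gt0.
  move=> k kd; rewrite distrC -h0; apply: Hd; rewrite /ball /= sub0r normrN.
  by apply: le_lt_trans kd _; lra.
exists d => //.
pose t0 := d * K^-1 * (d * K^-1).
have dK : 0 < d * K^-1 by rewrite divr_gt0.
have t00 : 0 < t0 by rewrite mulr_gt0.
have qt0 : isqrt t0 = K / d.
  by rewrite /isqrt /t0 -expr2 sqrtr_sqr gtr0_norm// invf_div.
have [C C0 HC] : exists2 C, 0 <= C & C = lindeberg_const t0.
  by exists (lindeberg_const t0) => //; exact: lindeberg_const_ge0.
(* From here on [C / sqrt n], the sum of the [n] Lindeberg errors, is at most [rho]. *)
exists (Num.bound ((C / rho) ^+ 2)).+1 => n n0 Q B PB QB1 QB2.
have nR : (C / rho) ^+ 2 < n%:R.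
  apply: lt_le_trans (_ : (Num.bound ((C / rho) ^+ 2))%:R <= _); last by rewrite ler_nat ltnW.
  by apply: archi_boundP; exact: sqr_ge0.
have np : 0 < n%:R :> R by apply: le_lt_trans nR; exact: sqr_ge0.
have np1 : 1 <= n%:R :> R by rewrite ler1n -(ltr0n R).
set w := Num.sqrt n%:R in QB1 QB2.
have w0 : 0 < w by rewrite sqrtr_gt0.
have w1 : 1 <= w by rewrite -sqrtr1 ler_wsqrtr.
have ww : w ^+ 2 = n%:R by rewrite sqr_sqrtr// ltW.
have Cw : C / w <= rho.
  rewrite ler_pdivrMr// mulrC -ler_pdivrMr//.
  have Cr0 : 0 <= C / rho by rewrite divr_ge0// ltW.
  by rewrite -(@ler_pXn2r _ 2)// ?nnegrE ?ww; [exact: ltW|exact: ltW].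
(* The minus sign turns the indicator of positive values into that of [centered_sum s] lying below a
   threshold. *)
pose r := - w^-1.
have r1 : `|r| <= 1 by rewrite normrN ger0_norm ?invr_ge0 ?(ltW w0)// invf_le1.
have nr : n%:R * (r ^+ 2 * var) = var by rewrite sqrrN exprVn ww mulrA divff ?mul1r// gt_eqF.
have nC : n%:R * (lindeberg_const t0 * `|r| ^+ 3) = C / w.
  rewrite -HC normrN ger0_norm ?invr_ge0 ?(ltW w0)// -ww exprVn; field; exact: lt0r_neq0.
have lin y := @lindeberg n t0 t0 y r t00 (lexx _) r1.
have lin' k : `|k| <= d -> t0 = k * K^-1 * (k * K^-1) ->
    `|avg A n (fun s => heat t0 (x + 2 * k + r * centered_sum s)) - heat var x| <= 2 * rho.
  move=> kd kt0; have := lin (x + 2 * k); rewrite nr nC => l1.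
  have := Hd _ kd; rewrite /h -kt0 => l2.
  rewrite -[X in `|X|](subrKA (heat (t0 + var) (x + 2 * k))).
  apply: le_trans (ler_normD _ _) _; apply: le_trans (lerD (le_trans l1 Cw) l2) _.
  by rewrite mulr_natl mulr2n.
have cw s (c : R) : (c <= r * centered_sum s) = (centered_sum s <= - c * w).
  rewrite /r mulNr lerNr mulrC ler_pdivrMr//.
have cw' s (c : R) : (r * centered_sum s <= c) = (- c * w <= centered_sum s).
  rewrite /r mulNr lerNl mulrC ler_pdivlMr//.
have up : prob R A n Q <= avg A n (fun s => heat t0 (x + 2 * d + r * centered_sum s)) + rho + rho.
  apply: le_trans (_ : avg A n (fun s => (heat t0 (x + 2 * d + r * centered_sum s) + (B s)%:R) + rho) <= _); last first.
    by rewrite !avgD avg_cst ?(ltnW A1)// lerD2r lerD2l.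
  apply: (le_avg (ltnW A1)) => s ws.
  have hp := gcdf_ge0 1 ((x + 2 * d + r * centered_sum s) * isqrt t0).
  rewrite /heat; case Bs: (B s); first by case: (Q s); rewrite /=; lra.
  case Qs: (Q s); last by rewrite /=; lra.
  have := QB2 s ws (negbT Bs) Qs; rewrite -[x + d]opprK -cw => l.
  have : K <= (x + 2 * d + r * centered_sum s) * isqrt t0.
    rewrite qt0 mulrC -mulrA ler_pMr// mulrC ler_pdivlMr// mul1r; lra.
  by move=> /GK; rewrite /=; lra.
have lo : avg A n (fun s => heat t0 (x + 2 * - d + r * centered_sum s)) - rho - rho <= prob R A n Q.
  apply: le_trans (_ : avg A n (fun s => (heat t0 (x + 2 * - d + r * centered_sum s) - (B s)%:R) - rho) <= _).
    by rewrite !avgB avg_cst ?(ltnW A1)// lerD2r lerD2l lerN2.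
  apply: (le_avg (ltnW A1)) => s ws.
  have hp := gcdf_le1 1 ((x + 2 * - d + r * centered_sum s) * isqrt t0).
  rewrite /heat; case Bs: (B s); first by case: (Q s); rewrite /=; lra.
  case Qs: (Q s); first by rewrite /=; lra.
  have l : r * centered_sum s <= - (x - d).
    rewrite cw' opprK leNgt; apply/negP => /ltW /(QB1 s ws (negbT Bs)).
    by rewrite Qs.
  have : (x + 2 * - d + r * centered_sum s) * isqrt t0 <= - K.
    have -> : - K = - d * isqrt t0 by rewrite qt0; field; rewrite gt_eqF.
    by rewrite ler_wpM2r//; [exact/ltW/isqrt_gt0|lra].
  by move=> /GNK; rewrite /=; lra.
have := lin' d; rewrite gtr0_norm// lexx => /(_ isT erefl).
have := lin' (- d); rewrite normrN gtr0_norm// lexx => /(_ isT).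
rewrite !mulNr mulrN opprK => /(_ erefl).
rewrite !ler_norml; lra.
Qed.

End Lindeberg.

(** * Laws of large numbers *)

Section BoundedDifferences.
Variables (R : realType) (A : nat).
Hypothesis A0 : (0 < A)%N.
Implicit Types (n : nat) (s : seq nat).

(** The word [s1 ++ a :: b :: s2] only serves to say at once that all the letters involved are
    admissible. *)
Definition bounded_diff (f : seq nat -> R) (c : R) := forall s1 a b s2,
  all (fun a => 0 < a <= A)%N (s1 ++ a :: b :: s2) ->
  `|f (s1 ++ a :: s2) - f (s1 ++ b :: s2)| <= c.

Lemma is_word_all n s : is_word A n s -> all (fun a => 0 < a <= A)%N s.
Proof. by case/andP. Qed.

Lemma avg_cat n k (f : seq nat -> R) :
  avg A (n + k) f = avg A n (fun s => avg A k (fun t => f (s ++ t))).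
Proof.
elim: n f => [|n IH] f; first by rewrite avg0.
by rewrite addSn !avgS; congr (_ / _); apply: eq_bigr => a _; rewrite IH.
Qed.

(* Efron-Stein, by conditioning on the first letter. *)
Lemma bounded_diff_variance (f : seq nat -> R) (c : R) n : bounded_diff f c ->
  avg A n (fun s => (f s - avg A n f) ^+ 2) <= n%:R * c ^+ 2.
Proof.
elim: n f => [|n IH] f fc; first by rewrite !avg0 subrr expr0n mul0r.
have AR : 0 < A%:R :> R by rewrite ltr0n.
pose g a s := f (a :: s); pose m a := avg A n (g a).
have mE : avg A n.+1 f = (\sum_(a <- iota 1 A) m a) / A%:R by rewrite avgS.
have c0 : 0 <= c by apply: le_trans (fc [::] 1%N 1%N [::] _); rewrite ?normr_ge0//= A0.
have mab a b : a \in iota 1 A -> b \in iota 1 A -> `|m a - m b| <= c.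
  rewrite !mem_iota !add1n !ltnS => aA bA.
  rewrite -avgB -[leRHS](avg_cst A0 n c).
  apply: le_trans (avg_norm A0 _ _) _; apply: (le_avg A0) => s ws.
  by apply: (fc [::]) => /=; rewrite aA bA; exact: is_word_all ws.
have mm a : a \in iota 1 A -> `|m a - avg A n.+1 f| <= c.
  move=> aA; rewrite mE.
  have -> : m a - (\sum_(a <- iota 1 A) m a) / A%:R = (\sum_(b <- iota 1 A) (m a - m b)) / A%:R.
    rewrite sumrB big_const_seq count_predT iter_addr_0 size_iota -[m a *+ A]mulr_natr.
    by field; lra.
  rewrite normrM [X in _ * X]ger0_norm ?invr_ge0 ?ler0n// ler_pdivrMr//.
  apply: le_trans (ler_norm_sum _ _ _) _.
  apply: le_trans (_ : \sum_(a <- iota 1 A) c <= _); last first.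
    by rewrite big_const_seq count_predT iter_addr_0 size_iota mulr_natr.
  by rewrite big_seq [leRHS]big_seq; apply: ler_sum => b; exact: mab.
rewrite avgS ler_pdivrMr//.
apply: le_trans (_ : \sum_(a <- iota 1 A) (n.+1%:R * c ^+ 2) <= _); last first.
  by rewrite big_const_seq count_predT iter_addr_0 size_iota mulr_natr.
rewrite big_seq [leRHS]big_seq; apply: ler_sum => a aA.
(* The conditional variance given the first letter, left to the induction, plus the squared
   deviation of the conditional mean, bounded by [mm]; the cross term averages to 0. *)
have -> : avg A n (fun s => (f (a :: s) - avg A n.+1 f) ^+ 2) =
    avg A n (fun s => (g a s - m a) ^+ 2) + (m a - avg A n.+1 f) ^+ 2.
  set M := avg A n.+1 f.
  rewrite (@eq_avg _ _ _ _ (fun s => (g a s - m a) ^+ 2 +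
     (2 * (m a - M) * (g a s - m a) + (m a - M) ^+ 2))) => [|s _]; last first.
    by rewrite /g; ring.
  by rewrite !avgD avgZ avgB !(avg_cst A0) -/(m a) subrr mulr0 add0r.
rewrite -[n.+1%:R]natr1 mulrDl mul1r lerD//.
  apply: IH => s1 b1 b2 s2 h; apply: (fc (a :: s1)) => /=.
  by move: aA h; rewrite mem_iota add1n ltnS => ->.
rewrite -[leLHS]real_normK ?num_real//.
by apply: lerXn2r; rewrite ?nnegrE//; exact: mm.
Qed.

(** Chebyshev's inequality for [f] uses half of the tolerance [eta * n]; the other half covers the
    two errors of size [D]. *)
Lemma weak_lln (f l : seq nat -> R) (c k D : R) : bounded_diff f c ->
  (forall n, `|avg A n f - k * n%:R| <= D) ->
  (forall n s, is_word A n s -> `|l s - f s| <= D) ->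
  forall eta : R, 0 < eta -> exists n0, forall n, (n0 <= n)%N ->
    prob R A n (fun s => eta * n%:R < `|l s - k * n%:R|) <= eta.
Proof.
move=> fc fk lf eta e0.
have D0 : 0 <= D by apply: le_trans (fk 0%N).
have e3 : 0 < eta ^+ 3 by rewrite exprn_gt0.
(* The first summand makes [2 * D] at most [eta * n / 2]; the second makes the Chebyshev bound
   [4 c^2 / (eta^2 n)] at most [eta]. *)
pose B := 4 * D / eta + 4 * c ^+ 2 / eta ^+ 3.
have B1 : 0 <= 4 * D / eta by apply: divr_ge0; [exact: mulr_ge0|exact: ltW].
have B2 : 0 <= 4 * c ^+ 2 / eta ^+ 3.
  by apply: divr_ge0; [rewrite mulr_ge0// sqr_ge0|exact: ltW].
exists (Num.bound B).+1 => n nB.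
have nR : B < n%:R.
  apply: lt_le_trans (_ : (Num.bound B)%:R <= _); last by rewrite ler_nat ltnW.
  by apply: archi_boundP; rewrite addr_ge0.
have n0 : 0 < n%:R :> R by apply: le_lt_trans nR; rewrite addr_ge0.
have n1 : 4 * D <= eta * n%:R.
  by rewrite [leRHS]mulrC -ler_pdivrMr//; apply/ltW; apply: le_lt_trans nR; rewrite lerDl.
have n2 : 4 * c ^+ 2 <= eta ^+ 3 * n%:R.
  by rewrite [leRHS]mulrC -ler_pdivrMr//; apply/ltW; apply: le_lt_trans nR; rewrite lerDr.
pose h := eta * n%:R / 2.
have h0 : 0 < h by rewrite divr_gt0// mulr_gt0.
apply: le_trans (_ : prob R A n (fun s => h < `|f s - avg A n f|) <= _).
  apply: (@le_prob R A A0 n) => s ws.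
  have := fk n; have := lf n s ws; rewrite /h => l1 l2 l3.
  have : `|l s - k * n%:R| <= `|l s - f s| + (`|f s - avg A n f| + `|avg A n f - k * n%:R|).
    apply: le_trans (_ : _ <= `|l s - f s| + `|f s - avg A n f + (avg A n f - k * n%:R)|) _.
      by rewrite addrA subrK; apply: le_trans (ler_normD _ _); rewrite subrKA.
    by rewrite lerD2l ler_normD.
  by lra.
apply: le_trans (chebyshev A0 n _ h0) _.
rewrite ler_pdivrMr ?exprn_gt0//.
apply: le_trans (bounded_diff_variance n fc) _.
have -> : eta * h ^+ 2 = n%:R * (eta ^+ 3 * n%:R / 4) by rewrite /h; field.
by rewrite ler_wpM2l//; lra.
Qed.

End BoundedDifferences.

Section LetterSum.
Variables (R : realType) (A : nat).
Hypothesis A0 : (0 < A)%N.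

Lemma letter_sum_lln (eta : R) : 0 < eta -> exists n0, forall n, (n0 <= n)%N ->
  prob R A n (fun s => eta * n%:R < `|(2 * sumn s)%:R - A.+1%:R * n%:R|) <= eta.
Proof.
have AR : 0 < A%:R :> R by rewrite ltr0n.
apply: (@weak_lln R A A0 (fun s => (2 * sumn s)%:R) _ (2 * A%:R) _ 0).
- move=> s1 a b s2; rewrite all_cat /= => /and4P[_ /andP[a0 aA] /andP[b0 bA] _].
  rewrite !natrM !sumn_cat /= !natrD -mulrBr.
  rewrite normrM ger0_norm// ler_pM2l//.
  have -> : (sumn s1)%:R + (a%:R + (sumn s2)%:R) - ((sumn s1)%:R + (b%:R + (sumn s2)%:R)) = a%:R - b%:R :> R by ring.
  have : a%:R <= A%:R :> R by rewrite ler_nat.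
  have : b%:R <= A%:R :> R by rewrite ler_nat.
  have : 0 <= a%:R :> R by [].
  have : 0 <= b%:R :> R by [].
  by rewrite ler_norml => ? ? ? ?; apply/andP; split; lra.
- move=> n; rewrite normr_le0 subr_eq0; apply/eqP.
  elim: n => [|n IH]; first by rewrite avg0 mulr0.
  rewrite avgS.
  transitivity ((\sum_(a <- iota 1 A) (2 * (a%:R - letter_mean R A) + (A.+1%:R + A.+1%:R * n%:R))) / A%:R).
    congr (_ / _); apply: eq_bigr => a _.
    rewrite -IH -[in RHS](avg_cst A0 n (2 * _ + _)) /letter_mean.
    rewrite -[in RHS](avg_cst A0 n A.+1%:R).
    rewrite addrA.
    rewrite (@eq_avg _ _ _ _ (fun s => 2 * a%:R + (2 * sumn s)%:R)) => [|s _]; last first.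
      by rewrite /= mulnDr natrD natrM.
    by rewrite avgD !(avg_cst A0); congr (_ + _); field.
  rewrite big_split /= -mulr_sumr sum_letters mulr0 add0r.
  rewrite big_const_seq count_predT iter_addr_0 size_iota -[_ *+ A]mulr_natr mulfK ?gt_eqF//.
  by rewrite -[n.+1%:R]natr1; ring.
- by move=> n s _; rewrite subrr normr0.
Qed.

End LetterSum.

(** * Continuants *)

Section Continuants.
Implicit Types (s : seq nat) (v : nat * nat).

(* [ccol (1, 0) s] and [ccol (0, 1) s] are the columns of the product of the
   matrices [[a, 1], [1, 0]], a in s. *)
Definition ccol v s : nat * nat := foldr (fun a v => (a * v.1 + v.2, v.1))%N v s.
Definition cont s : nat := (ccol (1, 0)%N s).1.
Notation pos s := (all (fun a => 0 < a)%N s).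

Lemma ccol_lin v s : ccol v s =
  (v.1 * (ccol (1, 0)%N s).1 + v.2 * (ccol (0, 1)%N s).1,
   v.1 * (ccol (1, 0)%N s).2 + v.2 * (ccol (0, 1)%N s).2)%N.
Proof.
elim: s => [|a s /= ->] /=; first by case: v => x y /=; congr pair; lia.
by congr pair => //=; lia.
Qed.

Lemma ccol_order s : pos s ->
  [/\ (0 < cont s)%N, ((ccol (1, 0) s).2 <= cont s)%N, ((ccol (0, 1) s).1 <= cont s)%N
    & ((ccol (0, 1) s).2 <= cont s)%N].
Proof.
(* The induction needs the bottom row to be nonincreasing, which fails only for the identity matrix
   of the empty word. *)
suff H : pos s ->
  [/\ (0 < cont s)%N, ((ccol (1, 0) s).2 <= cont s)%N, ((ccol (0, 1) s).1 <= cont s)%N,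
   ((ccol (0, 1) s).2 <= cont s)%N
   & ((ccol (0, 1) s).2 <= (ccol (1, 0) s).2)%N \/ s = [::] ].
  by move=> /H[].
rewrite /cont; elim: s => [|a s IH] /=; first by split=> //; right.
move=> /andP[a0 /IH [h1 h2 h3 h4 h5]].
case: h5 => [h5|->] /=; last by split; try lia; left; lia.
by split; try nia; left; nia.
Qed.

Lemma ccol_cat v s t : ccol v (s ++ t) = ccol (ccol v t) s.
Proof. exact: foldr_cat. Qed.

(** Euler's identity: for nonempty words the last two factors are the continuants of [s] without its
    last letter and of [t] without its first. *)
Lemma cont_cat s t : cont (s ++ t) = (cont s * cont t + (ccol (0, 1) s).1 * (ccol (1, 0) t).2)%N.
Proof. by rewrite /cont ccol_cat ccol_lin /=; lia. Qed.

Lemma cont_cat_ge s t : (cont s * cont t <= cont (s ++ t))%N.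
Proof. by rewrite cont_cat leq_addr. Qed.

Lemma cont_cat_le s t : pos s -> pos t -> (cont (s ++ t) <= 2 * (cont s * cont t))%N.
Proof.
move=> /ccol_order[_ _ h1 _] /ccol_order[_ h2 _ _]; rewrite cont_cat.
by have := leq_mul h1 h2; lia.
Qed.

(** A continuant is affine in each letter with nonnegative coefficients, and [a <= A * b]. Hence its
    logarithm moves by at most [ln A] when one letter changes. *)
Lemma cont_letter s a b t A : (0 < b)%N -> (a <= A)%N -> (0 < A)%N ->
  (cont (s ++ a :: t) <= A * cont (s ++ b :: t))%N.
Proof.
move=> b0 aA A0; rewrite !cont_cat /cont /=.
set x := (ccol (1, 0) s).1; set y := (ccol (1, 0) t).1; set z := (ccol (1, 0) t).2.
set w := (ccol (0, 1) s).1.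
have h1 : (a * y + z <= A * (b * y + z))%N.
  rewrite mulnDr leq_add ?leq_pmull// mulnA leq_mul2r (leq_trans aA) ?orbT//.
  exact: leq_pmulr.
have := leq_mul (leqnn x) h1.
have : (w * y <= A * (w * y))%N by rewrite leq_pmull.
by lia.
Qed.

End Continuants.

(** * The growth rate of continuants *)

Section ContinuantLln.
Variables (R : realType) (A : nat).
Hypothesis A0 : (0 < A)%N.
Implicit Types (n : nat) (s : seq nat).

Let lnK s : R := ln (cont s)%:R.
Let m n : R := avg A n lnK.

Lemma word_pos n s : is_word A n s -> all (fun a => 0 < a)%N s.
Proof. by case/andP => _; apply: sub_all => a /andP[]. Qed.

Lemma cont_gt0 n s : is_word A n s -> 0 < (cont s)%:R :> R.
Proof. by move=> /word_pos /ccol_order[h _ _ _]; rewrite ltr0n. Qed.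

Let m_super n k : m n + m k <= m (n + k)%N.
Proof.
rewrite /m avg_cat//; apply: le_trans (_ : avg A n (fun s => lnK s + m k) <= _).
  by rewrite avgD (avg_cst A0).
apply: (le_avg A0) => s ws.
apply: le_trans (_ : avg A k (fun t => lnK t + lnK s) <= _).
  by rewrite avgD (avg_cst A0) addrC.
apply: (le_avg A0) => t wt; have h1 := cont_gt0 ws; have h2 := cont_gt0 wt.
have h : 0 < (cont (s ++ t))%:R :> R.
  by apply: lt_le_trans (mulr_gt0 h1 h2) _; rewrite -natrM ler_nat cont_cat_ge.
rewrite /lnK -lnM ?posrE// ler_ln ?posrE ?mulr_gt0//.
by rewrite -natrM ler_nat mulnC cont_cat_ge.
Qed.

Let m_sub n k : m (n + k)%N <= m n + m k + ln 2.
Proof.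
rewrite /m avg_cat//; apply: le_trans (_ : avg A n (fun s => lnK s + (m k + ln 2)) <= _); last first.
  by rewrite avgD (avg_cst A0) addrA.
apply: (le_avg A0) => s ws.
apply: le_trans (_ : avg A k (fun t => lnK t + (lnK s + ln 2)) <= _); last first.
  by rewrite avgD (avg_cst A0) addrCA.
apply: (le_avg A0) => t wt; have h1 := cont_gt0 ws; have h2 := cont_gt0 wt.
have h : 0 < (cont (s ++ t))%:R :> R.
  by apply: lt_le_trans (mulr_gt0 h1 h2) _; rewrite -natrM ler_nat cont_cat_ge.
rewrite /lnK -!lnM ?posrE ?mulr_gt0// ler_ln ?posrE ?mulr_gt0//.
rewrite -!natrM ler_nat mulnCA mulnC -mulnA.
by rewrite mulnC -mulnA cont_cat_le// ?(word_pos ws)// (word_pos wt).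
Qed.

Let m0 : m 0 = 0.
Proof. by rewrite /m avg0 /lnK /cont /= ln1. Qed.

Let m_superM n k : k%:R * m n <= m (n * k)%N.
Proof.
elim: k => [|k IH]; first by rewrite mul0r muln0 m0.
by rewrite mulnS -natr1 mulrDl mul1r addrC; apply: le_trans (m_super _ _); rewrite lerD2l.
Qed.

Let m_subM n k : m (n * k)%N <= k%:R * (m n + ln 2).
Proof.
elim: k => [|k IH]; first by rewrite mul0r muln0 m0.
by rewrite mulnS -natr1 mulrDl mul1r; apply: le_trans (m_sub _ _) _; move: IH; lra.
Qed.

(** Fekete's limit, taken as a supremum: superadditivity and subadditivity up to [ln 2] together
    keep [m n] within [ln 2] of [rate * n]. *)
Let rate : R := sup [set m n.+1 / n.+1%:R | n in setT].

(** Both sides are compared with the mean at the common multiple [n.+1 * k.+1]. *)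
Let m_compare n k : m n.+1 / n.+1%:R <= (m k.+1 + ln 2) / k.+1%:R.
Proof.
rewrite ler_pdivrMr ?ltr0n// mulrAC ler_pdivlMr ?ltr0n//.
rewrite mulrC; apply: le_trans (m_superM _ _) _; rewrite mulnC.
by apply: le_trans (m_subM _ _) _; rewrite mulrC.
Qed.

Let rate_has_sup : has_sup [set m n.+1 / n.+1%:R | n in setT].
Proof.
split; first by exists (m 1 / 1%:R), 0%N.
by exists ((m 1 + ln 2) / 1%:R) => _ [n _ <-]; exact: m_compare.
Qed.

Lemma ln2_gt0 : 0 < ln 2 :> R.
Proof. by rewrite ln_gt0// ltr1n. Qed.

Let m_rate n : `|m n - rate * n%:R| <= ln 2.
Proof.
have l2 := ln2_gt0.
case: n => [|n]; first by rewrite m0 mulr0 subr0 normr0 ltW.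
have n0 : 0 < n.+1%:R :> R by rewrite ltr0n.
have h1 : m n.+1 <= rate * n.+1%:R.
  rewrite -ler_pdivrMr//; apply: sup_upper_bound => //; by exists n.
have h2 : rate * n.+1%:R <= m n.+1 + ln 2.
  rewrite -ler_pdivlMr//; apply: ge_sup; first by case: rate_has_sup.
  by move=> _ [k _ <-]; exact: m_compare.
by rewrite ler_norml; apply/andP; split; lra.
Qed.

(** The continuant [a * b + 1] of two positive letters is at least 2, so [m 2 >= ln 2]. *)
Let rate_gt0 : 0 < rate.
Proof.
apply: lt_le_trans (_ : m 2 / 2%:R <= _); last first.
  by apply: sup_upper_bound => //; exists 1%N.
rewrite divr_gt0//; apply: lt_le_trans ln2_gt0 _.
rewrite -(avg_cst A0 2 (ln 2)); apply: (le_avg A0) => s ws.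
rewrite /lnK ler_ln ?posrE//; last exact: cont_gt0 ws.
rewrite ler_nat; case: s ws => [|a [|b [|? ?]]] //= /andP[_ /=].
by move=> /and3P[/andP[a1 _] /andP[b1 _] _]; rewrite /cont /=; nia.
Qed.

(** [l] is left open so that the geometric length, which is known only up to a bounded error, can be
    inserted. *)
Lemma continuant_lln : exists2 k : R, 0 < k &
  forall (l : seq nat -> R) (D : R),
  (forall n s, is_word A n s -> (0 < n)%N -> `|l s - 2 * ln (cont s)%:R| <= D) ->
  forall eta : R, 0 < eta -> exists n0, forall n, (n0 <= n)%N ->
    prob R A n (fun s => eta * n%:R < `|l s - k * n%:R|) <= eta.
Proof.
exists (2 * rate); first by rewrite mulr_gt0.
move=> l D lD eta e0.
(* [l] is controlled on nonempty words only, while [weak_lln] asks for a bound at every length; the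
   empty word receives the value of [2 * ln 1]. *)
pose l' s := if s is [::] then 0 else l s.
suff F : forall eta : R, 0 < eta -> exists n0, forall n, (n0 <= n)%N ->
    prob R A n (fun s => eta * n%:R < `|l' s - 2 * rate * n%:R|) <= eta.
  have [n0 Hn0] := F eta e0.
  exists n0.+1 => n n0n; apply: le_trans (Hn0 n (ltnW n0n)).
  apply: (@le_prob R A A0 n) => -[|a s] //=.
  by move=> /andP[/eqP] /= nE; rewrite -nE in n0n.
apply: (@weak_lln R A A0 (fun s => 2 * lnK s) l' (2 * ln A%:R) (2 * rate) (2 * ln 2 + `|D|)).
- move=> s1 a b s2; rewrite all_cat /= => /and4P[p1 /andP[a0 aA] /andP[b0 bA] p2].
  have pos_sub s : all (fun a => 0 < a <= A)%N s -> all (fun a => 0 < a)%N s.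
    by apply: sub_all => x /andP[].
  have Ka x : (0 < x)%N -> 0 < (cont (s1 ++ x :: s2))%:R :> R.
    move=> x0; rewrite ltr0n.
    have /ccol_order[] // : all (fun a => 0 < a)%N (s1 ++ x :: s2).
    by rewrite all_cat /= x0 !pos_sub.
  have AR : 0 < A%:R :> R by rewrite ltr0n.
  have le x y : (0 < x)%N -> (0 < y <= A)%N -> lnK (s1 ++ y :: s2) <= ln A%:R + lnK (s1 ++ x :: s2).
    move=> x0 /andP[y0 yA]; rewrite /lnK -lnM ?posrE ?Ka// ler_ln ?posrE ?mulr_gt0 ?Ka//.
    by rewrite -natrM ler_nat cont_letter.
  have h1 := le a b a0; have h2 := le b a b0.
  rewrite a0 aA b0 bA in h1 h2; have := h1 isT; have := h2 isT.
  by rewrite -mulrBr normrM ger0_norm// ler_pM2l// ler_norml => ? ?; apply/andP; split; lra.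
- move=> n; rewrite avgZ -mulrA -mulrBr normrM ger0_norm//.
  apply: le_trans (_ : 2 * ln 2 <= _); last by rewrite lerDl.
  by rewrite ler_pM2l//; exact: m_rate.
- move=> n s ws; have l2 := ln2_gt0; rewrite /l'; case: s ws => [|a s] ws.
    by rewrite /lnK /cont /= ln1 mulr0 subrr normr0 addr_ge0// mulr_ge0// ltW.
  have n0 : (0 < n)%N by case/andP: ws => /eqP <-.
  apply: le_trans (lD n _ ws n0) _; apply: le_trans (ler_norm D) _.
  by rewrite lerDr mulr_ge0// ltW.
Qed.

End ContinuantLln.

(** * SL_2(Z) and the additive continued fraction algorithm *)

Section Mat22.
Implicit Types (a b c d : int) (g h : 'M[int]_2).

Lemma mat22E a b c d : [/\ mat22 a b c d 0 0 = a, mat22 a b c d 0 1 = b,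
  mat22 a b c d 1 0 = c & mat22 a b c d 1 1 = d].
Proof. by split; rewrite mxE. Qed.

Definition mat22_simp := (fun a b c d => let: And4 e1 e2 e3 e4 := mat22E a b c d in (e1, e2, e3, e4)).

Lemma ord2P (k : 'I_2) : k = 0 \/ k = 1.
Proof. by case: k => -[|[|k]] // kk; [left|right]; apply: val_inj. Qed.

Lemma eq_mat22 g h : g 0 0 = h 0 0 -> g 0 1 = h 0 1 -> g 1 0 = h 1 0 ->
  g 1 1 = h 1 1 -> g = h.
Proof.
move=> e1 e2 e3 e4; apply/matrixP => i j.
by case: (ord2P i) => ->; case: (ord2P j) => ->.
Qed.

Lemma mat22_eta g : g = mat22 (g 0 0) (g 0 1) (g 1 0) (g 1 1).
Proof. by apply: eq_mat22; rewrite mat22_simp. Qed.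

Lemma mulmx22E g h i j : (g * h) i j = g i 0 * h 0 j + g i 1 * h 1 j.
Proof.
rewrite mxE !big_ord_recl big_ord0 addr0.
by rewrite (_ : lift ord0 ord0 = 1)//; apply: val_inj.
Qed.

Lemma mat22M a b c d a' b' c' d' : mat22 a b c d * mat22 a' b' c' d' =
  mat22 (a * a' + b * c') (a * b' + b * d') (c * a' + d * c') (c * b' + d * d').
Proof. by apply: eq_mat22; rewrite mulmx22E !mat22_simp. Qed.

Lemma mat22N a b c d : - mat22 a b c d = mat22 (- a) (- b) (- c) (- d).
Proof. by apply: eq_mat22; rewrite mxE !mat22_simp. Qed.

Lemma mat22_1 : 1 = mat22 1 0 0 1.
Proof. by apply: eq_mat22; rewrite !mat22_simp mxE. Qed.

Lemma det22 g : \det g = g 0 0 * g 1 1 - g 0 1 * g 1 0.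
Proof.
rewrite (expand_det_row _ 0) !big_ord_recl big_ord0 addr0 /cofactor !det_mx11 !mxE /=.
have -> : lift ord0 ord0 = 1 :> 'I_2 by apply: val_inj.
have -> : lift (1 : 'I_2) (0 : 'I_1) = 0 :> 'I_2 by apply: val_inj.
by rewrite /bump /= expr0 expr1 mul1r mulN1r mulrN.
Qed.

Lemma tr22 g : \tr g = g 0 0 + g 1 1.
Proof.
rewrite /mxtrace !big_ord_recl big_ord0 addr0.
by rewrite (_ : lift ord0 ord0 = 1)//; apply: val_inj.
Qed.

Definition inv22 g := mat22 (g 1 1) (- g 0 1) (- g 1 0) (g 0 0).

Lemma mulmx22V g : SL2Z g -> g * inv22 g = 1.
Proof.
rewrite /SL2Z /= det22 => dg; apply: eq_mat22; rewrite mulmx22E !mat22_simp mat22_1 !mat22_simp; lia.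
Qed.

Lemma mulVmx22 g : SL2Z g -> inv22 g * g = 1.
Proof.
rewrite /SL2Z /= det22 => dg; apply: eq_mat22; rewrite mulmx22E !mat22_simp mat22_1 !mat22_simp; lia.
Qed.

Lemma SL2Z_mul g h : SL2Z g -> SL2Z h -> SL2Z (g * h).
Proof. by rewrite /SL2Z /= => dg dh; rewrite det_mulmx dg dh. Qed.

Lemma SL2Z_inv g : SL2Z g -> SL2Z (inv22 g).
Proof. by rewrite /SL2Z /= !det22 !mat22_simp; lia. Qed.

Lemma SL2Z_opp g : SL2Z g -> SL2Z (- g).
Proof. by rewrite /SL2Z /= !det22 !mxE !mulrNN. Qed.

Lemma SL2Z_1 : SL2Z 1.
Proof. by rewrite /SL2Z /= det1. Qed.

Lemma inv22E g : SL2Z g -> g^-1 = inv22 g.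
Proof.
move=> sg; have e := mulmx22V sg; have e' := mulVmx22 sg.
have u : g \is a GRing.unit by apply/unitrP; exists (inv22 g).
by rewrite -[LHS]mulr1 -e mulrA mulVr// mul1r.
Qed.

End Mat22.

(** * Action on end points and the additive algorithm *)

Section Moebius.
Variable R : realType.
Implicit Types (x y : R) (g h : 'M[int]_2) (p q : R * R).

(** Irrationality as linear independence of 1 and [x] over the integers, the form in which
    denominators of Moebius maps are seen to be nonzero. *)
Definition irrational_pt x := forall e f : int, e%:~R * x + f%:~R = 0 -> e = 0 /\ f = 0.

Lemma irr_den_neq0 g x : SL2Z g -> irrational_pt x -> (g 1 0)%:~R * x + (g 1 1)%:~R != 0.
Proof.
rewrite /SL2Z /= det22 => dg ix; apply/eqP => /ix[e1 e2].
by rewrite e1 e2 !mulr0 subrr in dg.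
Qed.

Lemma irr_moebius g x : SL2Z g -> irrational_pt x -> irrational_pt (moebius g x).
Proof.
move=> sg ix e f; have dn := irr_den_neq0 sg ix; rewrite /moebius.
move/(congr1 (fun z => z * ((g 1 0)%:~R * x + (g 1 1)%:~R))).
rewrite mul0r mulrDl mulrA divfK// => h.
have /ix[h1 h2] : (e * g 0 0 + f * g 1 0)%:~R * x + (e * g 0 1 + f * g 1 1)%:~R = 0.
  by rewrite -h !rmorphD !rmorphM /=; ring.
move: sg; rewrite /SL2Z /= det22 => dg; split.
  have : (e * g 0 0 + f * g 1 0) * g 1 1 - (e * g 0 1 + f * g 1 1) * g 1 0 = e * (g 0 0 * g 1 1 - g 0 1 * g 1 0) by ring.
  by rewrite h1 h2 !mul0r dg mulr1 subrr.
have : (e * g 0 1 + f * g 1 1) * g 0 0 - (e * g 0 0 + f * g 1 0) * g 0 1 = f * (g 0 0 * g 1 1 - g 0 1 * g 1 0) by ring.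
by rewrite h1 h2 !mul0r dg mulr1 subrr.
Qed.

Lemma moebius_mul g h x : SL2Z g -> SL2Z h -> irrational_pt x ->
  moebius (g * h) x = moebius g (moebius h x).
Proof.
move=> sg sh ix.
have d1 := irr_den_neq0 sh ix; have d2 := irr_den_neq0 sg (irr_moebius sh ix).
have d3 := irr_den_neq0 (SL2Z_mul sg sh) ix.
move: d1 d2 d3; rewrite /moebius !mulmx22E !rmorphD !rmorphM /=.
set u := _ + (h 0 1)%:~R; set v := _ + (h 1 1)%:~R.
have -> : forall k : 'I_2, ((g k 0)%:~R * (h 0 0)%:~R + (g k 1)%:~R * (h 1 0)%:~R) * x +
  ((g k 0)%:~R * (h 0 1)%:~R + (g k 1)%:~R * (h 1 1)%:~R) = (g k 0)%:~R * u + (g k 1)%:~R * v.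
  by move=> k; rewrite /u /v; ring.
have -> : forall k : 'I_2, ((g k 0)%:~R * (h 0 0)%:~R + (g k 1)%:~R * (h 1 0)%:~R) * x +
  ((g k 0)%:~R * (h 0 1)%:~R + (g k 1)%:~R * (h 1 1)%:~R) = (g k 0)%:~R * u + (g k 1)%:~R * v.
  by move=> k; rewrite /u /v; ring.
move=> d1 d2 d3.
have e k : (g k 0)%:~R * (u / v) + (g k 1)%:~R = ((g k 0)%:~R * u + (g k 1)%:~R * v) / v by field.
by rewrite !e invf_div mulrA divfK.
Qed.

Lemma moebius1 x : moebius 1 x = x.
Proof. by rewrite /moebius mat22_1 !mat22_simp mul1r mul0r add0r addr0 divr1. Qed.

Lemma moebiusN g x : moebius (- g) x = moebius g x.
Proof. by rewrite /moebius !mxE !rmorphN /= !mulNr -!opprD invrN mulrNN. Qed.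

Lemma fixes_moebius g x : SL2Z g -> irrational_pt x -> fixes_endpoint g x <-> moebius g x = x.
Proof.
move=> sg ix; have dn := irr_den_neq0 sg ix; rewrite /fixes_endpoint /moebius; split.
  by move=> ->; rewrite mulfK.
by move=> /(congr1 (fun z => z * ((g 1 0)%:~R * x + (g 1 1)%:~R))); rewrite divfK.
Qed.

Definition act g p : R * R := (moebius g p.1, moebius g p.2).
Definition irrational_pair p := irrational_pt p.1 /\ irrational_pt p.2.

Lemma act_mul g h p : SL2Z g -> SL2Z h -> irrational_pair p -> act (g * h) p = act g (act h p).
Proof. by move=> sg sh [i1 i2]; rewrite /act !moebius_mul. Qed.

Lemma act1 p : act 1 p = p.
Proof. by rewrite /act !moebius1; case: p. Qed.

Lemma actN g p : act (- g) p = act g p.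
Proof. by rewrite /act !moebiusN. Qed.

Lemma act_irr g p : SL2Z g -> irrational_pair p -> irrational_pair (act g p).
Proof. by move=> sg [i1 i2]; split; exact: irr_moebius. Qed.

Lemma actK g p : SL2Z g -> irrational_pair p -> act (inv22 g) (act g p) = p.
Proof. by move=> sg ip; rewrite -act_mul// ?mulVmx22 ?act1//; exact: SL2Z_inv. Qed.

(* t^2 - 4 is not a square when |t| > 2. *)
Lemma hyperbolic_irr g x : SL2Z g -> 2 < `|\tr g| -> fixes_endpoint g x -> irrational_pt x.
Proof.
rewrite /SL2Z /= det22 tr22 /fixes_endpoint => dg tg fx e f ef.
set a := g 0 0 in dg tg fx; set b := g 0 1 in dg fx; set c := g 1 0 in dg fx.
set d := g 1 1 in dg tg fx.
have [e0|e0] := eqVneq e 0.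
  by split=> //; move: ef; rewrite e0 mul0r add0r => /eqP; rewrite intr_eq0 => /eqP.
exfalso.
(* Completing the square in the fixed-point equation at [x = - f / e]. Then [e] divides the base of
   the left-hand square, and the quotient [m] is an integer square root of [(a + d) ^+ 2 - 4]. *)
have h : ((2 * c * (- f) + (d - a) * e) ^+ 2 = ((a + d) ^+ 2 - 4) * e ^+ 2)%R.
  apply/eqP; rewrite -(eqr_int R); apply/eqP.
  have fE : f%:~R = - (e%:~R * x) by apply/eqP; rewrite -addr_eq0 addrC ef.
  have bE : b%:~R = x * (c%:~R * x + d%:~R) - a%:~R * x by rewrite -fx; ring.
  have dgR : a%:~R * d%:~R - b%:~R * c%:~R = 1 :> R by rewrite -!rmorphM -rmorphB /= dg.
  have -> : (a + d) ^+ 2 - 4 = (a + d) ^+ 2 - 4 * (a * d - b * c) by rewrite dg mulr1.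
  rewrite !(rmorphM, rmorphD, rmorphN, rmorphXn, rmorphB) /= fE bE; ring.
have : (e ^+ 2 %| (2 * c * (- f) + (d - a) * e) ^+ 2)%Z by rewrite h dvdz_mull.
rewrite dvdz_pexp2r// => /dvdzP[m mE].
move: h; rewrite mE exprMn => /(mulIf _)h.
have {}h : m ^+ 2 = (a + d) ^+ 2 - 4 by apply: h; rewrite expf_neq0.
rewrite -(real_normK (num_real m)) -(real_normK (num_real (a + d))) in h.
move: tg h (normr_ge0 m) => /=; move: `|m| `|a + d| => u t t3 h u0.
have [ut|ut] := leP t u; first by nia.
have : u + 1 <= t by lia.
by nia.
Qed.

(* One step of the additive continued fraction algorithm: subtract 1 from the
   positive end point or from its inverse. *)
Definition fstep p : R * R :=
  if 1 < p.2 then (p.1 - 1, p.2 - 1) else (p.1 / (1 - p.1), p.2 / (1 - p.2)).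

Definition Tmx := mat22 1 1 0 1.
Definition Umx := mat22 1 0 1 1.
Definition lrmx (w : seq bool) : 'M[int]_2 := \prod_(b <- w) (if b then Tmx else Umx).

Lemma lrmx_cons b w : lrmx (b :: w) = (if b then Tmx else Umx) * lrmx w.
Proof. by rewrite /lrmx big_cons. Qed.

Lemma lrmx_cat w w' : lrmx (w ++ w') = lrmx w * lrmx w'.
Proof. by rewrite /lrmx big_cat. Qed.

Lemma SL2Z_T : SL2Z Tmx.
Proof. by rewrite /SL2Z /= det22 !mat22_simp. Qed.

Lemma SL2Z_U : SL2Z Umx.
Proof. by rewrite /SL2Z /= det22 !mat22_simp. Qed.

Lemma SL2Z_lr w : SL2Z (lrmx w).
Proof.
elim: w => [|b w IH]; first by rewrite /lrmx big_nil; exact: SL2Z_1.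
by rewrite lrmx_cons; apply: SL2Z_mul IH; case: b; [exact: SL2Z_T|exact: SL2Z_U].
Qed.

Definition nonneg_mx g := [/\ 0 <= g 0 0, 0 <= g 0 1, 0 <= g 1 0 & 0 <= g 1 1].

Lemma lr_nonneg w : nonneg_mx (lrmx w).
Proof.
elim: w => [|b w [h1 h2 h3 h4]].
  by rewrite /lrmx big_nil mat22_1 /nonneg_mx !mat22_simp.
by rewrite lrmx_cons /nonneg_mx !mulmx22E; case: b; rewrite !mat22_simp; split; lia.
Qed.

(** Unless [g] is the identity, determinant 1 forces one row to dominate the other entrywise.
    Subtracting the smaller row strips off a factor [Tmx] or [Umx] and lowers the sum of the
    entries. *)
Lemma lr_factor g : SL2Z g -> nonneg_mx g -> exists w, g = lrmx w.
Proof.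
move=> sg ng.
have [n] := ubnP (`|g 0%R 0%R| + `|g 0%R 1%R| + `|g 1%R 0%R| + `|g 1%R 1%R|)%N.
elim: n g sg ng => // n IH g sg [h1 h2 h3 h4] hn.
have dg : g 0 0 * g 1 1 - g 0 1 * g 1 0 = 1 by rewrite -det22.
set a := g 0 0 in h1 dg hn; set b := g 0 1 in h2 dg hn.
set c := g 1 0 in h3 dg hn; set d := g 1 1 in h4 dg hn.
have [gI|[[ac bd]|[ca db]]] : (a = 1 /\ b = 0 /\ c = 0 /\ d = 1) \/ (c <= a /\ b >= d) \/ (a <= c /\ b <= d).
- have [ac|ac] := leP c a; have [bd|bd] := leP d b; [by right; left| | |by right; right; split; lia].
  + have [e|e] := eqVneq a c; first by right; right; split; lia.
    have : c + 1 <= a by lia.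
    have : b + 1 <= d by lia.
    by left; nia.
  + by exfalso; nia.
- exists [::]; rewrite /lrmx big_nil mat22_1 [g]mat22_eta -/a -/b -/c -/d.
  by case: gI => -> [-> [-> ->]].
- have [w wE] : exists w, mat22 (a - c) (b - d) c d = lrmx w.
    apply: IH; rewrite /SL2Z /nonneg_mx /= ?det22 !mat22_simp; [lia|split; lia|].
    have cd0 : 0 < c \/ 0 < d by nia.
    by lia.
  exists (true :: w); rewrite lrmx_cons -wE mat22M [LHS]mat22_eta -/a -/b -/c -/d.
  by congr mat22; ring.
- have [w wE] : exists w, mat22 a b (c - a) (d - b) = lrmx w.
    apply: IH; rewrite /SL2Z /nonneg_mx /= ?det22 !mat22_simp; [lia|split; lia|].
    have ab0 : 0 < a \/ 0 < b by nia.
    by lia.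
  exists (false :: w); rewrite lrmx_cons -wE mat22M [LHS]mat22_eta -/a -/b -/c -/d.
  by congr mat22; ring.
Qed.

Lemma lr_pos w x : irrational_pt x -> 0 < x -> 0 < moebius (lrmx w) x.
Proof.
move=> ix x0; have [h1 h2 h3 h4] := lr_nonneg w.
have i := irr_moebius (SL2Z_lr w) ix.
have h : 0 <= moebius (lrmx w) x.
  by rewrite /moebius divr_ge0// addr_ge0// ?mulr_ge0 ?ler0z// ltW.
rewrite lt_neqAle h andbT; apply/eqP => e.
have [] := i 1 0; last by [].
by rewrite -e mulr0 addr0.
Qed.

Lemma irr_neq x (e f : int) : irrational_pt x -> e != 0 -> e%:~R * x + f%:~R != 0.
Proof. by move=> ix; apply: contra => /eqP /ix[->]. Qed.

(** [Tmx] sends a positive point above 1 and [Umx] sends it below 1, so [fstep] recognises the first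
    letter and removes it. *)
Lemma fstep_lr w q : irrational_pair q -> 0 < q.2 ->
  iter (size w) fstep (act (lrmx w) q) = q.
Proof.
move=> iq q0; elim: w => [|b w IH]; first by rewrite /lrmx big_nil act1.
rewrite [size _]/= iterSr -[RHS]IH; congr iter.
rewrite lrmx_cons act_mul//; [|by case: b; [exact: SL2Z_T|exact: SL2Z_U]|exact: SL2Z_lr].
have r0 : 0 < (act (lrmx w) q).2 by apply: lr_pos q0; case: iq.
have [i1 i2] := act_irr (SL2Z_lr w) iq.
move: (act (lrmx w) q) r0 i1 i2 => [y x] /= x0 iy ix.
rewrite /fstep /act; case: b; rewrite /moebius !mat22_simp /=.
  by rewrite !mul0r !add0r !divr1 !mul1r ltrDr x0 !addrK.
rewrite !mul1r !addr0 ltNge.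
have x1 : 0 < x + 1 by rewrite addr_gt0.
rewrite ler_pdivrMr// mul1r lerDl ler01 /=.
have y1 : y + 1 != 0 by have := irr_neq 1 iy (isT : (1 : int) != 0); rewrite mul1r.
have e (z : R) : z + 1 != 0 -> z / (z + 1) / (1 - z / (z + 1)) = z.
  move=> z1; have -> : 1 - z / (z + 1) = (z + 1)^-1 by field.
  by rewrite invrK divfK.
by rewrite !e// gt_eqF.
Qed.

Definition crossing p := p.1 < 0 < p.2.

(** If [b * c >= 0], then [a * d >= 1], so [a] and [d] share a sign, as do [b] and [c]: either all
    four agree or the inverse has this property. If [b * c < 0], then [a * d <= 0], and at one of
    the end points the signs of numerator and denominator contradict the sign of the image. *)
Lemma crossing_sign g p : SL2Z g -> irrational_pair p -> crossing p -> crossing (act g p) ->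
  exists h, [/\ h = g \/ h = - g & nonneg_mx h \/ nonneg_mx (inv22 h)].
Proof.
move=> sg [i1 i2] /andP[p1 p2] /andP[/=].
have d1 := irr_den_neq0 sg i1; have d2 := irr_den_neq0 sg i2.
have dg : g 0 0 * g 1 1 - g 0 1 * g 1 0 = 1 by rewrite -det22.
rewrite /moebius => q1 q2.
have {}q1 : ((g 0 0)%:~R * p.1 + (g 0 1)%:~R) * ((g 1 0)%:~R * p.1 + (g 1 1)%:~R) < 0.
  rewrite (_ : _ * _ = ((g 0 0)%:~R * p.1 + (g 0 1)%:~R) / ((g 1 0)%:~R * p.1 + (g 1 1)%:~R) *
    ((g 1 0)%:~R * p.1 + (g 1 1)%:~R) ^+ 2); last by field.
  by rewrite pmulr_llt0// exprn_even_gt0.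
have {}q2 : 0 < ((g 0 0)%:~R * p.2 + (g 0 1)%:~R) * ((g 1 0)%:~R * p.2 + (g 1 1)%:~R).
  rewrite (_ : _ * _ = ((g 0 0)%:~R * p.2 + (g 0 1)%:~R) / ((g 1 0)%:~R * p.2 + (g 1 1)%:~R) *
    ((g 1 0)%:~R * p.2 + (g 1 1)%:~R) ^+ 2); last by field.
  by rewrite pmulr_lgt0// exprn_even_gt0.
set a := g 0 0 in dg q1 q2; set b := g 0 1 in dg q1 q2.
set c := g 1 0 in dg q1 q2; set d := g 1 1 in dg q1 q2.
have eN : [/\ (- g) 0 0 = - a, (- g) 0 1 = - b, (- g) 1 0 = - c & (- g) 1 1 = - d] by rewrite !mxE.
case: eN => N1 N2 N3 N4.
(* [s] is the sign of [c] and [- b], and [t * s] that of [a] and [- d]. The contradiction arises at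
   [p.1] for [t = 1] and at [p.2] for [t = -1]. *)
have bad (s t : int) : s * s = 1 -> 0 <= s * c -> s * b <= 0 -> 0 <= t * s * a -> t * s * d <= 0 ->
    t = 1 \/ t = -1 -> False.
  move=> ss sc sb ta td tt.
  have ssR : s%:~R * s%:~R = 1 :> R by rewrite -rmorphM ss.
  have scR : 0 <= s%:~R * c%:~R :> R by rewrite -rmorphM ler0z.
  have sbR : s%:~R * b%:~R <= 0 :> R by rewrite -rmorphM lerz0.
  have taR : 0 <= t%:~R * s%:~R * a%:~R :> R by rewrite -!rmorphM ler0z.
  have tdR : t%:~R * s%:~R * d%:~R <= 0 :> R by rewrite -!rmorphM lerz0.
  case: tt => tE; rewrite tE ?mul1r ?mulN1r ?mulNr in taR tdR.
    have n1 : s%:~R * a%:~R * p.1 + s%:~R * b%:~R <= 0 by have := mulr_ge0_le0 taR (ltW p1); lra.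
    have n2 : s%:~R * c%:~R * p.1 + s%:~R * d%:~R <= 0 by have := mulr_ge0_le0 scR (ltW p1); lra.
    have := mulr_le0 n1 n2.
    have -> : (s%:~R * a%:~R * p.1 + s%:~R * b%:~R) * (s%:~R * c%:~R * p.1 + s%:~R * d%:~R) =
      (s%:~R * s%:~R) * ((a%:~R * p.1 + b%:~R) * (c%:~R * p.1 + d%:~R)) by ring.
    by rewrite ssR mul1r; lra.
  have n1 : s%:~R * a%:~R * p.2 + s%:~R * b%:~R <= 0.
    have h : s%:~R * a%:~R <= 0 :> R by lra.
    by have := mulr_le0_ge0 h (ltW p2); lra.
  have n2 : 0 <= s%:~R * c%:~R * p.2 + s%:~R * d%:~R.
    by have := mulr_ge0 scR (ltW p2); lra.
  have := mulr_le0_ge0 n1 n2.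
  have -> : (s%:~R * a%:~R * p.2 + s%:~R * b%:~R) * (s%:~R * c%:~R * p.2 + s%:~R * d%:~R) =
      (s%:~R * s%:~R) * ((a%:~R * p.2 + b%:~R) * (c%:~R * p.2 + d%:~R)) by ring.
  by rewrite ssR mul1r; lra.
have [bc0|bc0] := leP 0 (b * c).
  have ad : 1 <= a * d by lia.
  have [a0|a0] := leP 0 a.
    have d0 : 0 <= d by nia.
    exists g; split; first by left.
    have [[b0 c0]|[b0 c0]] : (0 <= b /\ 0 <= c) \/ (b <= 0 /\ c <= 0) by nia.
      by left; split.
    by right; rewrite /nonneg_mx /inv22 !mat22_simp -/a -/b -/c -/d; split; lia.
  have d0 : d <= 0 by nia.
  exists (- g); split; first by right.
  have [[b0 c0]|[b0 c0]] : (0 <= b /\ 0 <= c) \/ (b <= 0 /\ c <= 0) by nia.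
    by right; rewrite /nonneg_mx /inv22 !mat22_simp N1 N2 N3 N4; split; lia.
  by left; rewrite /nonneg_mx N1 N2 N3 N4; split; lia.
exfalso.
have ad : a * d <= 0 by lia.
have [[c0 b0]|[c0 b0]] : (0 <= c /\ b <= 0) \/ (c <= 0 /\ 0 <= b) by nia.
  have [[a0 d0]|[a0 d0]] : (0 <= a /\ d <= 0) \/ (a <= 0 /\ 0 <= d) by nia.
    by apply: (bad 1 1) => //; rewrite ?mul1r//; left.
  by apply: (bad 1 (-1)) => //; rewrite ?mul1r ?mulr1 ?mulN1r ?oppr_ge0 ?oppr_le0//; right.
have [[a0 d0]|[a0 d0]] : (0 <= a /\ d <= 0) \/ (a <= 0 /\ 0 <= d) by nia.
  by apply: (bad (-1) (-1)) => //; rewrite ?mulrNN ?mulN1r ?mul1r ?oppr_ge0 ?oppr_le0//; right.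
by apply: (bad (-1) 1) => //; rewrite ?mulrNN ?mulN1r ?mul1r ?mulN1r ?oppr_ge0 ?oppr_le0//; left.
Qed.

(** Whether [h] or its inverse is nonnegative decides which of the two geodesics comes first in the
    algorithm. *)
Lemma crossing_fstep g p : SL2Z g -> irrational_pair p -> crossing p -> crossing (act g p) ->
  exists k, iter k fstep (act g p) = p \/ iter k fstep p = act g p.
Proof.
move=> sg ip cp cq; have [h [hg hn]] := crossing_sign sg ip cp cq.
have sh : SL2Z h by case: hg => ->//; exact: SL2Z_opp.
have hE : act g p = act h p by case: hg => ->; rewrite ?actN.
rewrite hE in cq *; case: hn => hn.
  have [w wE] := lr_factor sh hn; exists (size w); left.
  by rewrite wE fstep_lr//; case/andP: cp.
have [w wE] := lr_factor (SL2Z_inv sh) hn; exists (size w); right.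
rewrite -{1}(actK sh ip) wE fstep_lr//; first exact: act_irr.
by case/andP: cq.
Qed.

End Moebius.

(** * Complete quotients of continued fractions *)

Section CfTails.
Variable R : realType.
Implicit Types (al be : nat -> nat) (x z : nat -> R) (y : R) (p q : R * R).

(** [al] lists the partial quotients and [x] the complete quotients; giving both as sequences
    describes an infinite expansion without a limit. *)
Definition cf_tails al x := forall i, [/\ (0 < al i)%N, 1 < x i & x i = (al i)%:R + (x i.+1)^-1].

Lemma cf_tails_shift al x k : cf_tails al x -> cf_tails (fun i => al (i + k)%N) (fun i => x (i + k)%N).
Proof. by move=> h i; exact: h. Qed.

Lemma cf_tails_inv al x i : cf_tails al x -> 0 < (x i)^-1 < 1.
Proof.
move=> ha; have [_ x1 _] := ha i.
by rewrite invr_gt0 invf_lt1 ?x1 ?andbT (lt_trans _ x1).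
Qed.

Lemma cf_digits_unique al be x z : cf_tails al x -> cf_tails be z -> x 0 = z 0 ->
  forall i, al i = be i /\ x i = z i.
Proof.
move=> ha hb e.
have dig i : x i = z i -> al i = be i.
  have [_ _ e1] := ha i; have [_ _ e2] := hb i => xz.
  have /andP[? ?] := cf_tails_inv i.+1 ha; have /andP[? ?] := cf_tails_inv i.+1 hb.
  have l1 : (al i)%:R < (be i)%:R + 1 :> R by lra.
  have l2 : (be i)%:R < (al i)%:R + 1 :> R by lra.
  rewrite natr1 ltr_nat ltnS in l1; rewrite natr1 ltr_nat ltnS in l2.
  by apply/eqP; rewrite eqn_leq l1 l2.
move=> i; have {}e : x i = z i; last by split=> //; exact: dig.
elim: i => [//|i IH]; apply: invr_inj.
have [_ _ e1] := ha i; have [_ _ e2] := hb i; have := dig i IH => ab.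
rewrite ab in e1; lra.
Qed.

(** The negative end point under the shift that sends [x i] to [x i.+1]. *)
Fixpoint back al y i : R := if i is j.+1 then (back al y j - (al j)%:R)^-1 else y.

Lemma back_add al y i k : back al y (i + k)%N = back (fun j => al (j + k)%N) (back al y k) i.
Proof. by elim: i => //= i ->. Qed.

Lemma back_reduced al x y i : cf_tails al x -> -1 < y < 0 -> -1 < back al y i < 0.
Proof.
move=> ha y01; elim: i => //= i /andP[y1 y0]; have [a0 _ _] := ha i.
have a1 : 1 <= (al i)%:R :> R by rewrite ler1n.
rewrite invr_lt0 subr_lt0 (lt_le_trans y0) ?ler0n// andbT.
rewrite -[X in X < _]invrK ltf_nV2 ?negrE ?invrN1 ?invr1; lra.
Qed.

Definition reduced p := (-1 < p.1 < 0) && (1 < p.2).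

Lemma fstep_T al x y k : cf_tails al x -> (k <= al 0)%N ->
  iter k (@fstep R) (y, x 0) = (y - k%:R, x 0 - k%:R).
Proof.
move=> ha; elim: k => [|k IH] ka; first by rewrite !subr0.
rewrite iterS IH ?(ltnW ka)// /fstep /=.
have [_ _ e] := ha 0%N; have [_ x1 _] := ha 1%N.
have i0 : 0 < (x 1%N)^-1 by rewrite invr_gt0 (lt_trans _ x1).
have : k.+1%:R <= (al 0%N)%:R :> R by rewrite ler_nat.
rewrite -natr1 => ka'; have -> : 1 < x 0 - k%:R by lra.
by congr pair; ring.
Qed.

Lemma fstep_U al x y k : cf_tails al x -> y < 0 -> (k <= al 0)%N ->
  iter k (@fstep R) (y^-1, (x 0)^-1) = ((y - k%:R)^-1, (x 0 - k%:R)^-1).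
Proof.
move=> ha y0; elim: k => [|k IH] ka; first by rewrite !subr0.
rewrite iterS IH ?(ltnW ka)// /fstep /=.
have [_ _ e] := ha 0%N; have [_ x1 _] := ha 1%N.
have i0 : 0 < (x 1%N)^-1 by rewrite invr_gt0 (lt_trans _ x1).
have : k.+1%:R <= (al 0%N)%:R :> R by rewrite ler_nat.
rewrite -natr1 => ka'; have xk : 1 < x 0 - k%:R by lra.
have k0 : 0 <= k%:R :> R by [].
have lt1 : (x 0%N - k%:R)^-1 < 1 by rewrite invf_lt1//; lra.
rewrite ltNge (ltW lt1) /=.
by congr pair; field; apply/andP; split; apply/negP => /eqP; lra.
Qed.

(** The first [al 0] steps bring the positive end point below 1, and [al 1] steps on the inverses
    bring it back above 1: one even shift of the expansion. *)
Lemma fstep_tails2 al x y : cf_tails al x -> -1 < y < 0 ->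
  iter (al 0 + al 1)%N (@fstep R) (y, x 0) = (back al y 2, x 2%N).
Proof.
move=> ha y01; rewrite addnC iterD (fstep_T _ ha)//.
have [_ _ e] := ha 0%N; have [_ _ e1] := ha 1%N.
have -> : x 0 - (al 0%N)%:R = (x 1%N)^-1 by rewrite e; ring.
have -> : y - (al 0%N)%:R = (back al y 1)^-1 by rewrite /= invrK.
have /andP[_ b0] := back_reduced 1 ha y01.
have -> := @fstep_U _ _ (back al y 1) (al 1%N) (cf_tails_shift 1 ha) b0 (leqnn _).
rewrite !add0n.
congr pair; rewrite e1 addrAC subrr add0r invrK//.
Qed.

(** Strictly inside a block of [al 0 + al 1] steps no iterate is reduced: before the first digit is
    used up the negative end point lies below -1, and afterwards the positive one lies below 1. So
    only whole blocks are possible. *)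
Lemma fstep_return al x y k : cf_tails al x -> -1 < y < 0 ->
  reduced (iter k (@fstep R) (y, x 0)) -> exists j, k = (\sum_(i < j.*2) al i)%N
   /\ iter k (@fstep R) (y, x 0) = (back al y j.*2, x j.*2).
Proof.
have [n] := ubnP k; elim: n k al x y => // n IH k al x y kn ha y01 red.
have [a0 _ e0] := ha 0%N; have [a1 x1 e1] := ha 1%N.
have [k0|k0] := posnP k; first by exists 0%N; rewrite k0 big_ord0.
have /andP[y1 y0] := y01.
have ka : (al 0 + al 1 <= k)%N.
  rewrite leqNgt; apply/negP => kaa; move: red.
  have [ka|ka] := ltnP k (al 0%N).
    rewrite (fstep_T _ ha (ltnW ka)) /reduced /=.
    have : 1 <= k%:R :> R by rewrite ler1n.
    by move=> k1 /andP[/andP[]]; lra.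
  have kE : k = ((k - al 0) + al 0)%N by rewrite subnK.
  rewrite kE iterD (fstep_T _ ha)//.
  have -> : x 0 - (al 0%N)%:R = (x 1%N)^-1 by rewrite e0; ring.
  have -> : y - (al 0%N)%:R = (back al y 1)^-1 by rewrite /= invrK.
  have /andP[_ b0] := back_reduced 1 ha y01.
  have kl : (k - al 0 < al 1)%N by rewrite ltn_subLR.
  have -> := @fstep_U _ _ (back al y 1) _ (cf_tails_shift 1 ha) b0 (ltnW kl).
  rewrite /reduced /= add0n => /andP[_]; apply/negP; rewrite -leNgt.
  have i0 : 0 < (x 2%N)^-1 by have [_ x2 _] := ha 2%N; rewrite invr_gt0 (lt_trans _ x2).
  have : (k - al 0).+1%:R <= (al 1%N)%:R :> R by rewrite ler_nat.
  by rewrite -natr1 => h; rewrite invf_le1; lra.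
have kE : k = ((k - (al 0 + al 1)) + (al 0 + al 1))%N by rewrite subnK.
set k' := (k - (al 0 + al 1))%N in kE.
move: red; rewrite kE iterD (fstep_tails2 ha y01) => red.
have [||j [kj ej]] := IH k' (fun i => al (i + 2)%N) (fun i => x (i + 2)%N) (back al y 2) _ (cf_tails_shift 2 ha) _ red.
- by rewrite /k'; lia.
- exact: back_reduced ha y01.
exists j.+1; rewrite doubleS; split; last by rewrite -[j.*2.+2]addn2 (back_add al y j.*2 2); exact: ej.
rewrite !big_ord_recl kj addnC -addnA; congr (_ + (_ + _))%N.
by apply: eq_bigr => i _; rewrite addn2.
Qed.

Lemma finite_cf_ge0 s : 0 <= finite_cf R s.
Proof. by elim: s => //= a s IH; rewrite addr_ge0// invr_ge0. Qed.

(** Two digits together divide the error by at least 4, and a quarter of [2 / (k + 1)] is at most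
    [2 / (k + 3)]. This crude rate suffices for convergence. *)
Lemma finite_cf_tails al x k : cf_tails al x ->
  `|finite_cf R (mkseq al k.+1) - x 0| <= 2 * k.+1%:R^-1.
Proof.
have mkS f m : mkseq f m.+1 = f 0%N :: mkseq (fun i => f (i + 1)%N) m.
  rewrite /mkseq -[m.+1]add1n iotaD /= add0n (iotaDl 1 0) -map_comp; congr cons.
  by apply: eq_map => i /=; rewrite add1n addn1.
have ge1 f m : (0 < f 0)%N -> 1 <= finite_cf R (mkseq f m.+1).
  move=> f0; rewrite mkS /= ; have h : 1 <= (f 0)%:R :> R by rewrite ler1n.
  by apply: le_trans h _; rewrite lerDl invr_ge0 finite_cf_ge0.
have [n] := ubnP k; elim: n k al x => // n IH k al x kn ha.
have [a0 _ e0] := ha 0%N; have [a1 x1 e1] := ha 1%N; have [a2 x2 e2] := ha 2%N.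
have i1 : 0 < (x 1%N)^-1 by rewrite invr_gt0 (lt_trans _ x1).
have i1' : (x 1%N)^-1 < 1 by rewrite invf_lt1 // (lt_trans _ x1).
case: k kn => [|[|k]] kn.
- rewrite mkS /= invr0 addr0 e0 opprD addrA subrr add0r normrN invr1 mulr1.
  by rewrite gtr0_norm//; lra.
- rewrite mkS mkS /= invr0 addr0 e0 opprD addrACA subrr add0r add0n divff//.
  have b1 : 1 <= (al 1%N)%:R :> R by rewrite ler1n.
  have b2 : 0 < (al 1%N)%:R^-1 :> R by rewrite invr_gt0; lra.
  have b3 : (al 1%N)%:R^-1 <= 1 :> R by rewrite invf_le1//; lra.
  by rewrite ler_norml; apply/andP; split; lra.
have kn' : (k < n)%N by lia.
have := IH k _ _ kn' (cf_tails_shift 2 ha).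
have -> : mkseq al k.+3 = [:: al 0%N, al 1%N & mkseq (fun i => al (i + 2)%N) k.+1].
  by rewrite mkS mkS; congr [:: _, _ & _]; apply: eq_map => i; rewrite -addnA.
have -> l : finite_cf R [:: al 0%N, al 1%N & l] = (al 0%N)%:R + ((al 1%N)%:R + (finite_cf R l)^-1)^-1 by [].
have u1 := ge1 (fun i => al (i + 2)%N) k a2.
set u := finite_cf _ _ in u1 *; set v := x 2%N in x2 e1 *.
rewrite e0 e1 opprD addrACA subrr add0r => uv.
set a := (al 1%N)%:R in e1 *; have b1 : 1 <= a by rewrite ler1n.
have U0 : 0 < a + u^-1 by rewrite addr_gt0 ?invr_gt0; lra.
have V0 : 0 < a + v^-1 by rewrite addr_gt0 ?invr_gt0; lra.
have -> : (a + u^-1)^-1 - (a + v^-1)^-1 = (u - v) / ((a * u + 1) * (a * v + 1)).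
  have au : 0 < a * u + 1 by nra.
  have av : 0 < a * v + 1 by nra.
  by field; rewrite !gt_eqF//=; lra.
have au : 2 <= a * u + 1 by nra.
have av : 2 <= a * v + 1 by nra.
have dd : 4 <= (a * u + 1) * (a * v + 1) by nra.
have d0 : 0 < (a * u + 1) * (a * v + 1) by lra.
rewrite normrM normfV (gtr0_norm d0).
rewrite ler_pdivrMr; last by lra.
apply: le_trans uv _; apply: le_trans (_ : 2 * k.+3%:R^-1 * 4 <= _); last first.
  by rewrite ler_wpM2l// mulr_ge0// invr_ge0.
rewrite -mulrA ler_pM2l// mulrC ler_pdivlMr ?ltr0n// mulrC ler_pdivrMr ?ltr0n//.
by rewrite -natrM ler_nat; clear; lia.
Qed.

Lemma finite_cf_cvg al x : cf_tails al x ->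
  (fun k : nat => finite_cf R (mkseq al k)) @ \oo --> x 0.
Proof.
move=> ha; rewrite -(@cvg_shiftS _ (fun k : nat => finite_cf R (mkseq al k))).
apply/cvgrPdist_le => e e0.
have h : (fun n => 2 * harmonic n : R) @ \oo --> (2 * 0 : R).
  by apply: cvgM; [exact: cvg_cst|exact: cvg_harmonic].
move/cvgrPdist_le: h => /(_ e e0); rewrite mulr0 => h.
near=> k; rewrite distrC; apply: le_trans (finite_cf_tails k ha) _.
have : `|0 - 2 * @harmonic R k| <= e by near: k.
by rewrite sub0r normrN ger0_norm ?mulr_ge0 ?invr_ge0.
Unshelve. all: by end_near. Qed.

End CfTails.

(** * Coding of closed geodesics *)

Section Codes.
Variable R : realType.
Implicit Types (s t : seq nat) (p q : R * R).

Definition cfmx s : 'M[int]_2 := \prod_(a <- s) mat22 a%:Z 1 1 0.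

Lemma cfmx_cons a s : cfmx (a :: s) = mat22 a%:Z 1 1 0 * cfmx s.
Proof. by rewrite /cfmx big_cons. Qed.

Lemma cfmxE s : cfmx s = mat22 (ccol (1, 0)%N s).1%:Z (ccol (0, 1)%N s).1%:Z
  (ccol (1, 0)%N s).2%:Z (ccol (0, 1)%N s).2%:Z.
Proof.
elim: s => [|a s IH]; first by rewrite /cfmx big_nil mat22_1.
rewrite cfmx_cons IH mat22M /=; congr mat22; rewrite ?PoszD ?PoszM; ring.
Qed.

Definition even_code s := [&& (0 < size s)%N, ~~ odd (size s) & all (fun a => 0 < a)%N s].

Lemma det_cfmx s : \det (cfmx s) = (-1) ^+ size s.
Proof.
elim: s => [|a s IH]; first by rewrite /cfmx big_nil det1.
by rewrite cfmx_cons det_mulmx IH det22 !mat22_simp /= exprS; ring.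
Qed.

Lemma SL2Z_cfmx s : ~~ odd (size s) -> SL2Z (cfmx s).
Proof. by move=> os; rewrite /SL2Z /= det_cfmx -signr_odd (negbTE os). Qed.

Lemma even_code2 s : even_code s -> exists a b t, s = [:: a, b & t] /\ ~~ odd (size t) /\
  (0 < a)%N /\ (0 < b)%N /\ all (fun a => 0 < a)%N t.
Proof.
case: s => [|a [|b t]] //= /and3P[_]; rewrite negbK => st /and3P[a0 b0 t0].
by exists a, b, t.
Qed.

Lemma ccol_det s : ~~ odd (size s) ->
  ((ccol (1, 0)%N s).1 * (ccol (0, 1)%N s).2 = (ccol (0, 1)%N s).1 * (ccol (1, 0)%N s).2 + 1)%N.
Proof.
move=> /SL2Z_cfmx; rewrite /SL2Z /= det22 cfmxE !mat22_simp; lia.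
Qed.

(** The last inequality says that the fixed-point polynomial [q x^2 + (q' - p) x - p'] is positive
    at -1, which will place the conjugate root above -1. *)
Lemma ccol_even s : even_code s -> let p := (ccol (1, 0)%N s).1 in let p' := (ccol (0, 1)%N s).1 in
  let q := (ccol (1, 0)%N s).2 in let q' := (ccol (0, 1)%N s).2 in
  [/\ (p * q' = p' * q + 1)%N, (2 <= p)%N, (1 <= p')%N, (1 <= q)%N & (1 <= q')%N /\ (p' + q' < p + q)%N].
Proof.
move=> es; have /and3P[_ os ps] := es.
have := ccol_det os; have [_ _ h3 _] := ccol_order ps; move: h3.
have [a [b [t [-> [ot [a0 [b0 t0]]]]]]] := even_code2 es.
have := ccol_det ot; have [h1 _ _ _] := ccol_order t0; move: h1.
rewrite /cont /=.
move: (ccol (1, 0)%N t) (ccol (0, 1)%N t) => [P Q] [P' Q'] /= P1 dt h3 ds.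
have Q'1 : (1 <= Q')%N by nia.
move: h3 ds; set q := (b * P + Q)%N; set q' := (b * P' + Q')%N.
have q1 : (1 <= q)%N by nia.
have q'1 : (1 <= q')%N by nia.
set p := (a * q + P)%N; set p' := (a * q' + P')%N.
have p2 : (2 <= p)%N by nia.
have p'1 : (1 <= p')%N by nia.
clearbody p p' q q'; move=> h3 ds; split => //; split => //.
have q'q : (q' <= q)%N.
  rewrite leqNgt; apply/negP => qq.
  have : (p * q.+1 <= p * q')%N by rewrite leq_mul2l qq orbT.
  have : (p' * q <= p * q)%N by rewrite leq_mul2r h3 orbT.
  by lia.
have [e|ne] := eqVneq p' p; last by lia.
have : q' != q by apply/eqP => e2; move: ds; rewrite e e2; lia.
by lia.
Qed.

Lemma cfmx_tr s : even_code s -> 2 < `|\tr (cfmx s)|.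
Proof.
move=> /ccol_even[_ h1 _ _ [h2 _]]; rewrite tr22 cfmxE !mat22_simp ger0_norm; lia.
Qed.

Lemma lrmx_T a : lrmx (nseq a true) = mat22 1 a%:Z 0 1.
Proof.
elim: a => [|a IH]; first by rewrite /lrmx big_nil mat22_1.
by rewrite /= lrmx_cons IH mat22M; congr mat22; lia.
Qed.

Lemma lrmx_U a : lrmx (nseq a false) = mat22 1 0 a%:Z 1.
Proof.
elim: a => [|a IH]; first by rewrite /lrmx big_nil mat22_1.
by rewrite /= lrmx_cons IH mat22M; congr mat22; lia.
Qed.

(** A pair of digits [a], [b] contributes [T^a U^b]. *)
Lemma cfmx_lr s : ~~ odd (size s) -> exists2 w, cfmx s = lrmx w & size w = sumn s.
Proof.
have [n] := ubnP (size s); elim: n s => // n IH [|a [|b s]] //= sn.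
  by exists [::]; rewrite // /cfmx /lrmx !big_nil.
rewrite negbK => /IH[|w wE ws]; first lia.
exists (nseq a true ++ nseq b false ++ w); last by rewrite !size_cat !size_nseq ws.
rewrite !lrmx_cat lrmx_T lrmx_U -wE !cfmx_cons !mulrA !mat22M; congr (mat22 _ _ _ _ * _); ring.
Qed.

(** The roots of the fixed-point equation [q x^2 + (q' - p) x - p' = 0] of [cfmx s], the conjugate
    (negative) one first. *)
Definition cflift s : R * R :=
  let p := (ccol (1, 0)%N s).1%:R in let p' := (ccol (0, 1)%N s).1%:R in
  let q := (ccol (1, 0)%N s).2%:R in let q' := (ccol (0, 1)%N s).2%:R in
  let D := Num.sqrt ((p - q') ^+ 2 + 4 * q * p') in
  ((p - q' - D) / (2 * q), (p - q' + D) / (2 * q)).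

Lemma cflift_vieta s : even_code s ->
  let p := (ccol (1, 0)%N s).1%:R in let p' := (ccol (0, 1)%N s).1%:R in
  let q := (ccol (1, 0)%N s).2%:R in let q' := (ccol (0, 1)%N s).2%:R in
  [/\ q * ((cflift s).1 + (cflift s).2) = p - q', q * ((cflift s).1 * (cflift s).2) = - p',
      (cflift s).1 < 0 < (cflift s).2 & -1 < (cflift s).1].
Proof.
move=> /ccol_even [_ h1 h2 h3 [h4 h5]] p p' q q'.
have p2 : 2 <= p by rewrite ler_nat.
have p'1 : 1 <= p' by rewrite ler1n.
have q1 : 1 <= q by rewrite ler1n.
have q'1 : 1 <= q' by rewrite ler1n.
have pq : p' + q' < p + q by rewrite -!natrD ltr_nat.
rewrite /cflift /= -/p -/p' -/q -/q'.
set D := Num.sqrt _; have DD : D ^+ 2 = (p - q') ^+ 2 + 4 * q * p'.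
  by rewrite sqr_sqrtr// addr_ge0 ?sqr_ge0// !mulr_ge0//; lra.
have D0 : 0 <= D by exact: sqrtr_ge0.
have q2 : 0 < 2 * q by lra.
have Dp : `|p - q'| < D.
  by rewrite -(@ltr_pXn2r _ 2)// ?nnegrE// real_normK ?num_real// DD ltrDl; nra.
move: Dp; rewrite ltr_norml => /andP[D1 D2].
set y := (p - q' - D) / _; set x := (p - q' + D) / _.
have yE : y * (2 * q) = p - q' - D by rewrite divfK// gt_eqF.
have xE : x * (2 * q) = p - q' + D by rewrite divfK// gt_eqF.
have y0 : y < 0 by rewrite -(pmulr_llt0 _ q2) yE; lra.
have x0 : 0 < x by rewrite -(pmulr_lgt0 _ q2) xE; lra.
have v1 : q * (y + x) = p - q' by lra.
have v2 : q * (y * x) = - p'.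
  have : (y * (2 * q)) * (x * (2 * q)) = - (4 * q * p') by rewrite yE xE; nra.
  have -> : (y * (2 * q)) * (x * (2 * q)) = 4 * q * (q * (y * x)) by ring.
  rewrite -mulrN => /mulfI; apply; lra.
split=> //; first by rewrite y0.
(* With [y <= -1 < x] the fixed-point polynomial would be nonpositive at -1. *)
rewrite ltNge; apply/negP => y1.
have : q * ((- 1 - x) * (- 1 - y)) <= 0.
  have : (-1 - x) * (-1 - y) <= 0 by apply: mulr_le0_ge0; lra.
  by move=> h; rewrite pmulr_rle0//; lra.
have -> : q * ((- 1 - x) * (- 1 - y)) = q + q * (y + x) + q * (y * x) by ring.
by rewrite v1 v2; lra.
Qed.

Lemma cflift_fixed s : even_code s ->
  fixes_endpoint (cfmx s) (cflift s).1 /\ fixes_endpoint (cfmx s) (cflift s).2.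
Proof.
move=> /cflift_vieta; rewrite /fixes_endpoint cfmxE !mat22_simp.
move: (cflift s) => [y x] /= [v1 v2 _ _].
have v1' : (ccol (1, 0)%N s).1%:R = (ccol (0, 1)%N s).2%:R + (ccol (1, 0)%N s).2%:R * (y + x) :> R by lra.
have v2' : (ccol (0, 1)%N s).1%:R = - ((ccol (1, 0)%N s).2%:R * (y * x)) :> R by lra.
split; rewrite /= -!pmulrn v1' v2'; ring.
Qed.

Lemma cflift_closed s : even_code s -> closed_lift (cflift s).
Proof.
move=> es; have [_ _ /andP[y0 x0] _] := cflift_vieta es; split.
  by move=> e; rewrite e in y0; lra.
have /and3P[_ os _] := es; have [f1 f2] := cflift_fixed es.
by exists (cfmx s); split => //; [exact: SL2Z_cfmx|exact: cfmx_tr].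
Qed.

Lemma closed_lift_irr p : closed_lift p -> irrational_pair p.
Proof. by move=> [_ [g [sg tg f1 f2]]]; split; apply: hyperbolic_irr sg tg _. Qed.

(* Two hyperbolic elements with a common fixed point have proportional
   fixed-point equations, since this point is irrational. *)
Lemma closed_lift_unique s p : even_code s -> closed_lift p -> p.2 = (cflift s).2 ->
  p = cflift s.
Proof.
move=> es cp px; have [p12 [g [sg tg f1 f2]]] := cp.
have [_ ix] := closed_lift_irr cp.
have [f1' f2'] := cflift_fixed es; have [v1 v2 _ _] := cflift_vieta es.
have [_ _ _ h3 _] := ccol_even es.
move: f1' f2' v1 v2; rewrite /fixes_endpoint cfmxE !mat22_simp -!pmulrn -px.
set P := (ccol (1, 0)%N s).1; set P' := (ccol (0, 1)%N s).1; set Q := (ccol (1, 0)%N s).2 in h3 *.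
set Q' := (ccol (0, 1)%N s).2; move=> f1' f2' v1 v2.
move: f1 f2; rewrite /fixes_endpoint.
move: sg; rewrite /SL2Z /= det22; move: tg; rewrite tr22.
set a := g 0 0; set b := g 0 1; set c := g 1 0; set d := g 1 1 => tg dg f1 f2.
have Q0 : 0 < Q%:R :> R by rewrite ltr0n.
(* Eliminating the square of [p.2] from its two fixed-point equations leaves a linear relation with
   integer coefficients. *)
have [e1 e2] : Q%:Z * (d - a) - c * (Q'%:Z - P%:Z) = 0 /\ - (Q%:Z * b) + c * P'%:Z = 0.
  apply: ix; rewrite !(rmorphM, rmorphD, rmorphN, rmorphB) /= -!pmulrn.
  have b' : b%:~R = p.2 * (c%:~R * p.2 + d%:~R) - a%:~R * p.2 by rewrite -f2; ring.
  have P'' : P'%:R = p.2 * (Q%:R * p.2 + Q'%:R) - P%:R * p.2 by rewrite -f2'; ring.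
  by rewrite b' P''; ring.
(* Otherwise [d = a], and determinant 1 would give trace 2 or -2. *)
have c0 : c != 0.
  apply/eqP => c0; move: e1 e2; rewrite c0 !mul0r !subr0 => e1 _.
  have Qz : Q%:Z != 0 by lia.
  have da : d = a by move/eqP: e1; rewrite mulf_eq0 (negbTE Qz) /= subr_eq0 => /eqP.
  by move: dg tg; rewrite c0 da mulr0 subr0; nia.
have E1 : Q%:R * (d%:~R - a%:~R) = c%:~R * (Q'%:R - P%:R) :> R.
  have : (Q%:Z * (d - a) - c * (Q'%:Z - P%:Z))%:~R = 0 :> R by rewrite e1.
  by rewrite !(rmorphM, rmorphD, rmorphN, rmorphB) /= -!pmulrn; lra.
have E2 : Q%:R * b%:~R = c%:~R * P'%:R :> R.
  have : (- (Q%:Z * b) + c * P'%:Z)%:~R = 0 :> R by rewrite e2.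
  by rewrite !(rmorphM, rmorphD, rmorphN, rmorphB) /= -!pmulrn; lra.
have : c%:~R * (Q%:R * ((p.1 - p.2) * (p.1 - (cflift s).1))) = 0.
  have -> : c%:~R * (Q%:R * ((p.1 - p.2) * (p.1 - (cflift s).1))) =
    c%:~R * (Q%:R * p.1 ^+ 2 - (Q%:R * ((cflift s).1 + p.2)) * p.1 + Q%:R * ((cflift s).1 * p.2)) by ring.
  rewrite v1 v2.
  have -> : c%:~R * (Q%:R * p.1 ^+ 2 - (P%:R - Q'%:R) * p.1 + - P'%:R) =
    Q%:R * c%:~R * p.1 ^+ 2 + (c%:~R * (Q'%:R - P%:R)) * p.1 - c%:~R * P'%:R by ring.
  rewrite -E1 -E2.
  have -> : Q%:R * c%:~R * p.1 ^+ 2 + Q%:R * (d%:~R - a%:~R) * p.1 - Q%:R * b%:~R =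
    Q%:R * (p.1 * (c%:~R * p.1 + d%:~R) - (a%:~R * p.1 + b%:~R)) by ring.
  by rewrite f1 subrr mulr0.
move/eqP; rewrite !mulf_eq0 intr_eq0 (negbTE c0) (gt_eqF Q0) !subr_eq0 2!orFb.
case/orP => /eqP e; first by case: p12.
by rewrite [p]surjective_pairing e px -surjective_pairing.
Qed.

Lemma foldr_cf s (z : R) : all (fun a => 0 < a)%N s -> 0 < z ->
  0 < foldr (fun a x => a%:R + x^-1) z s /\
  foldr (fun a x => a%:R + x^-1) z s * ((ccol (1, 0)%N s).2%:R * z + (ccol (0, 1)%N s).2%:R) =
  (ccol (1, 0)%N s).1%:R * z + (ccol (0, 1)%N s).1%:R.
Proof.
move=> + z0; elim: s => [|a s IH] /=; first by rewrite mul0r add0r mulr1 mul1r addr0.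
move=> /andP[a0 /IH[f0 fE]]; have i0 : 0 < a%:R :> R by rewrite ltr0n.
split; first by rewrite addr_gt0// invr_gt0.
set F := foldr _ z s in f0 fE *.
have e : F^-1 * ((ccol (1, 0)%N s).1%:R * z + (ccol (0, 1)%N s).1%:R) =
    (ccol (1, 0)%N s).2%:R * z + (ccol (0, 1)%N s).2%:R.
  by rewrite -fE mulKf// gt_eqF.
by rewrite mulrDl e !natrD !natrM; ring.
Qed.

(** The complete quotients are the continued fractions of the suffixes of [s] ended by the fixed
    point itself; the fixed-point equation closes the cycle, [X 0 = X (size s)]. *)
Lemma code_tails s : even_code s ->
  exists2 x, cf_tails (periodize s) x & x 0%N = (cflift s).2.
Proof.
move=> es; have [_ _ /andP[_ x0] _] := cflift_vieta es; have [_ fx] := cflift_fixed es.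
have /and3P[n0 _ ps] := es.
set x := (cflift s).2 in x0 fx *.
pose X i := foldr (fun a x => a%:R + x^-1) x (drop i s).
have pd i : all (fun a => 0 < a)%N (drop i s).
  by apply/allP => a /mem_drop; apply/allP.
have X0 i : 0 < X i by have [] := foldr_cf (pd i) x0.
have Xn : X (size s) = x by rewrite /X drop_size.
have X00 : X 0%N = x.
  rewrite /X drop0; have [_] := foldr_cf ps x0.
  move: fx; rewrite /fixes_endpoint cfmxE !mat22_simp -!pmulrn => ->.
  have [_ _ _ _ [h _]] := ccol_even es.
  have h0 : 0 <= (ccol (1, 0)%N s).2%:R * x by rewrite mulr_ge0// ltW.
  by move/mulIf; apply; rewrite gt_eqF// ltr_wpDl// ltr0n.
have XS i : (i < size s)%N -> X i = (nth 0%N s i)%:R + (X i.+1)^-1.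
  by move=> is_; rewrite /X (drop_nth 0%N).
have XE i : X (i %% size s)%N = (periodize s i)%:R + (X (i.+1 %% size s)%N)^-1.
  have im : (i %% size s < size s)%N by rewrite ltn_mod.
  rewrite XS// /periodize; congr (_ + _^-1).
  have : ((i %% size s).+1 = size s \/ (i %% size s).+1 < size s)%N by lia.
  have -> : (i.+1 %% size s = (i %% size s).+1 %% size s)%N by rewrite -addn1 -modnDml addn1.
  case=> [e|l].
    by rewrite e modnn Xn X00.
  by rewrite (modn_small l).
exists (fun i => X (i %% size s)%N); last by rewrite mod0n.
move=> i; have a0 : (0 < periodize s i)%N.
  by rewrite /periodize; apply: (allP ps); rewrite mem_nth// ltn_mod.
split => //.
rewrite XE; have : 1 <= (periodize s i)%:R :> R by rewrite ler1n.
have i0 : 0 < (X (i.+1 %% size s)%N)^-1 by rewrite invr_gt0.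
by move=> ?; lra.
Qed.

Lemma periodic_cf_lift s (w : R) : even_code s -> is_periodic_cf w s <-> w = (cflift s).2.
Proof.
move=> /code_tails[x xt <-]; have h := finite_cf_cvg xt; split.
  by move=> h'; exact: (cvg_unique _ h' h).
by move=> ->.
Qed.

End Codes.

(** * Geodesics and their codes up to even rotation *)

Section GeodesicCodes.
Variable R : realType.
Implicit Types (s t : seq nat) (p q : R * R) (g h : 'M[int]_2) (C : set (R * R)).

Lemma closed_lift_act g p : SL2Z g -> closed_lift p -> closed_lift (act g p).
Proof.
move=> sg cp; have [i1 i2] := closed_lift_irr cp; case: cp => p12 [h [sh th f1 f2]].
have sV := SL2Z_inv sg; have sgh := SL2Z_mul (SL2Z_mul sg sh) sV.
split.
  move=> /= e; apply: p12.
  by rewrite -[p.1]moebius1 -[p.2]moebius1 -(mulVmx22 sg) !moebius_mul// e.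
exists (g * h * inv22 g); split => //.
- have -> : \tr (g * h * inv22 g) = \tr h; last exact: th.
  by rewrite [LHS]mxtrace_mulC -[LHS]/(\tr (inv22 g * (g * h))) mulrA mulVmx22// mul1r.
- apply/fixes_moebius => //=; first exact: irr_moebius.
  rewrite -moebius_mul// -mulrA mulVmx22// mulr1 moebius_mul//.
  by congr moebius; apply/fixes_moebius.
- apply/fixes_moebius => //=; first exact: irr_moebius.
  rewrite -moebius_mul// -mulrA mulVmx22// mulr1 moebius_mul//.
  by congr moebius; apply/fixes_moebius.
Qed.

Lemma orbit_self p : geodesic_orbit p p.
Proof. by exists 1; [exact: SL2Z_1|rewrite !moebius1; case: p]. Qed.

Lemma orbit_act g p : SL2Z g -> irrational_pair p -> geodesic_orbit (act g p) = geodesic_orbit p.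
Proof.
move=> sg ip; apply/seteqP; split => _ [h sh <-].
  by exists (h * g); [exact: SL2Z_mul|rewrite -!/(act _ _) -[LHS]/(act (h * g) p) act_mul].
exists (h * inv22 g); first by apply: SL2Z_mul => //; exact: SL2Z_inv.
rewrite -[LHS]/(act (h * inv22 g) (act g p)) -[RHS]/(act h p) act_mul ?actK//.
- exact: SL2Z_inv.
- exact: act_irr.
Qed.

Definition valid_code s := all (fun a => 0 < a)%N s /\ minimal_even_period s.

Lemma valid_even s : valid_code s -> even_code s.
Proof. by move=> [ps [[s0 os _] _]]; apply/and3P. Qed.

Definition geod s : set (R * R) := geodesic_orbit (cflift R s).

Lemma crossing_cflift s : even_code s -> crossing (cflift R s).
Proof. by move=> /(cflift_vieta R)[]. Qed.

Lemma cflift_irr s : even_code s -> irrational_pair (cflift R s).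
Proof. by move=> es; exact/closed_lift_irr/cflift_closed. Qed.

Lemma reduced_cflift s : even_code s -> reduced (cflift R s).
Proof.
move=> es; have [_ _ /andP[h0 _] h1] := cflift_vieta R es.
have [x xt x0] := code_tails R es; have [_ x1 _] := xt 0%N.
by rewrite /reduced h0 h1 -x0.
Qed.

Lemma reduced_lift_cflift s : valid_code s -> reduced_lift (cflift R s) s.
Proof.
move=> vs; have es := valid_even vs; have /andP[r1 r2] := reduced_cflift es.
by case: (vs) => ps ms; split => //; apply/periodic_cf_lift.
Qed.

Lemma has_code_geod C s : primitive_closed_geodesic C -> has_code C s ->
  valid_code s /\ C = geod s.
Proof.
move=> [p cp ->] [q [g sg gE] [q1 q2 ps ms cs]].
have vs : valid_code s by split.
have cq : closed_lift q by rewrite -gE; exact: closed_lift_act.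
have /(closed_lift_unique (valid_even vs) cq) qE : q.2 = (cflift R s).2.
  by apply/periodic_cf_lift => //; exact: valid_even.
split=> //; rewrite /geod -qE -gE; apply/esym; apply: orbit_act => //.
exact: closed_lift_irr.
Qed.

Lemma geod_prim s : even_code s -> primitive_closed_geodesic (geod s).
Proof. by move=> es; exists (cflift R s) => //; exact: cflift_closed. Qed.

Lemma has_code_self s : valid_code s -> has_code (geod s) s.
Proof. by move=> vs; exists (cflift R s); [exact: orbit_self|exact: reduced_lift_cflift]. Qed.

Lemma periodize_size s i : periodize s (i + size s) = periodize s i.
Proof. by rewrite /periodize modnDr. Qed.

Lemma periodize_rot s k i : (k <= size s)%N -> periodize (rot k s) i = periodize s (i + k).
Proof.
move=> ks; rewrite /periodize size_rot /rot nth_cat size_drop.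
have [s0|s0] := posnP (size s); first by move/size0nil: s0 => ->; rewrite !nth_nil.
have := ltn_pmod i s0; set m := (i %% _)%N => ms.
have -> : ((i + k) %% size s = (m + k) %% size s)%N by rewrite modnDml.
case: ltnP => h.
  by rewrite nth_drop modn_small; [rewrite addnC|lia].
rewrite nth_take; last by lia.
have -> : (m + k = (m - (size s - k)) + size s)%N by lia.
by rewrite modnDr modn_small//; lia.
Qed.

(** Pure periodicity permits stepping back: completing the shift by [k] to a multiple of [size s]
    undoes it. *)
Lemma periodize_shift_period s k m : (0 < size s)%N ->
  (forall i, periodize s (i + k + m) = periodize s (i + k)) ->
  forall i, periodize s (i + m) = periodize s i.
Proof.
move=> s0 h i.
have per j n : periodize s (j + n * size s) = periodize s j.
  by rewrite /periodize addnC modnMDl.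
rewrite -(per (i + m)%N k) -[RHS](per i k).
have : (k <= k * size s)%N by rewrite leq_pmulr.
move=> kk; have := h (i + (k * size s - k))%N.
have -> : (i + (k * size s - k) + k + m = i + m + k * size s)%N by lia.
by have -> : (i + (k * size s - k) + k = i + k * size s)%N by lia.
Qed.

Lemma eq_shift_minimal s t k : (0 < size s)%N -> (0 < size t)%N ->
  (forall i, periodize t i = periodize s (i + k)) ->
  minimal_even_period s -> minimal_even_period t -> size s = size t.
Proof.
move=> s0 t0 ts [[_ os ps] ms] [[_ ot pt] mt]; apply/eqP; rewrite eqn_leq; apply/andP; split.
  apply: ms; split=> //; apply: (@periodize_shift_period s k) => // i.
  by rewrite addnAC -!ts pt.
by apply: mt; split=> // i; rewrite !ts addnAC ps.
Qed.

Lemma valid_rot s k : (k <= size s)%N -> valid_code s -> valid_code (rot k s).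
Proof.
move=> ks [ps [[s0 os per] ms]]; split.
  by apply/allP => a; rewrite mem_rot; apply/allP.
split.
  by split; rewrite ?size_rot// => i; rewrite !periodize_rot// addnAC per.
move=> m [m0 om pm]; rewrite size_rot; apply: ms; split => //.
apply: (@periodize_shift_period s k) => // i.
by have := pm i; rewrite !periodize_rot// addnAC.
Qed.

Lemma shift_rot s t j : valid_code s -> valid_code t ->
  (forall i, periodize t i = periodize s (i + j.*2)) ->
  exists2 k, (k.*2 <= size s)%N & t = rot k.*2 s.
Proof.
move=> vs vt ts.
have /and3P[s0 os _] := valid_even vs; have /and3P[t0 ot _] := valid_even vt.
have st : size s = size t by apply: (eq_shift_minimal s0 t0 ts); [case: vs|case: vt].
have [n nE] : exists n, size s = n.*2 by exists (size s)./2; rewrite even_halfK.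
have n0 : (0 < n)%N by rewrite -double_gt0 -nE.
exists (j %% n)%N; first by rewrite nE leq_double ltnW// ltn_mod.
have ks : ((j %% n).*2 <= size s)%N by rewrite nE leq_double ltnW// ltn_mod.
apply: (@eq_from_nth _ 0%N); first by rewrite size_rot.
move=> i it.
have -> : nth 0%N t i = periodize t i by rewrite /periodize modn_small.
have -> : nth 0%N (rot (j %% n).*2 s) i = periodize (rot (j %% n).*2 s) i.
  have e : (i %% size s = i)%N by rewrite modn_small// st.
  by rewrite /periodize size_rot e.
rewrite ts periodize_rot// /periodize; congr nth.
by rewrite -modnDmr nE -!muln2 -muln_modl.
Qed.

(** One lift is an [fstep] iterate of the other; both being reduced, [fstep_return] makes this an
    even shift of the digits. *)
Lemma geod_inj s t : valid_code s -> valid_code t -> geod s = geod t ->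
  exists2 k, (k.*2 <= size s)%N & t = rot k.*2 s.
Proof.
move=> vs vt st; have es := valid_even vs; have et := valid_even vt.
have : geod s (cflift R t) by rewrite st; exact: orbit_self.
move=> [g sg gE]; rewrite -[LHS]/(act g (cflift R s)) in gE.
have := crossing_fstep sg (cflift_irr es) (crossing_cflift es).
rewrite gE => /(_ (crossing_cflift et))[k kE].
have [xs xst xs0] := code_tails R es; have [xt xtt xt0] := code_tails R et.
have rs := reduced_cflift es; have rt := reduced_cflift et.
have /andP[ys _] := rs; have /andP[yt _] := rt.
case: kE => kE.
  have [j [_ e]] : exists j, k = (\sum_(i < j.*2) periodize t i)%N /\
      iter k (@fstep R) ((cflift R t).1, xt 0%N) = (back (periodize t) (cflift R t).1 j.*2, xt j.*2).
    by apply: fstep_return => //; rewrite xt0 -surjective_pairing kE.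
  have ss : exists2 k, (k.*2 <= size t)%N & s = rot k.*2 t.
    apply: (@shift_rot t s j) => // i.
    have := cf_digits_unique xst (cf_tails_shift j.*2 xtt); rewrite /= add0n => h.
    have [|-> //] := h _ i.
    by move: e; rewrite xt0 -surjective_pairing kE => /(congr1 snd) /= <-.
  (* In this case [s] is a rotation of [t], and the complementary rotation leads back. *)
  have [m ms sE] := ss; have [n nE] : exists n, size t = n.*2.
    by exists (size t)./2; rewrite even_halfK//; case/and3P: et.
  exists (n - m)%N; first by rewrite sE size_rot nE leq_double leq_subr.
  by rewrite doubleB -nE -[LHS](rotK m.*2) -sE /rotr; congr rot; rewrite sE size_rot.
have [j [_ e]] : exists j, k = (\sum_(i < j.*2) periodize s i)%N /\
      iter k (@fstep R) ((cflift R s).1, xs 0%N) = (back (periodize s) (cflift R s).1 j.*2, xs j.*2).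
  by apply: fstep_return => //; rewrite xs0 -surjective_pairing kE.
apply: (@shift_rot s t j) => // i.
have := cf_digits_unique xtt (cf_tails_shift j.*2 xst); rewrite /= add0n => h.
have [|-> //] := h _ i.
by move: e; rewrite xs0 -surjective_pairing kE => /(congr1 snd) /= <-.
Qed.

Lemma iter_fstep_act k p : irrational_pair p ->
  exists2 g, SL2Z g & iter k (@fstep R) p = act g p.
Proof.
move=> ip; elim: k => [|k [g sg IH]]; first by exists 1; [exact: SL2Z_1|rewrite act1].
suff [h sh hE] : exists2 h, SL2Z h & fstep (act g p) = act h (act g p).
  by exists (h * g); [exact: SL2Z_mul|rewrite iterS IH hE act_mul].
rewrite /fstep; case: ifP => _.
  exists (inv22 Tmx); first exact/SL2Z_inv/SL2Z_T.
  by rewrite /act /moebius /inv22 /Tmx !mat22_simp !(oppr0, mul0r, add0r, divr1, mul1r, rmorphN).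
exists (inv22 Umx); first exact/SL2Z_inv/SL2Z_U.
rewrite /act /moebius /inv22 /Umx !mat22_simp !(oppr0, rmorphN, mulN1r, mul1r, addr0).
by rewrite ![- _ + _]addrC.
Qed.

(** One block of [fstep] moves the lift inside its orbit to a closed lift whose positive end point
    has the shifted expansion; the other end point is then determined by [closed_lift_unique]. *)
Lemma geod_rot2 s : valid_code s -> geod (rot 2 s) = geod s.
Proof.
move=> vs; have es := valid_even vs.
have s2 : (2 <= size s)%N by have [a [b [t [-> _]]]] := even_code2 es.
have vr := valid_rot s2 vs; have er := valid_even vr.
have [x xt x0] := code_tails R es; have /andP[ys _] := reduced_cflift es.
have := fstep_tails2 xt ys; rewrite x0 -surjective_pairing.
have [g sg ->] := iter_fstep_act (periodize s 0 + periodize s 1) (cflift_irr es).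
move=> e; have cq : closed_lift (act g (cflift R s)).
  by apply: closed_lift_act => //; exact: cflift_closed.
rewrite /geod -(orbit_act sg (cflift_irr es)); congr geodesic_orbit.
apply/esym; apply: closed_lift_unique => //; rewrite e /=.
apply/periodic_cf_lift => //.
have := finite_cf_cvg (cf_tails_shift 2 xt); rewrite add0n /is_periodic_cf.
have -> // : periodize (rot 2 s) = (fun i => periodize s (i + 2)).
by apply/funext => i; rewrite periodize_rot.
Qed.

Lemma geod_rot s k : valid_code s -> (k.*2 <= size s)%N -> geod (rot k.*2 s) = geod s.
Proof.
move=> vs; elim: k => [|k IH] ks; first by rewrite rot0.
have ks' : (k.*2 <= size s)%N by move: ks; rewrite doubleS; lia.
rewrite doubleS -(add2n k.*2) rotD// geod_rot2 ?IH//.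
exact: valid_rot.
Qed.

(** The arbitrary choice made by [xget] can only select an even rotation of [s]. *)
Lemma code_geod s : valid_code s -> exists2 k, (k.*2 <= size s)%N & Defs.code (geod s) = rot k.*2 s.
Proof.
move=> vs; have h : has_code (geod s) (Defs.code (geod s)).
  by apply: xgetPex; exists s; exact: has_code_self.
have [vc cE] := has_code_geod (geod_prim (valid_even vs)) h.
exact: geod_inj.
Qed.

Lemma valid_code_geod s : valid_code s -> valid_code (Defs.code (geod s)).
Proof. by move=> vs; have [k ks ->] := code_geod vs; exact: valid_rot. Qed.

Lemma lift_of_geod s : valid_code s -> lift_of (geod s) = cflift R (Defs.code (geod s)).
Proof.
move=> vs; have vc := valid_code_geod vs; have ec := valid_even vc.
have [k ks cE] := code_geod vs.
have gE : geod (Defs.code (geod s)) = geod s by rewrite cE geod_rot.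
rewrite /lift_of; set X := [set p | _]; have [] : X (xget (0, 0) X).
  apply: xgetPex; exists (cflift R (Defs.code (geod s))); split; last exact: reduced_lift_cflift.
  by rewrite -[X in X _]gE; exact: orbit_self.
move: (xget _ _) => q [g sg gq] [_ _ _ _ cq].
have clq : closed_lift q by rewrite -gq; apply: closed_lift_act => //; exact/cflift_closed/valid_even.
by apply: closed_lift_unique => //; apply/periodic_cf_lift.
Qed.

Definition alt_sum s : int := foldr (fun a (z : int) => a%:Z - z) 0 s.

Lemma alt_sum_cat s t : alt_sum (s ++ t) = alt_sum s + (-1) ^+ size s * alt_sum t.
Proof.
elim: s => [|a s IH] /=; first by rewrite add0r expr0 mul1r.
by rewrite -/(alt_sum _) IH exprS -/(alt_sum s); ring.
Qed.

Lemma alt_sumE s : alt_sum s = \sum_(i < size s) (-1) ^+ i * (nth 0%N s i)%:Z.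
Proof.
elim: s => [|a s IH]; first by rewrite big_ord0.
rewrite big_ord_recl /= -/(alt_sum s) IH expr0 mul1r; congr (_ + _).
by rewrite -sumrN; apply: eq_bigr => i _; rewrite exprS mulN1r mulNr.
Qed.

Lemma alt_sum_rot s k : ~~ odd (size s) -> (k.*2 <= size s)%N -> alt_sum (rot k.*2 s) = alt_sum s.
Proof.
move=> os ks; rewrite /rot -[X in _ = alt_sum X](cat_take_drop k.*2 s) !alt_sum_cat.
have sg m : ~~ odd m -> (-1) ^+ m = 1 :> int by move=> om; rewrite -signr_odd (negbTE om).
rewrite size_drop size_takel// !sg ?oddB ?odd_double ?(negbTE os)//.
by rewrite !mul1r addrC.
Qed.

Lemma winding_geod s : valid_code s -> winding (geod s) = alt_sum s.
Proof.
move=> vs; have [k ks cE] := code_geod vs; rewrite /winding -alt_sumE cE alt_sum_rot//.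
by have /and3P[] := valid_even vs.
Qed.

Lemma period_length_geod s : valid_code s -> period_length (geod s) = size s.
Proof. by move=> vs; have [k ks cE] := code_geod vs; rewrite /period_length cE size_rot. Qed.

Lemma trace_rot s k : \tr (cfmx (rot k s)) = \tr (cfmx s).
Proof.
rewrite /rot -[X in _ = \tr (cfmx X)](cat_take_drop k s) /cfmx !big_cat /=.
exact: mxtrace_mulC.
Qed.

Lemma trace_code_geod s : valid_code s -> \tr (cfmx (Defs.code (geod s))) = \tr (cfmx s).
Proof. by move=> vs; have [k ks ->] := code_geod vs; exact: trace_rot. Qed.

Lemma sumn_code_geod s : valid_code s -> sumn (Defs.code (geod s)) = sumn s.
Proof.
move=> vs; have [k ks ->] := code_geod vs.
by apply: perm_sumn; rewrite perm_rot.
Qed.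

End GeodesicCodes.

(** * Geometric length and word length *)

Section GeometricLength.
Variable R : realType.
Implicit Types (s : seq nat).

Let toC (x : R) : R[i] := Complex x 0.

Lemma intC (n : int) : n%:~R = toC n%:~R.
Proof. by rewrite -(rmorph_int (real_complex R)). Qed.

Lemma complex_mulE (a b c d : R) : Complex a b * Complex c d = Complex (a * c - b * d) (a * d + b * c).
Proof. by []. Qed.

Lemma complex_addE (a b c d : R) : Complex a b + Complex c d = Complex (a + c) (b + d).
Proof. by []. Qed.

(* The translation length l of a hyperbolic element of trace t satisfies
   cosh l = t^2 / 2 - 1. *)
Lemma hyp_dist_axis s : even_code s ->
  hyp_dist (summit (cflift R s)) (moebius (cfmx s) (summit (cflift R s))) =
  arcosh ((\tr (cfmx s))%:~R ^+ 2 / 2 - 1).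
Proof.
move=> es; have [v1 v2 /andP[y0 x0] _] := cflift_vieta R es.
have [dp _ _ q1 [q'1 _]] := ccol_even es; have /and3P[_ os _] := es.
rewrite tr22 /moebius !intC cfmxE !mat22_simp /summit /hyp_dist.
move: dp q1 q'1 v1 v2 y0 x0.
move: (ccol (1, 0)%N s).1 (ccol (1, 0)%N s).2 (ccol (0, 1)%N s).1 (ccol (0, 1)%N s).2.
move: (cflift R s).1 (cflift R s).2 => y x p q p' q' dp q1 q'1.
rewrite intrD -!pmulrn.
have Q0 : 0 < q%:R :> R by rewrite ltr0n.
have Q'0 : 0 < q'%:R :> R by rewrite ltr0n.
have dR : p%:R * q'%:R = p'%:R * q%:R + 1 :> R by rewrite -!natrM dp natrD.
move: (p%:R : R) (q%:R : R) (p'%:R : R) (q'%:R : R) Q0 Q'0 dR => P Q P' Q' Q0 Q'0 dR v1 v2 y0 x0.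
have -> : `|x - y| = x - y by rewrite gtr0_norm//; lra.
set m := (y + x) / 2; set r := (x - y) / 2.
have r0 : 0 < r by rewrite /r; lra.
have PE : P = 2 * Q * m + Q' by rewrite /m; lra.
have P'E : P' = - (Q * (m ^+ 2 - r ^+ 2)) by rewrite /m /r; lra.
(* [u + i v] is the denominator of the Moebius map at the summit [m + i r], and [N] its squared
   modulus. Determinant 1 becomes [u ^+ 2 = v ^+ 2 + 1], and the trace is [2 * u]. *)
set u := Q * m + Q'; set v := Q * r.
have uv : u ^+ 2 = v ^+ 2 + 1.
  by move: dR; rewrite PE P'E /u /v => dR; nra.
pose N := u ^+ 2 + v ^+ 2.
have N0 : 0 < N by rewrite /N uv; have := sqr_ge0 v; lra.
have -> : (toC P * Complex m r + toC P') / (toC Q * Complex m r + toC Q') =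
    Complex (m + 2 * u * v * r / N) (r / N).
  have dE : toC Q * Complex m r + toC Q' = Complex u v.
    by rewrite complex_mulE complex_addE; congr Complex; rewrite /u /v; ring.
  have d0 : Complex u v != 0.
    by apply/eqP => -[u0 _]; move: uv; rewrite u0; have := sqr_ge0 v; nra.
  apply: (mulIf d0); rewrite dE divfK// !complex_mulE complex_addE.
  have n0 : N != 0 by rewrite gt_eqF.
  congr Complex; apply: (mulIf n0).
    transitivity ((m * u + Q * r ^+ 2) * N); first by rewrite PE P'E /u; ring.
    have -> : (m + 2 * u * v * r / N) * u - r / N * v =
       m * u + r * v * (2 * u ^+ 2 - 1) / N by field.
    have -> : 2 * u ^+ 2 - 1 = N by rewrite /N uv; ring.
    by rewrite mulfK// /v; ring.
  have -> : (m + 2 * u * v * r / N) * v + r / N * u =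
     m * v + r * u * (2 * v ^+ 2 + 1) / N by field.
  have -> : 2 * v ^+ 2 + 1 = N by rewrite /N uv; ring.
  by rewrite mulfK// PE /u /v; ring.
rewrite /=; congr arcosh.
have -> : P + Q' = 2 * u by rewrite PE /u; ring.
have n0 : N != 0 by rewrite gt_eqF.
have -> : m - (m + 2 * u * v * r / N) = - (2 * u * v * r / N) by ring.
have -> : r - r / N = r * (N - 1) / N by field.
have NE : N = 2 * v ^+ 2 + 1 by rewrite /N uv; ring.
have -> : (- (2 * u * v * r / N)) ^+ 2 + (r * (N - 1) / N) ^+ 2 =
   r ^+ 2 * (4 * u ^+ 2 * v ^+ 2 + (N - 1) ^+ 2) / N ^+ 2 by field.
have -> : 4 * u ^+ 2 * v ^+ 2 + (N - 1) ^+ 2 = 4 * v ^+ 2 * N by rewrite /N uv; ring.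
have -> : r ^+ 2 * (4 * v ^+ 2 * N) / N ^+ 2 / (2 * r * (r / N)) = 2 * v ^+ 2.
  by field; rewrite n0 gt_eqF.
have -> : (2 * u) ^+ 2 = 4 * u ^+ 2 by ring.
by rewrite uv; field.
Qed.

(** The argument of the logarithm in [arcosh] lies between [u] and [2 * u], hence between [t^2 / 4]
    and [t^2], hence between [k^2 / 4] and [4 k^2]. *)
Lemma arcosh_bounds (k t : R) : 1 <= k -> 3 <= t -> k <= t <= 2 * k ->
  `|arcosh (t ^+ 2 / 2 - 1) - 2 * ln k| <= 2 * ln 2.
Proof.
move=> k1 t3 /andP[kt t2].
have k0 : 0 < k by lra.
set u := t ^+ 2 / 2 - 1; rewrite /arcosh.
have tt : 9 <= t ^+ 2 by rewrite expr2; nra.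
have u1 : 1 <= u by rewrite /u; lra.
have s0 := sqrtr_ge0 (u ^+ 2 - 1).
have su : Num.sqrt (u ^+ 2 - 1) <= u.
  rewrite -[leRHS]gtr0_norm; last by lra.
  by rewrite -sqrtr_sqr ler_wsqrtr// gerBl.
have w0 : 0 < u + Num.sqrt (u ^+ 2 - 1) by lra.
have sq2 : 2 * ln 2 = ln (2 ^+ 2) :> R by rewrite lnXn// mulr_natl.
have sqk : 2 * ln k = ln (k ^+ 2) by rewrite lnXn// mulr_natl.
rewrite ler_norml sq2 sqk; apply/andP; split.
  rewrite lerNl opprB lerBlDr -lnM ?posrE ?exprn_gt0//.
  rewrite ler_ln ?posrE ?mulr_gt0 ?exprn_gt0//.
  apply: le_trans (_ : t ^+ 2 <= _); first by rewrite !expr2; nra.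
  by rewrite /u in s0 *; lra.
rewrite lerBlDr -lnM ?posrE ?exprn_gt0// ler_ln ?posrE ?mulr_gt0 ?exprn_gt0//.
apply: le_trans (_ : t ^+ 2 <= _); first by rewrite /u in su *; lra.
by rewrite !expr2; nra.
Qed.

(** The trace is [cont s] plus an entry that does not exceed [cont s]. *)
Lemma geometric_length_bound s : valid_code s ->
  `|geometric_length (@geod R s) - 2 * ln (cont s)%:R| <= 2 * ln 2.
Proof.
move=> vs; have vc := valid_code_geod R vs; have ec := valid_even vc.
have es := valid_even vs; have /and3P[_ _ ps] := es.
rewrite /geometric_length lift_of_geod// -[gamma _]/(cfmx (Defs.code (@geod R s))).
rewrite hyp_dist_axis// trace_code_geod//.
have [_ h1 _ _ [h2 _]] := ccol_even es; have [k0 _ _ h3] := ccol_order ps.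
rewrite tr22 cfmxE !mat22_simp -PoszD -pmulrn.
apply: arcosh_bounds; first by rewrite ler1n.
  by rewrite ler_nat; lia.
by rewrite -natrM !ler_nat -/(cont s) leq_addr mul2n -addnn leq_add2l.
Qed.

End GeometricLength.

(** * Normal forms in the free product of cyclic groups of orders 2 and 3 *)

Section WordLength.
Implicit Types (g h X Y : 'M[int]_2) (w : seq bool) (s : seq nat).

Definition Mpow (e : bool) := if e then M_gen else inv22 M_gen.
Definition letter (b : bool) := if b then Tmx else Umx.

Lemma SL2Z_S : SL2Z S_gen.
Proof. by rewrite /SL2Z /= det22 !mat22_simp. Qed.

Lemma SL2Z_M e : SL2Z (Mpow e).
Proof. by case: e; [|apply: SL2Z_inv]; rewrite /SL2Z /= det22 !mat22_simp. Qed.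

Lemma eq_pm_refl X : eq_pm X X. Proof. by left. Qed.

Lemma eq_pm_sym X Y : eq_pm X Y -> eq_pm Y X.
Proof. by case=> ->; [left|right; rewrite opprK]. Qed.

Lemma eq_pm_trans X Y Z : eq_pm X Y -> eq_pm Y Z -> eq_pm X Z.
Proof. by case=> -> [] ->; rewrite ?opprK; [left|right|right|left]. Qed.

Lemma eq_pm_mul X Y X' Y' : eq_pm X X' -> eq_pm Y Y' -> eq_pm (X * Y) (X' * Y').
Proof. by case=> -> [] ->; rewrite ?mulNr ?mulrN ?opprK; [left|right|right|left]. Qed.

Lemma eq_pm_mull X Y Z : eq_pm Y Z -> eq_pm (X * Y) (X * Z).
Proof. exact/eq_pm_mul/eq_pm_refl. Qed.

Lemma eq_pm_mulr X Y Z : eq_pm Y Z -> eq_pm (Y * X) (Z * X).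
Proof. by move=> h; apply: eq_pm_mul h (eq_pm_refl X). Qed.

(** The dictionary between the two descriptions: up to sign [T = M S] and [U = M^-1 S], so words in
    [Tmx] and [Umx] are the words alternating [M^{+1}] or [M^{-1}] with [S]. *)
Lemma MpowS e : eq_pm (Mpow e * S_gen) (letter e).
Proof.
case: e; [right|left]; rewrite /Mpow /letter /M_gen /S_gen /Tmx /Umx /inv22 ?mat22_simp mat22M ?mat22N; congr mat22; ring.
Qed.

Lemma MpowMpow e : eq_pm (Mpow e * Mpow e) (Mpow (~~ e)).
Proof.
by case: e; right; rewrite /Mpow /M_gen /inv22 !mat22_simp mat22M mat22N; congr mat22; ring.
Qed.

Lemma MpowV e : Mpow e * Mpow (~~ e) = 1.
Proof.
by case: e; rewrite /Mpow /M_gen /inv22 !mat22_simp mat22M mat22_1; congr mat22; ring.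
Qed.

Lemma SS : eq_pm (S_gen * S_gen) 1.
Proof. by right; rewrite /S_gen mat22M mat22_1 mat22N; congr mat22; ring. Qed.

Lemma inv22M g h : inv22 (g * h) = inv22 h * inv22 g.
Proof. by rewrite /inv22 mat22M !mulmx22E; congr mat22; ring. Qed.

Lemma inv22K g : inv22 (inv22 g) = g.
Proof. by apply: eq_mat22; rewrite !mat22_simp ?opprK. Qed.

(** The reduced words of the free product: an optional leading [S], then blocks [M^{+1} S] or
    [M^{-1} S], then an optional power of [M]. [nf_cost] is the number of generators. *)
Definition nf_val (b : bool) w (e : option bool) : 'M[int]_2 :=
  (if b then S_gen else 1) * lrmx w * (if e is Some e' then Mpow e' else 1).
Definition nf_cost (b : bool) w (e : option bool) : nat := (b + 2 * size w + (e != None))%N.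

Lemma lrmx_letter b w : lrmx (b :: w) = letter b * lrmx w.
Proof. exact: lrmx_cons. Qed.

Lemma nf_S b w e : exists b' w' e', eq_pm (S_gen * nf_val b w e) (nf_val b' w' e') /\
  (nf_cost b' w' e' <= (nf_cost b w e).+1)%N.
Proof.
case: b; last by exists true, w, e; split; [rewrite /nf_val mul1r mulrA; exact: eq_pm_refl|].
exists false, w, e; split; last by rewrite /nf_cost; lia.
by rewrite /nf_val !mulrA; do 2 apply: eq_pm_mulr; exact: SS.
Qed.

(** A power of [M] before [S] forms a new letter. Before a letter it either cancels the [M] part or,
    since [M * M] is [M^-1] up to sign, changes the letter into the other one. *)
Lemma nf_M d b w e : exists b' w' e', eq_pm (Mpow d * nf_val b w e) (nf_val b' w' e') /\
  (nf_cost b' w' e' <= (nf_cost b w e).+1)%N.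
Proof.
case: b.
  exists false, (d :: w), e; split; last by rewrite /nf_cost /=; lia.
  rewrite /nf_val mul1r !mulrA lrmx_letter; do 2 apply: eq_pm_mulr; exact: MpowS.
case: w => [|c w].
  case: e => [e|]; last first.
    exists false, [::], (Some d); split => //.
    rewrite /nf_val /lrmx big_nil !mul1r mulr1; exact: eq_pm_refl.
  have [ed|] := eqVneq e (~~ d).
    exists false, [::], None; split => //.
    by rewrite /nf_val /lrmx big_nil ed !mul1r MpowV; exact: eq_pm_refl.
  move=> ed; have -> : e = d by case: (e) (d) ed => -[].
  exists false, [::], (Some (~~ d)); split => //.
  by rewrite /nf_val /lrmx big_nil !mul1r; exact: MpowMpow.
have [cd|cd] := eqVneq c (~~ d).
  exists true, w, e; split; last by rewrite /nf_cost /=; lia.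
  rewrite /nf_val !mulrA; apply: eq_pm_mulr; rewrite mulr1 lrmx_letter mulrA.
  apply: eq_pm_mulr; apply: eq_pm_trans (eq_pm_mull _ (eq_pm_sym (MpowS c))) _.
  by rewrite mulrA cd MpowV mul1r; exact: eq_pm_refl.
have -> : c = d by case: (c) (d) cd => -[].
exists false, (~~ d :: w), e; split; last by rewrite /nf_cost.
rewrite /nf_val !mulrA; apply: eq_pm_mulr; rewrite mulr1 mul1r !lrmx_letter mulrA.
apply: eq_pm_mulr; apply: eq_pm_trans (eq_pm_mull _ (eq_pm_sym (MpowS d))) _.
rewrite mulrA; apply: eq_pm_trans (eq_pm_mulr _ (MpowMpow d)) _; exact: MpowS.
Qed.

Definition gens : seq 'M[int]_2 := [:: S_gen; S_gen^-1; M_gen; M_gen^-1].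

Lemma nf_exists (u : seq 'M[int]_2) : all (fun x => x \in gens) u ->
  exists b w e, eq_pm (\prod_(x <- u) x) (nf_val b w e) /\ (nf_cost b w e <= size u)%N.
Proof.
elim: u => [|x u IH] /=.
  exists false, [::], None; rewrite big_nil /nf_val /lrmx big_nil !mulr1.
  by split=> //; exact: eq_pm_refl.
move=> /andP[xg /IH[b [w [e [he hc]]]]]; rewrite big_cons.
have SV : S_gen^-1 = - S_gen.
  by rewrite (inv22E SL2Z_S) /S_gen /inv22 !mat22_simp mat22N; congr mat22; ring.
have step Y : eq_pm x Y -> (exists b' w' e', eq_pm (Y * nf_val b w e) (nf_val b' w' e') /\
    (nf_cost b' w' e' <= (nf_cost b w e).+1)%N) ->
    exists b' w' e', eq_pm (x * \prod_(x <- u) x) (nf_val b' w' e') /\ (nf_cost b' w' e' <= (size u).+1)%N.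
  move=> xY [b' [w' [e' [h1 h2]]]]; exists b', w', e'; split.
    by apply: eq_pm_trans h1; exact: eq_pm_mul.
  by apply: leq_trans h2 _; rewrite ltnS.
move: xg; rewrite !inE => /or4P[] /eqP xE.
- by apply: (step S_gen); [left|exact: nf_S].
- by apply: (step S_gen); [right; rewrite xE SV|exact: nf_S].
- by apply: (step (Mpow true)); [left|exact: nf_M].
- apply: (step (Mpow false)); last exact: nf_M.
  by left; rewrite xE inv22E//; exact: (SL2Z_M true).
Qed.

(* The alternative on the trace is for words that reduce to a trivial or elliptic
   element. *)
Definition conj_lr X (n : nat) := `|\tr X| <= 2 \/
  exists h w, [/\ SL2Z h, eq_pm (h * X * inv22 h) (lrmx w) & (size w <= n)%N].

Lemma conj_lr_pm X Y n : eq_pm X Y -> conj_lr Y n -> conj_lr X n.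
Proof.
move=> XY [tY|[h [w [sh hY wn]]]].
  by left; case: XY => ->//; rewrite raddfN normrN.
right; exists h, w; split => //; apply: eq_pm_trans hY.
by apply: eq_pm_mulr; exact: eq_pm_mull.
Qed.

Lemma conj_lr_comm X Y n : SL2Z X -> conj_lr (Y * X) n -> conj_lr (X * Y) n.
Proof.
move=> sX [tY|[h [w [sh hY wn]]]].
  by left; rewrite -[X * Y]/(X *m Y) mxtrace_mulC.
right; exists (h * inv22 X), w; split => //; first by apply: SL2Z_mul => //; exact: SL2Z_inv.
have -> // : h * inv22 X * (X * Y) * inv22 (h * inv22 X) = h * (Y * X) * inv22 h.
by rewrite inv22M inv22K !mulrA -(mulrA h) mulVmx22// mulr1.
Qed.

Lemma conj_lr_le X n n' : (n <= n')%N -> conj_lr X n -> conj_lr X n'.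
Proof.
move=> nn [t|[h [w [sh hY wn]]]]; first by left.
by right; exists h, w; split=> //; exact: leq_trans nn.
Qed.

Lemma conj_lr_self w n : (size w <= n)%N -> conj_lr (lrmx w) n.
Proof.
move=> wn; right; exists 1, w; split=> //; first exact: SL2Z_1.
rewrite mul1r (_ : inv22 1 = 1) ?mulr1; first exact: eq_pm_refl.
by rewrite -[RHS](mulVmx22 SL2Z_1) mulr1.
Qed.

(** Cyclic reduction. A leading power of [M] merges into the first letter or cancels there, leaving
    an [S] before a shorter word. A leading [S] is moved cyclically to the end, cancels the [S] of
    the last letter, and leaves a power of [M] that moves to the front of a shorter word. *)
Lemma conj_lr_SM w : (conj_lr (S_gen * lrmx w) (size w)) /\ (forall e, conj_lr (Mpow e * lrmx w) (size w)).
Proof.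
have [n] := ubnP (size w); elim: n w => // n IH w wn.
have B e : conj_lr (Mpow e * lrmx w) (size w).
  case: w wn => [|c w] wn.
    left; rewrite /lrmx big_nil mulr1 tr22.
    by case: e; rewrite /Mpow /M_gen /inv22 !mat22_simp.
  have wn' : (size w < n)%N by [].
  have [h1 h2] := IH w wn'.
  have [ce|ce] := eqVneq c (~~ e).
    apply: (@conj_lr_pm _ (S_gen * lrmx w)); last by apply: conj_lr_le h1; exact: leqnSn.
    rewrite lrmx_letter mulrA; apply: eq_pm_mulr.
    apply: eq_pm_trans (eq_pm_mull _ (eq_pm_sym (MpowS c))) _.
    by rewrite mulrA ce MpowV mul1r; exact: eq_pm_refl.
  have -> : c = e by case: (c) (e) ce => -[].
  apply: (@conj_lr_pm _ (lrmx (~~ e :: w))); last exact: conj_lr_self.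
  rewrite !lrmx_letter mulrA; apply: eq_pm_mulr.
  apply: eq_pm_trans (eq_pm_mull _ (eq_pm_sym (MpowS e))) _.
  rewrite mulrA; apply: eq_pm_trans (eq_pm_mulr _ (MpowMpow e)) _; exact: MpowS.
split=> //; case/lastP: w wn {B} => [|w c] wn.
  by left; rewrite /lrmx big_nil mulr1 tr22 /S_gen !mat22_simp.
have wn' : (size w < n)%N by move: wn; rewrite size_rcons.
have [_ h2] := IH w wn'; rewrite size_rcons.
apply: conj_lr_comm; first exact: SL2Z_S.
rewrite -cats1 lrmx_cat /lrmx big_seq1 -/(lrmx w) -/(letter c).
apply: (@conj_lr_pm _ (lrmx w * Mpow c)).
  rewrite -mulrA; apply: eq_pm_mull.
  apply: eq_pm_trans (eq_pm_mulr _ (eq_pm_sym (MpowS c))) _.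
  by rewrite -mulrA -[X in eq_pm _ X]mulr1; apply: eq_pm_mull; exact: SS.
apply: conj_lr_comm; first exact: SL2Z_lr.
by apply: conj_lr_le (h2 c); exact: leqnSn.
Qed.

(** If both optional ends are present, conjugation joins them into one more letter, paid for by
    their cost 2. *)
Lemma conj_lr_nf b w e : exists2 n, conj_lr (nf_val b w e) n & (2 * n <= nf_cost b w e)%N.
Proof.
have [h1 h2] := conj_lr_SM w; case: e => [e|].
  case: b; last first.
    exists (size w); last by rewrite /nf_cost; lia.
    by rewrite /nf_val mul1r; apply: conj_lr_comm => //; exact: SL2Z_lr.
  exists (size w).+1; last by rewrite /nf_cost /=; lia.
  rewrite /nf_val; apply: conj_lr_comm; first by apply: SL2Z_mul; [exact: SL2Z_S|exact: SL2Z_lr].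
  apply: (@conj_lr_pm _ (lrmx (e :: w))); last exact: conj_lr_self.
  by rewrite mulrA lrmx_letter; apply: eq_pm_mulr; exact: MpowS.
exists (size w); last by rewrite /nf_cost; lia.
by rewrite /nf_val mulr1; case: b => //; rewrite mul1r; exact: conj_lr_self.
Qed.

Lemma trace_conj h g : SL2Z h -> \tr (h * g * h^-1) = \tr g.
Proof.
move=> sh; rewrite inv22E// -[LHS]/(\tr (h * g *m inv22 h)) mxtrace_mulC.
by rewrite -[LHS]/(\tr (inv22 h * (h * g))) mulrA mulVmx22// mul1r.
Qed.

Lemma class_word_lr g k : SL2Z g -> 2 < `|\tr g| -> class_has_word g k ->
  exists h w, [/\ SL2Z h, eq_pm (h * g * inv22 h) (lrmx w) & (2 * size w <= k)%N].
Proof.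
move=> sg tg [u [ug su [h sh hE]]].
have [b [w [e [he hc]]]] := nf_exists ug; have [n cn nc] := conj_lr_nf b w e.
have : conj_lr (h * g * h^-1) n.
  by apply: conj_lr_pm cn; apply: eq_pm_trans he; exact: eq_pm_sym.
case=> [|[h' [w' [sh' hE' wn]]]]; first by rewrite trace_conj// leNgt tg.
exists (h' * h), w'; split; first exact: SL2Z_mul.
  by move: hE'; rewrite inv22E// inv22M !mulrA.
by rewrite -su; apply: leq_trans hc; apply: leq_trans nc; rewrite leq_mul2l wn orbT.
Qed.

Lemma class_word_code s : ~~ odd (size s) -> class_has_word (cfmx s) (2 * sumn s).
Proof.
move=> os; have [w wE ws] := cfmx_lr os.
exists (flatten [seq [:: (if b then M_gen else M_gen^-1); S_gen] | b <- w]); split.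
- elim: w {wE ws} => //= b w ->; rewrite andbT.
  by apply/andP; split; [case: b|]; rewrite /gens !inE eqxx ?orbT.
- rewrite -ws; elim: w {wE ws} => //= b w ->; lia.
exists 1; first exact: SL2Z_1.
rewrite invr1 mulr1 mul1r wE; elim: w {wE ws} => [|b w IH].
  by rewrite /= /lrmx !big_nil; exact: eq_pm_refl.
rewrite /= !big_cons mulrA lrmx_letter; apply: eq_pm_mul IH.
have -> : (if b then M_gen else M_gen^-1) = Mpow b.
  by case: b => //; rewrite inv22E//; exact: (SL2Z_M true).
exact: MpowS.
Qed.

End WordLength.

(** * The lower bound for the word length *)

Section WordLengthLowerBound.
Variable R : realType.
Implicit Types (g h P : 'M[int]_2) (w : seq bool) (s : seq nat) (p q : R * R).

Definition den g (x : R) : R := (g 1 0)%:~R * x + (g 1 1)%:~R.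

Lemma den_mul g h x : SL2Z h -> irrational_pt x -> den (g * h) x = den g (moebius h x) * den h x.
Proof.
move=> sh ix; have d := irr_den_neq0 sh ix; rewrite /den /moebius !mulmx22E.
rewrite mulrDl -mulrA divfK// !rmorphD !rmorphM /=; ring.
Qed.

(* The derivative of P at x is den P x ^- 2, so that the hypothesis on den says
   that q.2 is the attracting fixed point. *)
Lemma nonneg_fixed_crossing P q : SL2Z P -> nonneg_mx P -> irrational_pair q ->
  moebius P q.1 = q.1 -> moebius P q.2 = q.2 -> den P q.1 < den P q.2 -> crossing q.
Proof.
move=> sP [h1 h2 h3 h4] [i1 i2] /(fixes_moebius sP i1) + /(fixes_moebius sP i2).
rewrite /fixes_endpoint /den /crossing.
have c0 : 0 <= (P 1 0)%:~R :> R by rewrite ler0z.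
have b0 : 0 <= (P 0 1)%:~R :> R by rewrite ler0z.
(* If [b] vanished, dividing the fixed-point equation by [q.1] would leave a linear relation; so
   [b > 0], and the product [- b / c] of the two roots is negative. *)
have bne : (P 0 1)%:~R = 0 :> R -> (P 0 0)%:~R * q.1 + (P 0 1)%:~R = q.1 * ((P 1 0)%:~R * q.1 + (P 1 1)%:~R) ->
    (P 1 0)%:~R = 0 :> R.
  move=> -> e; have q10 : q.1 != 0 by apply/eqP => q0; have [] := i1 1 0; rewrite ?q0 ?mulr0 ?addr0.
  have : q.1 * ((P 1 0)%:~R * q.1 + (P 1 1 - P 0 0)%:~R) = 0.
    by rewrite rmorphB /=; lra.
  by move/eqP; rewrite mulf_eq0 (negbTE q10) /= => /eqP /i1[-> _].
move: c0 b0 bne; move: ((P 0 0)%:~R : R) ((P 0 1)%:~R : R) ((P 1 0)%:~R : R) ((P 1 1)%:~R : R).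
move: q i1 i2 => [y x] /= iy ix a b c d c0 b0 bne fy fx dl.
have cxy : 0 < c * (x - y) by lra.
have cp : 0 < c by rewrite lt_neqAle c0 andbT; apply/eqP => c00; move: cxy; rewrite -c00 mul0r ltxx.
have xy : y < x by rewrite -subr_gt0 -(pmulr_rgt0 _ cp).
have bp : 0 < b.
  rewrite lt_neqAle b0 andbT; apply/eqP => b00.
  by move: cp; rewrite (bne (esym b00) fy) ltxx.
have sum : c * (x + y) = a - d.
  have : (x - y) * (c * (x + y) - (a - d)) = 0 by lra.
  by move/eqP; rewrite mulf_eq0 subr_eq0 gt_eqF//= subr_eq0 => /eqP.
have prod : c * (x * y) = - b.
  have -> : c * (x * y) = x * (c * (x + y)) - c * x * x by ring.
  by rewrite sum; lra.
have xy0 : x * y < 0 by rewrite -(pmulr_rlt0 _ cp) prod oppr_lt0.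
apply/andP; split; rewrite ltNge; apply/negP => hh.
  have : 0 <= x * y by rewrite mulr_ge0//; lra.
  by lra.
have : 0 <= x * y by rewrite mulr_le0//; lra.
by lra.
Qed.

Lemma iter_fix T (f : T -> T) n m x : iter n f x = x -> iter (m * n) f x = x.
Proof. by move=> h; elim: m => //= m IH; rewrite mulSn iterD IH. Qed.

Lemma sumn_periodize s : sumn s = (\sum_(i < size s) periodize s i)%N.
Proof.
rewrite sumnE (big_nth 0%N) big_mkord; apply: eq_bigr => i _.
by rewrite /periodize modn_small.
Qed.

(** Minimality of the even period makes the digit sum the least positive return time of [fstep] to
    the lift, and a conjugate product of [size w] letters returns on the same cycle after [size w]
    steps. *)
Lemma word_length_lower s k : valid_code s -> class_has_word (cfmx s) k -> (2 * sumn s <= k)%N.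
Proof.
move=> vs hk; have es := valid_even vs; have /and3P[s0 os ps] := es.
have sg := SL2Z_cfmx os; set g := cfmx s in hk sg.
have [h [w [sh hE wk]]] := class_word_lr sg (cfmx_tr es) hk.
apply: leq_trans wk; rewrite leq_mul2l /=.
have sV := SL2Z_inv sh.
have tr3 : 3 <= \tr g.
  by have [_ h1 _ _ [h2 _]] := ccol_even es; rewrite tr22 /g cfmxE !mat22_simp; lia.
have trh : \tr (h * g * inv22 h) = \tr g by rewrite -(inv22E sh) trace_conj.
have [l1 l2 l3 l4] := lr_nonneg w.
(* The sign is settled by the trace: at least 3 on the left, nonnegative for [lrmx w]. *)
have {}hE : h * g * inv22 h = lrmx w.
  case: hE => // e; have : \tr (h * g * inv22 h) = - \tr (lrmx w) by rewrite e raddfN.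
  by rewrite trh [\tr (lrmx w)]tr22; lia.
have w0 : (0 < size w)%N.
  case: w hE {l1 l2 l3 l4} => // e; exfalso; move: trh tr3.
  have t2 : \tr (lrmx [::]) = 2 by rewrite /lrmx big_nil mat22_1 tr22 !mat22_simp.
  by rewrite e t2 => <-.
set p := cflift R s; have ip := @cflift_irr R s es; have cp := crossing_cflift R es.
have [f1 f2] := cflift_fixed R es; case: (ip) => i1 i2.
have {}f1 : moebius g p.1 = p.1 by apply/fixes_moebius.
have {}f2 : moebius g p.2 = p.2 by apply/fixes_moebius.
have hg : lrmx w * h = h * g by rewrite -hE -mulrA mulVmx22// mulr1.
have sw := SL2Z_lr w.
(* Conjugation preserves the multiplier at a fixed point, so it carries the attracting end point to
   the attracting one. *)
have denE x : irrational_pt x -> moebius g x = x -> den (lrmx w) (moebius h x) = den g x.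
  move=> ix fx; apply: (mulIf (irr_den_neq0 sh ix)); rewrite -[_ + _]/(den h x).
  by rewrite -den_mul// hg den_mul// fx mulrC.
have fixE x : irrational_pt x -> moebius g x = x -> moebius (lrmx w) (moebius h x) = moebius h x.
  by move=> ix fx; rewrite -moebius_mul// hg moebius_mul// fx.
set q := act h p; have iq : irrational_pair q by exact: act_irr.
have cq : crossing q.
  apply: (nonneg_fixed_crossing sw (lr_nonneg w) iq); rewrite ?fixE// /q /= !denE//.
  have [_ _ _ q1 _] := ccol_even es.
  rewrite /den /g cfmxE !mat22_simp -!pmulrn ltrD2r ltr_pM2l ?ltr0n//.
  by case/andP: cp => y0 x0; exact: lt_trans x0.
have Fq : iter (size w) (@fstep R) q = q.
  have {1}<- : act (lrmx w) q = q by rewrite /q /act /= !fixE.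
  by apply: fstep_lr => //; case/andP: cq.
have Fp : iter (sumn s) (@fstep R) p = p.
  have [v vE vs'] := cfmx_lr os; rewrite -vs'.
  have {1}<- : act (lrmx v) p = p by rewrite -vE -/g /act f1 f2 -surjective_pairing.
  by apply: fstep_lr => //; case/andP: cp.
have sum0 : (0 < sumn s)%N.
  by have [a [b [t [-> [_ [a0 _]]]]]] := even_code2 es; rewrite /= addn_gt0 a0.
have Fwp : iter (size w) (@fstep R) p = p.
  (* If [q] comes after [p], continuing to a multiple of the period of [p] leads from [q] back to
     [p]. *)
  have [j jE] : exists j, iter j (@fstep R) q = p.
    have [j [jE|jE]] := crossing_fstep sh ip cp cq; first by exists j.
    exists (j * sumn s - j)%N; rewrite -/p -/q in jE; rewrite -jE -iterD subnK ?iter_fix//.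
    by rewrite leq_pmulr.
  by rewrite -jE -iterD addnC iterD Fq.
have [x xt x0] := code_tails R es; have rp := @reduced_cflift R s es; have /andP[yp _] := rp.
have [j [jE e]] : exists j, size w = (\sum_(i < j.*2) periodize s i)%N /\
      iter (size w) (@fstep R) (p.1, x 0%N) = (back (periodize s) p.1 j.*2, x j.*2).
  by apply: fstep_return => //; rewrite x0 -surjective_pairing Fwp.
have j0 : (0 < j)%N by case: j jE {e} => //; rewrite big_ord0 => e; move: w0; rewrite e.
have sj : (size s <= j.*2)%N.
  case: (vs) => _ [_ ms]; apply: ms; split; rewrite ?double_gt0 ?odd_double// => i.
  have := cf_digits_unique xt (cf_tails_shift j.*2 xt); rewrite add0n => hd.
  have [|<- //] := hd _ i.
  by move: e; rewrite x0 -surjective_pairing Fwp => /(congr1 snd).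
rewrite jE sumn_periodize -(subnKC sj) big_split_ord /=; exact: leq_addr.
Qed.

Lemma word_length_geod s : valid_code s -> word_length (@geod R s) = (2 * sumn s)%N.
Proof.
move=> vs; have vc := valid_code_geod R vs; have /and3P[_ oc _] := valid_even vc.
rewrite -(sumn_code_geod R vs) /word_length -[gamma _]/(cfmx (Defs.code (@geod R s))).
set c := Defs.code _ in vc oc *; set X := [set k | _].
have hX : X (2 * sumn c)%N.
  by split; [exact: class_word_code|move=> j; exact: word_length_lower].
have [h1 h2] : X (xget 0%N X) by apply: xgetPex; exists (2 * sumn c)%N.
by apply/eqP; rewrite eqn_leq h2 ?word_length_lower//; case: hX.
Qed.

End WordLengthLowerBound.

(** A cube is enough to compare weights: about [N] terms, each smaller by [N^-3], remain negligible
    against a denominator of relative size [N^-1]. The constant 24 is generous. *)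
Lemma cube_le_exp k : (k.+1 ^ 3 <= 24 * 2 ^ k)%N.
Proof.
elim: k => // k IH.
have [k3|k3] := leqP k 3; first by case: k k3 {IH} => [|[|[|[|]]]].
rewrite [in leqRHS]expnS; apply: leq_trans (_ : 2 * k.+1 ^ 3 <= _)%N; last by lia.
rewrite !expnS !expn0 !muln1; nia.
Qed.

(** * Counting geodesics *)

Section Counting.
Variables (R : realType) (A : nat).
Implicit Types (s t : seq nat) (C : set (R * R)) (E : pred (set (R * R))).

Lemma ncard_seq (T : choiceType) (l : seq T) (X : set T) : uniq l ->
  (forall x, X x <-> x \in l) -> ncard X = size l.
Proof.
move=> ul Xl; have -> : X = [set` [fset x in l]%fset].
  apply/seteqP; split => x /=; first by move=> /Xl; rewrite !inE.
  by rewrite !inE => ?; apply/Xl.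
by rewrite /ncard set_fsetK card_fseq undup_id.
Qed.

Definition prim s : bool := `[< minimal_even_period s >].

Lemma prim_valid n s : is_word A n s -> prim s -> valid_code s.
Proof. by move=> ws /asboolP ms; split => //; exact: word_pos ws. Qed.

Lemma valid_rot_inj s i j : valid_code s -> (i.*2 < size s)%N -> (j.*2 < size s)%N ->
  rot i.*2 s = rot j.*2 s -> i = j.
Proof.
move=> vs; wlog ij : i j / (i <= j)%N.
  by move=> h; have [l|/ltnW l] := leqP i j => hi hj e; [exact: h|apply/esym/h].
move=> hi hj e; apply/eqP; rewrite eqn_leq ij leqNgt; apply/negP => lt.
case: (vs) => _ [[s0 os _] ms].
suff : (size s <= (j - i).*2)%N.
  by rewrite leqNgt (leq_ltn_trans _ hj)// leq_double leq_subr.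
apply: ms; split; rewrite ?odd_double//; first by rewrite double_gt0 subn_gt0.
apply: (@periodize_shift_period s i.*2) => // k.
rewrite -addnA -doubleD subnKC// -!periodize_rot ?e//; exact: ltnW.
Qed.

Lemma count_fiber n s : is_word A n s -> prim s ->
  count (fun t => prim t && (@geod R t == geod s)) (words A n) = n./2.
Proof.
move=> ws ps; have vs := prim_valid ws ps; have /andP[/eqP sn sA] := ws.
have /and3P[s0 os _] := valid_even vs.
have nE : n = n./2.*2 by rewrite even_halfK// -sn.
rewrite -size_filter -[RHS](size_iota 0) -(size_map (fun j => rot j.*2 s)).
apply: perm_size; apply: uniq_perm.
- by rewrite filter_uniq// words_uniq.
- rewrite map_inj_in_uniq ?iota_uniq// => i j; rewrite !mem_iota !add0n => hi hj.
  by apply: valid_rot_inj => //; rewrite sn nE ltn_double.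
move=> t; rewrite mem_filter mem_words; apply/idP/mapP.
  move=> /andP[/andP[pt /eqP gt] wt].
  have [k ks tE] := geod_inj vs (prim_valid wt pt) (esym gt).
  (* The remaining value [k = n./2] is a full turn, represented by 0. *)
  have [kn|kn] := ltnP k n./2; first by exists k; rewrite ?mem_iota.
  exists 0%N.
    by rewrite mem_iota /= add0n; move: s0; rewrite sn {1}nE double_gt0.
  have ke : k.*2 = size s.
    by apply/eqP; rewrite eqn_leq ks sn nE leq_double.
  by rewrite tE ke rot_size rot0.
move=> [j]; rewrite mem_iota add0n => jn ->.
have ks : (j.*2 <= size s)%N by rewrite sn nE leq_double ltnW.
have [_ mr] := valid_rot ks vs.
rewrite geod_rot// eqxx andbT; apply/andP; split; first exact/asboolP.
by rewrite /is_word size_rot sn eqxx /=; apply/allP => a; rewrite mem_rot; exact: (allP sA).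
Qed.

Definition level n E : seq (set (R * R)) :=
  undup [seq geod s | s <- words A n & prim s && E (geod s)].

(** By [count_fiber] every geodesic occurs exactly [n./2] times in the list before [undup]. *)
Lemma card_level n E :
  (n./2 * size (level n E))%N = count (fun s => prim s && E (geod s)) (words A n).
Proof.
rewrite /level; set L := [seq @geod R s | s <- words A n & prim s && E (@geod R s)].
rewrite -size_filter -(size_map (@geod R)) -/L.
rewrite -(perm_size (perm_count_undup L)) size_flatten /shape -map_comp.
have hL C : C \in undup L -> count_mem C L = n./2.
  rewrite mem_undup => /mapP[s]; rewrite mem_filter mem_words => /andP[/andP[ps Es] ws] ->.
  rewrite -(count_fiber ws ps) /L count_map count_filter; apply: eq_count => t /=.
  by case: eqP => [->|_]; rewrite ?Es ?andbT ?andbF.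
rewrite -/L; elim: (undup L) hL => [|C l IH] hL; first by rewrite muln0.
rewrite /= size_nseq mulnS IH ?hL ?mem_head// => D Dl.
by apply: hL; rewrite inE Dl orbT.
Qed.

Lemma level_size n E C : C \in level n E ->
  exists s, [/\ is_word A n s, valid_code s, C = geod s & E C].
Proof.
rewrite mem_undup => /mapP[s]; rewrite mem_filter mem_words => /andP[/andP[ps Es] ws] ->.
by exists s; split => //; exact: prim_valid ws ps.
Qed.

Lemma PiP N C : Pi_ A N C <-> exists s, [/\ valid_code s, is_word A (size s) s, (size s <= N)%N & C = geod s].
Proof.
split.
  move=> [pC [s hs sA] lC]; have [vs CE] := has_code_geod pC hs; exists s; split => //.
    rewrite /is_word eqxx; apply/allP => a sa; rewrite (allP sA) // andbT.
    by case: vs => /allP ->.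
  by move: lC; rewrite CE period_length_geod.
move=> [s [vs /andP[_ sA] sN ->]]; split.
- by apply: geod_prim; exact: valid_even.
- exists s; first exact: has_code_self.
  by apply: sub_all sA => a /andP[].
- by rewrite period_length_geod.
Qed.

(** Levels of different lengths are disjoint, because a geodesic determines the length of its codes,
    and that length is even. *)
Lemma card_Pi N (E : set (R * R) -> Prop) : ncard [set C | Pi_ A N C /\ E C] =
  (\sum_(m <- iota 1 N./2) size (level m.*2 (fun C => `[< E C >])))%N.
Proof.
set F := fun C => `[< E C >].
rewrite (@ncard_seq _ (flatten [seq level m.*2 F | m <- iota 1 N./2])).
- by rewrite size_flatten /shape -map_comp sumnE big_map.
- elim: (N./2) 1%N => //= k IH i; rewrite cat_uniq undup_uniq IH andbT /=.
  apply/hasPn => C /flattenP[l /mapP[j]]; rewrite mem_iota => /andP[ij _] -> /level_size.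
  move=> [s [/andP[/eqP sj _] vs CE _]]; apply/negP => /level_size[t [/andP[/eqP ti _] vt CE' _]].
  have := period_length_geod R vs; rewrite -CE CE' period_length_geod// ti sj.
  by move/double_inj => e; rewrite e ltnn in ij.
move=> C; split.
  move=> [/PiP[s [vs ws sN CE]] EC]; apply/flattenP.
  have /and3P[s0 os _] := valid_even vs.
  have sE : size s = (size s)./2.*2 by rewrite even_halfK.
  exists (level (size s)./2.*2 F).
    apply: map_f; rewrite mem_iota add1n ltnS half_leq// andbT.
    by move: s0; rewrite {1}sE double_gt0.
  rewrite mem_undup CE; apply: map_f; rewrite mem_filter mem_words -sE ws andbT.
  by apply/andP; split; apply/asboolP; [case: vs|rewrite -CE].
move=> /flattenP[l /mapP[m]]; rewrite mem_iota add1n ltnS => /andP[m1 mN] -> /level_size.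
move=> [s [ws vs CE /asboolP EC]]; split => //; apply/PiP; exists s.
have /andP[/eqP sm _] := ws; split=> //; first by rewrite sm.
by rewrite sm -[N](odd_double_half) (leq_trans _ (leq_addl _ _))// leq_double.
Qed.

Hypothesis A1 : (1 < A)%N.
Let A0 : (0 < A)%N := ltnW A1.

Lemma card_level_prob m E : (0 < m)%N -> (size (level m.*2 E))%:R =
  (A ^ m.*2)%:R / m%:R * prob R A m.*2 (fun s => prim s && E (geod s)) :> R.
Proof.
move=> m0; rewrite prob_count -card_level doubleK natrM.
have n1 : (A ^ m.*2)%:R != 0 :> R by rewrite gt_eqF// An_gt0.
have n2 : m%:R != 0 :> R by rewrite pnatr_eq0 -lt0n.
by field; rewrite n1 n2.
Qed.

(** Bezout, as [size s] is itself a period of [periodize s]. *)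
Lemma period_gcd s m : (0 < m)%N -> (forall i, periodize s (i + m) = periodize s i) ->
  forall i, periodize s (i + gcdn (size s) m) = periodize s i.
Proof.
move=> m0 per i.
have perk j k : periodize s (j + k * m) = periodize s j.
  by elim: k => [|k IH]; rewrite ?addn0// mulSn addnCA addnC per.
have [a _ /dvdnP[c cE]] := Bezoutr (size s) m0.
rewrite -[RHS](perk i c) -cE /periodize.
by rewrite addnA [(_ + a * _)%N]addnC modnMDl.
Qed.

(** A smaller even period [k] yields the period [gcdn (size s) k], a proper divisor of [m.*2] and so
    at most [m]; the prefix of that length determines the word. *)
Lemma nonprim_mem m s : (0 < m)%N -> is_word A m.*2 s -> ~~ prim s ->
  s \in [seq mkseq (periodize t) m.*2 | d <- iota 1 m, t <- words A d].
Proof.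
move=> m0 /andP[/eqP sm sA] /asboolP nm.
have [k [ek ks]] : exists k, even_period s k /\ (k < size s)%N.
  apply: contrapT => h; apply: nm; split.
    by split; rewrite ?sm ?double_gt0 ?odd_double// => i; rewrite -sm periodize_size.
  by move=> k ek; rewrite leqNgt; apply/negP => ks; apply: h; exists k.
case: ek => k0 ok per; have pg := period_gcd k0 per.
set d := gcdn (size s) k in pg.
have d0 : (0 < d)%N by rewrite gcdn_gt0 k0 orbT.
have dk : (d <= k)%N by apply: dvdn_leq => //; exact: dvdn_gcdr.
have /dvdnP[c cE] : (d %| size s)%N by exact: dvdn_gcdl.
have dm : (d <= m)%N.
  have c2 : (2 <= c)%N by case: c cE => [|[|c]] //; lia.
  by rewrite -leq_double -sm cE -mul2n leq_mul2r c2 orbT.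
have ds : (d <= size s)%N by rewrite sm; lia.
apply/allpairsPdep; exists d, (take d s); split => /=.
- by rewrite mem_iota d0 add1n ltnS.
- rewrite mem_words /is_word size_takel// eqxx /=.
  by apply/allP => a /mem_take; exact: (allP sA).
apply: (@eq_from_nth _ 0%N); first by rewrite size_mkseq.
move=> i is_; rewrite nth_mkseq -?sm// /periodize size_takel// nth_take ?ltn_mod//.
have perk j e : periodize s (j + e * d) = periodize s j.
  by elim: e => [|e IH]; rewrite ?addn0// mulSn addnCA addnC pg.
have -> : nth 0%N s i = periodize s i by rewrite /periodize modn_small.
have -> : nth 0%N s (i %% d) = periodize s (i %% d).
  have e : ((i %% d) %% size s = i %% d)%N by apply: modn_small; exact: leq_trans (ltn_pmod i d0) ds.
  by rewrite /periodize e.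
by rewrite {1}(divn_eq i d) addnC perk.
Qed.

Lemma nonprim_count m : (0 < m)%N ->
  (count (fun s => ~~ prim s) (words A m.*2) <= m * A ^ m)%N.
Proof.
move=> m0; rewrite -size_filter.
apply: leq_trans (uniq_leq_size _ _) _; [by rewrite filter_uniq// words_uniq| |].
  by move=> s; rewrite mem_filter mem_words => /andP[ns ws]; exact: nonprim_mem ws ns.
rewrite size_allpairs_dep.
suff H l : all (fun d => d <= m)%N l -> (sumn [seq size (words A d) | d <- l] <= size l * A ^ m)%N.
  have := H (iota 1 m); rewrite size_iota; apply.
  by apply/allP => d; rewrite mem_iota add1n ltnS => /andP[].
elim: l => //= d l IH /andP[dm /IH h]; rewrite mulSn leq_add// size_words.
by rewrite leq_exp2l.
Qed.

Lemma exp_beats_linear (rho : R) : 0 < rho -> exists n0, forall m, (n0 <= m)%N ->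
  m%:R <= rho * (A ^ m)%:R.
Proof.
move=> r0; exists (Num.bound (24 / rho)) => m hm.
have mR : 24 / rho < m%:R.
  apply: lt_le_trans (_ : (Num.bound (24 / rho))%:R <= _); last by rewrite ler_nat.
  by apply: archi_boundP; rewrite divr_ge0// ltW.
have m0 : 0 < m%:R :> R by apply: lt_trans mR; rewrite divr_gt0.
rewrite ltr_pdivrMr// in mR.
have h1 : (m.+1 ^ 3)%:R <= (24 * 2 ^ m)%:R :> R by rewrite ler_nat cube_le_exp.
have h2 : (2 ^ m)%:R <= (A ^ m)%:R :> R by rewrite ler_nat leq_exp2r// -(ltr0n R).
have h3 : m%:R * m%:R * m%:R <= (m.+1 ^ 3)%:R :> R.
  by rewrite -!natrM ler_nat; lia.
rewrite natrM in h1.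
have h4 : 24 * (m%:R * m%:R) <= m%:R * rho * (m%:R * m%:R) by rewrite ler_wpM2r ?mulr_ge0// ltW.
have h5 : rho * (m%:R * m%:R * m%:R) <= rho * (24 * (A ^ m)%:R).
  by rewrite ler_pM2l//; apply: le_trans h3 (le_trans h1 _); rewrite ler_pM2l.
have m1 : 1 <= m%:R :> R by rewrite ler1n -(ltr0n R).
have h6 : m%:R <= m%:R * m%:R :> R by nra.
nra.
Qed.

Lemma prim_prob (rho : R) : 0 < rho -> exists n0, forall m, (n0 <= m)%N ->
  prob R A m.*2 (fun s => ~~ prim s) <= rho.
Proof.
move=> r0; have [n0 H] := exp_beats_linear r0; exists n0.+1 => m nm.
have m0 : (0 < m)%N by apply: leq_ltn_trans nm.
have An := @An_gt0 R A A0 m.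
rewrite prob_count -addnn expnD natrM ler_pdivrMr ?mulr_gt0//.
apply: le_trans (_ : (m * A ^ m)%:R <= _); first by rewrite ler_nat addnn nonprim_count.
by rewrite natrM mulrA ler_pM2r//; apply: H; exact: ltnW.
Qed.

End Counting.

(** * Averages with exponentially growing weights *)

Section WeightedRatio.
Variables (R : realType) (A : nat).
Hypothesis A1 : (1 < A)%N.
Let A0 : (0 < A)%N := ltnW A1.

Let w m : R := (A ^ m.*2)%:R / m%:R.

Let w_ge0 m : 0 <= w m.
Proof. by rewrite divr_ge0. Qed.

(** The exponent falls short of the largest one by [k] with [delta * N <= k.+1], and [A ^ k] beats
    the cube of [k.+1]. The [+ 1] accounts for odd [N]. *)
Lemma small_weights (delta : R) N m : 0 < delta -> (0 < m)%N -> (0 < N)%N ->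
  m.*2%:R < (1 - delta) * N%:R ->
  w m <= 24 / (delta * N%:R) ^+ 3 * (A ^ N./2.*2)%:R.
Proof.
move=> d0 m0 N0 mN.
have NR : 0 < N%:R :> R by rewrite ltr0n.
have mN2 : (m.*2 <= N./2.*2)%N.
  rewrite leq_double -[m]doubleK half_leq// -(ler_nat R) ltW//; apply: lt_le_trans mN _.
  by rewrite mulrBl mul1r gerBl mulr_ge0// ltW.
set k := (N./2.*2 - m.*2)%N.
have kE : N./2.*2 = (m.*2 + k)%N by rewrite subnKC.
have dN : 0 < delta * N%:R by rewrite mulr_gt0.
have kN : delta * N%:R <= k.+1%:R.
  have : (N <= m.*2 + k.+1)%N by rewrite addnS -kE -{1}(odd_double_half N); case: odd; rewrite /= ?add1n ?add0n.
  rewrite -(ler_nat R) natrD; rewrite mulrBl mul1r in mN; lra.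
have wm : w m <= (A ^ m.*2)%:R.
  rewrite /w ler_pdivrMr ?ltr0n// ler_peMr// ler1n//.
apply: le_trans wm _.
rewrite mulrAC ler_pdivlMr ?exprn_gt0//.
apply: le_trans (_ : (A ^ m.*2)%:R * (k.+1 ^ 3)%:R <= _).
  by rewrite ler_wpM2l// natrX lerXn2r ?nnegrE// ltW.
rewrite kE expnD natrM mulrCA ler_wpM2l// -natrM ler_nat.
apply: leq_trans (cube_le_exp k) _; rewrite leq_mul2l /=.
by case: (k) => // k'; rewrite leq_exp2r.
Qed.

Lemma weighted_ratio (a : nat -> nat -> R) (b : nat -> R) (L : R) :
  0 <= L <= 1 -> (forall N m, 0 <= a N m <= b m) -> (forall m, b m <= 1) ->
  (forall rho : R, 0 < rho -> exists2 delta : R, 0 < delta < 1 & exists N0, forall N m, (N0 <= N)%N ->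
     (1 - delta) * N%:R <= m.*2%:R -> (m.*2 <= N)%N -> `|a N m - L| <= rho /\ 1 - rho <= b m) ->
  (fun N => (\sum_(m <- iota 1 N./2) w m * a N m) / (\sum_(m <- iota 1 N./2) w m * b m)) @ \oo --> L.
Proof.
move=> /andP[L0 L1] ab b1 H; apply/cvgrPdist_le => e e0.
(* Terms in the window cost [4 * rho] and the others together [rho]; the cap at one half keeps
   [b m >= 1 / 2] in the window. *)
pose rho := Num.min (e / 5) 2^-1.
have r0 : 0 < rho by rewrite lt_min invr_gt0 divr_gt0//= ltr0n.
have re : rho <= e / 5 by rewrite ge_min lexx.
have r2 : rho <= 2^-1 by rewrite ge_min lexx orbT.
have [delta /andP[d0 d1] [N0 HN]] := H rho r0.
have d3 : 0 < delta ^+ 3 * rho by rewrite mulr_gt0// exprn_gt0.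
(* Beyond [K1], at most [N / 2] terms of size [B] sum to at most [rho * (W / N)]. Beyond [K2] one
   has [delta * N >= 1], so the window contains the top index [N./2], which alone bounds the
   denominator from below. *)
have [K1 hK1] : exists K : nat, 12 / (delta ^+ 3 * rho) <= K%:R.
  by exists (Num.bound (12 / (delta ^+ 3 * rho))); apply/ltW/archi_boundP; rewrite divr_ge0// ltW.
have [K2 hK2] : exists K : nat, delta^-1 <= K%:R.
  by exists (Num.bound delta^-1); apply/ltW/archi_boundP; rewrite invr_ge0 ltW.
exists (N0 + K1 + K2.+2)%N => // N /= hN.
have [NN0 hB1 [hB2 N2']] : [/\ (N0 <= N)%N, (K1 <= N)%N & (K2 <= N)%N /\ (2 <= N)%N].
  by move: hN; clear => h; split; [lia|lia|split; lia].
have N1 : 12 / (delta ^+ 3 * rho) <= N%:R by apply: le_trans hK1 _; rewrite ler_nat.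
have N2 : delta^-1 <= N%:R by apply: le_trans hK2 _; rewrite ler_nat.
have NR : 0 < N%:R :> R by rewrite ltr0n ltnW.
have dN : 1 <= delta * N%:R by rewrite mulrC -ler_pdivrMr// div1r.
set M := N./2; have M0 : (0 < M)%N by rewrite /M half_gt0.
have MN : (M.*2 <= N)%N by rewrite -[leqRHS]odd_double_half leq_addl.
have MN' : (1 - delta) * N%:R <= M.*2%:R.
  have : (N <= M.*2 + 1)%N by rewrite addnC -[leqLHS]odd_double_half leq_add2r; case: odd.
  by rewrite -(ler_nat R) natrD mulrBl mul1r; lra.
pose W := (A ^ M.*2)%:R : R.
have W0 : 0 < W by exact: An_gt0.
set Num_ := \sum_(m <- _) _ * a N m; set Den := \sum_(m <- _) _ * b m.
have b0 m : 0 <= b m by have /andP[h1 h2] := ab 0%N m; exact: le_trans h2.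
have Mio : M \in iota 1 M by rewrite mem_iota M0 add1n ltnS leqnn.
have DenW : W / N%:R <= Den.
  rewrite /Den (bigD1_seq M) ?iota_uniq//=.
  apply: le_trans (_ : w M * b M <= _); last first.
    by rewrite lerDl; apply: sumr_ge0 => i _; rewrite mulr_ge0.
  have [_ bM] := HN N M NN0 MN' MN.
  have MR : 0 < M%:R :> R by rewrite ltr0n.
  have M2 : M%:R * 2 <= N%:R :> R by rewrite -natrM ler_nat muln2.
  apply: le_trans (_ : w M * 2^-1 <= _); last by rewrite ler_wpM2l//; lra.
  rewrite /w -/W -mulrA ler_pM2l// -invfM lef_pV2 ?posrE ?mulr_gt0//.
have Den0 : 0 < Den by apply: lt_le_trans DenW; rewrite divr_gt0.
pose B := 24 / (delta * N%:R) ^+ 3 * W.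
have B0 : 0 <= B by rewrite mulr_ge0 ?ltW// divr_gt0// exprn_gt0// mulr_gt0.
have term m : m \in iota 1 M -> `|w m * a N m - L * (w m * b m)| <= 4 * rho * (w m * b m) + B.
  rewrite mem_iota add1n ltnS => /andP[m0 mM].
  have /andP[a0 ab'] := ab N m; have bm1 := b1 m; have bm0 := b0 m.
  have -> : w m * a N m - L * (w m * b m) = w m * (a N m - L * b m) by ring.
  have -> : 4 * rho * (w m * b m) = w m * (4 * rho * b m) by ring.
  rewrite normrM (ger0_norm (w_ge0 m)).
  have [mN|mN] := leP ((1 - delta) * N%:R) m.*2%:R.
    have mN2 : (m.*2 <= N)%N by apply: leq_trans MN; rewrite leq_double.
    have [h1 h2] := HN N m NN0 mN mN2.
    apply: le_trans (_ : w m * (4 * rho * b m) <= _); last by rewrite lerDl.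
    rewrite ler_wpM2l//.
    have h3 : 2 * rho <= 4 * rho * b m by rewrite -[leLHS]mulr1; nra.
    apply: le_trans h3; move: h1; rewrite !ler_norml => /andP[h4 h5]; apply/andP; split; nra.
  apply: le_trans (_ : B <= _); last first.
    by rewrite lerDr mulr_ge0// mulr_ge0// mulr_ge0// ltW.
  have Npos : (0 < N)%N by exact: ltnW N2'.
  apply: le_trans (small_weights d0 m0 Npos mN).
  rewrite ler_piMr// ler_norml; apply/andP; split; nra.
have main : `|Num_ - L * Den| <= 5 * rho * Den.
  rewrite /Num_ /Den mulr_sumr -sumrB; apply: le_trans (ler_norm_sum _ _ _) _.
  apply: le_trans (_ : \sum_(m <- iota 1 M) (4 * rho * (w m * b m) + B) <= _).
    by rewrite big_seq [leRHS]big_seq; exact: ler_sum.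
  rewrite big_split /= -mulr_sumr -/Den big_const_seq count_predT iter_addr_0 size_iota.
  have -> : 5 * rho * Den = 4 * rho * Den + rho * Den by ring.
  rewrite lerD2l -mulr_natr.
  have M2 : M%:R * 2 <= N%:R :> R by rewrite -natrM ler_nat muln2.
  apply: le_trans (_ : B * (N%:R / 2) <= _); first by rewrite ler_wpM2l//; lra.
  apply: le_trans (_ : rho * (W / N%:R) <= _); last by rewrite ler_pM2l.
  have -> : B * (N%:R / 2) = (12 / (delta ^+ 3 * rho)) * (rho * (W / N%:R)) / N%:R.
    by rewrite /B; field; rewrite !gt_eqF.
  rewrite ler_pdivrMr// mulrC ler_pM2l//.
  by rewrite mulr_gt0// divr_gt0.
rewrite distrC -[L](mulfK (lt0r_neq0 Den0)) -mulrBl normrM normfV (gtr0_norm Den0).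
by rewrite ler_pdivrMr//; apply: le_trans main _; rewrite ler_pM2r//; lra.
Qed.

End WeightedRatio.

(** * The limit law *)

Section LengthLln.
Variables (R : realType) (A : nat).
Hypothesis A1 : (1 < A)%N.
Let A0 : (0 < A)%N := ltnW A1.

(** The window around [N] depends on [eta] for the sake of [Lmax], where the length is [N] rather
    than a function of the word. Restricting to [prim s] keeps to words that are codes. *)
Definition length_concentrates (l : standard_length) (c : R) := forall eta : R, 0 < eta ->
  exists2 delta : R, 0 < delta < 1 & exists N0, forall N m, (N0 <= N)%N ->
    (1 - delta) * N%:R <= m.*2%:R -> (m.*2 <= N)%N ->
    prob R A m.*2 (fun s => prim s &&
      (eta * m.*2%:R < `|length_of l N (@geod R s) - c * m.*2%:R|)) <= eta.

Let concentrates_of_lln l c : (forall N N' C, @length_of R l N C = length_of l N' C) ->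
  (forall eta : R, 0 < eta -> exists n0, forall n, (n0 <= n)%N ->
    prob R A n (fun s => prim s && (eta * n%:R < `|length_of l 0 (@geod R s) - c * n%:R|)) <= eta) ->
  length_concentrates l c.
Proof.
move=> lN H eta e0; have [n0 Hn] := H eta e0; exists 2^-1.
  by rewrite invr_gt0 ltr0n invf_lt1 ?ltr1n ?ltr0n.
exists (n0.*2)%N => N m hN hm mN.
have nm : (n0 <= m.*2)%N.
  rewrite -(ler_nat R); apply: le_trans hm.
  have : (n0.*2)%:R <= N%:R :> R by rewrite ler_nat.
  by rewrite -muln2 natrM; lra.
apply: le_trans (Hn _ nm); apply: (@le_prob R A A0) => s _ /andP[-> h].
by rewrite /= (lN 0%N N).
Qed.

Lemma length_lln l : exists2 c : R, 0 < c & length_concentrates l c.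
Proof.
case: l.
- have [c c0 Hc] := @continuant_lln R A A0; exists c => //.
  apply: concentrates_of_lln => // eta e0.
  (* Words that are not codes receive the main term, so that the bounded error holds for all
     nonempty words. *)
  pose f s := if `[< valid_code s >] then geometric_length (@geod R s) else 2 * ln (cont s)%:R : R.
  have fD n s : is_word A n s -> (0 < n)%N -> `|f s - 2 * ln (cont s)%:R| <= 2 * ln 2.
    move=> ws n0; rewrite /f; case: asboolP => vs; first exact: geometric_length_bound.
    by rewrite subrr normr0 mulr_ge0// ltW// ln2_gt0.
  have [n0 Hn] := Hc f (2 * ln 2) fD eta e0.
  exists n0 => n nn; apply: le_trans (Hn n nn); apply: (@le_prob R A A0) => s ws /andP[ps h].
  by rewrite /f asboolT//; exact: prim_valid ws ps.
- exists A.+1%:R => //; apply: concentrates_of_lln => // eta e0.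
  have [n0 Hn] := @letter_sum_lln R A A0 eta e0.
  exists n0 => n nn; apply: le_trans (Hn n nn); apply: (@le_prob R A A0) => s ws /andP[ps].
  by rewrite /= word_length_geod//; exact: prim_valid ws ps.
(* In the window [N - 2 m <= eta / 2 * N], and [delta <= 1 / 2] gives [N <= 2 * (2 m)]; hence the
   deviation event is empty. *)
exists 1 => // eta e0; pose delta := Num.min 2^-1 (eta / 2).
have d0 : 0 < delta by rewrite lt_min invr_gt0 divr_gt0// ltr0n.
have d1 : delta <= 2^-1 by rewrite ge_min lexx.
have d2 : delta <= eta / 2 by rewrite ge_min lexx orbT.
exists delta; first by rewrite d0 /=; lra.
exists 0%N => N m _ hm mN.
apply: le_trans (ltW e0); rewrite -[X in _ <= X](@avg_cst R A A0 m.*2 0).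
apply: (@le_avg R A A0) => s _; rewrite /= mul1r.
suff -> : eta * m.*2%:R < `|N%:R - m.*2%:R| = false by rewrite andbF.
apply/negbTE; rewrite -leNgt.
have mNR : m.*2%:R <= N%:R :> R by rewrite ler_nat.
have N0 : 0 <= N%:R :> R by [].
have h1 : delta * N%:R <= 2^-1 * N%:R by rewrite ler_wpM2r.
have h2 : delta * N%:R <= eta / 2 * N%:R by rewrite ler_wpM2r.
have h3 : eta * N%:R <= eta * (2 * m.*2%:R) by rewrite ler_wpM2l ?(ltW e0)//; lra.
by rewrite ger0_norm ?subr_ge0//; lra.
Qed.

End LengthLln.

(** * One-sided limits *)

Section OneSided.
Variables (R : realType) (A : nat).
Hypothesis A1 : (1 < A)%N.
Let A0 : (0 < A)%N := ltnW A1.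
Implicit Types (s : seq nat) (l : standard_length).

(** The means cancel in pairs, so at even length the centred sum is the winding number itself. *)
Lemma centered_sumE s : centered_sum R A s = (alt_sum s)%:~R - letter_mean R A * (odd (size s))%:R.
Proof.
elim: s => [|a s IH] /=; first by rewrite mulr0 subr0.
rewrite IH rmorphB /= -/(alt_sum s); case: (odd _) => /=; rewrite ?mulr1 ?mulr0; ring.
Qed.

Definition ratio l N s : R := (alt_sum s)%:~R / Num.sqrt (length_of l N (@geod R s)).

(** The event for the closed interval is the one-sided event closed at [b] minus the one open at
    [a], hence both variants. *)
Definition cmp (strict : bool) (x y : \bar R) : bool := if strict then (x < y)%E else (x <= y)%E.

Definition gcdfe (s : R) (x : \bar R) : R :=
  match x with x%:E => gcdf s x | +oo%E => 1 | -oo%E => 0 end.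

(** Where the length is [c * n] up to [eta * n], replacing it by [c * n] shifts the threshold for
    the winding number by at most [kappa / 2 * sqrt n], which [clt] tolerates. *)
Lemma one_sided_fin l (c : R) strict (b rho : R) : 0 < c -> length_concentrates A l c -> 0 < rho ->
  exists2 delta : R, 0 < delta < 1 & exists N0, forall N m, (N0 <= N)%N ->
    (1 - delta) * N%:R <= m.*2%:R -> (m.*2 <= N)%N ->
    `|prob R A m.*2 (fun s => prim s && cmp strict (ratio l N s)%:E b%:E)
      - heat (letter_var R A) (b * Num.sqrt c)| <= rho.
Proof.
move=> c0 Hc r0; have r4 : 0 < rho / 4 by rewrite divr_gt0.
have r8 : 0 < rho / 8 by rewrite divr_gt0.
have [kappa k0 [n0 Hclt]] := clt A1 (b * Num.sqrt c) r4.
have [n1 Hprim] := prim_prob A1 r8.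
have sc : 0 < Num.sqrt c by rewrite sqrtr_gt0.
have b1 : 0 < `|b| + 1 by rewrite ltr_pwDr.
(* In turn: small probability of the exceptional event, positive length, small shift of the
   threshold. Adding 1 to the modulus of [b] allows [b = 0]. *)
pose eta := Num.min (rho / 8) (Num.min (c / 2) (kappa * Num.sqrt c / (2 * (`|b| + 1)))).
have e0 : 0 < eta by rewrite !lt_min r8 divr_gt0//= divr_gt0// mulr_gt0.
have e1 : eta <= rho / 8 by rewrite ge_min lexx.
have e2 : eta <= c / 2 by rewrite !ge_min lexx !orbT.
have e3 : eta <= kappa * Num.sqrt c / (2 * (`|b| + 1)) by rewrite !ge_min lexx !orbT.
have {}e3 : `|b| * (eta / Num.sqrt c) <= kappa / 2.
  move: e3; rewrite ler_pdivlMr ?mulr_gt0// => e3.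
  have : `|b| * eta <= (kappa / 2) * Num.sqrt c by have := normr_ge0 b; nra.
  by rewrite -ler_pdivrMr// mulrA.
have [delta d01 [N0 HN]] := Hc eta e0; exists delta => //.
have /andP[d0 d1] := d01.
have [K hK] : exists K : nat, (n0 + n1.*2 + 2)%:R / (1 - delta) <= K%:R.
  by exists (Num.bound ((n0 + n1.*2 + 2)%:R / (1 - delta))); apply/ltW/archi_boundP; rewrite divr_ge0// subr_ge0 ltW.
exists (N0 + K)%N => N m hN hm mN.
have NN0 : (N0 <= N)%N by apply: leq_trans hN; rewrite leq_addr.
have NK : (K <= N)%N by apply: leq_trans hN; rewrite leq_addl.
have hnm : (n0 + n1.*2 + 2 <= m.*2)%N.
  rewrite -(ler_nat R); apply: le_trans hm; rewrite mulrC -ler_pdivrMr ?subr_gt0//.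
  by apply: le_trans hK _; rewrite ler_nat.
have [n0m n1m m0] : [/\ (n0 <= m.*2)%N, (n1 <= m)%N & (0 < m.*2)%N].
  by move: hnm; clear => h; split; lia.
set n := m.*2 in HN n0m m0 *.
have nR : 0 < n%:R :> R by rewrite ltr0n.
pose w : R := Num.sqrt n%:R; have w0 : 0 < w by rewrite sqrtr_gt0.
have ww : w * w = n%:R by rewrite -expr2 sqr_sqrtr// ltW.
have scc : Num.sqrt c * Num.sqrt c = c by rewrite -expr2 sqr_sqrtr// ltW.
pose B s := ~~ prim s || (prim s && (eta * n%:R < `|length_of l N (@geod R s) - c * n%:R|)).
have PB : prob R A n B <= rho / 4.
  apply: le_trans (@prob_or R A A0 n _ _) _.
  have h1 := Hprim m n1m; have h2 := HN N m NN0 hm mN; rewrite -/n in h1 h2.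
  have -> : rho / 4 = rho / 8 + rho / 8 by field.
  by apply: lerD => //; exact: le_trans h2 e1.
have good s : ~~ B s -> prim s /\ exists2 z : R, 0 < z &
    z = Num.sqrt (length_of l N (@geod R s)) /\ `|b * z - b * Num.sqrt c * w| <= kappa / 2 * w.
  rewrite /B negb_or negbK negb_and => /andP[ps]; rewrite ps /= -leNgt => hl.
  split => //; set L := length_of _ _ _ in hl *.
  have L0 : 0 < L by move: hl; rewrite ler_norml => /andP[]; nra.
  exists (Num.sqrt L); first by rewrite sqrtr_gt0.
  split => //; set z := Num.sqrt L.
  have z0 : 0 < z by rewrite sqrtr_gt0.
  have zz : z * z = L by rewrite -expr2 sqr_sqrtr// ltW.
  have -> : b * z - b * Num.sqrt c * w = b * (z - Num.sqrt c * w) by ring.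
  rewrite normrM.
  (* The difference of the roots is [L - c * n] divided by their sum, of which only the root of
     [c * n] is kept. *)
  have h : `|z - Num.sqrt c * w| <= eta / Num.sqrt c * w.
    have scw : 0 < Num.sqrt c * w by rewrite mulr_gt0.
    have : `|z - Num.sqrt c * w| * (Num.sqrt c * w) <= eta * n%:R.
      apply: le_trans hl; have -> : L - c * n%:R = (z - Num.sqrt c * w) * (z + Num.sqrt c * w).
        transitivity (z * z - Num.sqrt c * Num.sqrt c * (w * w)); first by rewrite zz scc ww.
        by ring.
      rewrite normrM ler_wpM2l// ger0_norm; last by rewrite addr_ge0// ltW.
      by rewrite lerDr ltW.
    rewrite -ler_pdivlMr// => /le_trans; apply.
    by rewrite -ww le_eqVlt; apply/orP; left; apply/eqP; field; rewrite !gt_eqF.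
  apply: le_trans (_ : `|b| * (eta / Num.sqrt c * w) <= _); first by rewrite ler_wpM2l.
  by rewrite mulrA ler_pM2r.
have -> : rho = 4 * (rho / 4) by field.
apply: (Hclt n n0m _ B PB) => s ws /good[ps [z z0 [zE zb]]].
  move=> h; rewrite ps /=.
  have lt : (alt_sum s)%:~R < b * z.
    apply: le_lt_trans (_ : centered_sum R A s < _).
      rewrite centered_sumE; have /andP[/eqP -> _] := ws.
      by rewrite odd_double mulr0 subr0.
    apply: le_lt_trans h _.
    move: zb; rewrite ler_norml => /andP[zb _].
    have : 0 < kappa * w by rewrite mulr_gt0.
    by rewrite -/w; lra.
  have : ratio l N s < b by rewrite /ratio -zE ltr_pdivrMr.
  by rewrite /cmp; case: strict; rewrite ?lte_fin ?lee_fin// => /ltW.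
move=> /andP[_ h]; have {h} : ratio l N s <= b.
  by move: h; rewrite /cmp; case: strict; rewrite ?lte_fin ?lee_fin// => /ltW.
rewrite /ratio -zE ler_pdivrMr// => h.
rewrite centered_sumE; have /andP[/eqP -> _] := ws; rewrite odd_double mulr0 subr0.
apply: le_trans h _; move: zb; rewrite ler_norml => /andP[_ zb].
have : 0 < kappa * w by rewrite mulr_gt0.
by rewrite -/w; lra.
Qed.

Lemma one_sided l (c : R) strict (b : \bar R) (rho : R) : 0 < c -> length_concentrates A l c -> 0 < rho ->
  exists2 delta : R, 0 < delta < 1 & exists N0, forall N m, (N0 <= N)%N ->
    (1 - delta) * N%:R <= m.*2%:R -> (m.*2 <= N)%N ->
    `|prob R A m.*2 (fun s => prim s && cmp strict (ratio l N s)%:E b)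
      - gcdfe (Num.sqrt (letter_var R A / c)) b| <= rho.
Proof.
move=> c0 Hc r0; have v0 := @letter_var_gt0 R A A1.
have half01 : 0 < 2^-1 :> R /\ 2^-1 < 1 :> R by split; lra.
case: b => [b| |].
- have [delta d01 [N0 HN]] := one_sided_fin strict b c0 Hc r0.
  exists delta => //; exists N0 => N m h1 h2 h3; have := HN N m h1 h2 h3.
  rewrite /heat /isqrt; move: v0; move: (letter_var R A) => v v0.
  rewrite /= (gcdf_scale b) ?sqrtr_gt0 ?divr_gt0//.
  suff -> : b * Num.sqrt c / Num.sqrt v = b / Num.sqrt (v / c) by [].
  by rewrite sqrtrM ?ltW// sqrtrV ?ltW// invfM invrK; ring.
(* At [+oo] the claim is that almost all words are primitive; at [-oo] the event is empty. *)
- have [n1 Hprim] := prim_prob A1 r0.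
  exists 2^-1; first by apply/andP.
  exists (n1.*2.*2)%N => N m hN hm mN.
  have nm : (n1 <= m)%N.
    rewrite -leq_double -(ler_nat R); apply: le_trans hm.
    have : (n1.*2.*2)%:R <= N%:R :> R by rewrite ler_nat.
    by rewrite -[n1.*2.*2]muln2 natrM; lra.
  have := Hprim m nm; set n := m.*2.
  have -> : prob R A n (fun s => prim s && cmp strict (ratio l N s)%:E +oo%E) = 1 - prob R A n (fun s => ~~ prim s).
    rewrite -[X in X - _](@avg_cst R A A0 n 1) -avgB; apply: eq_avg => s _.
    by rewrite /cmp; case: strict; rewrite ?ltry ?leey andbT; case: (prim s); rewrite /= ?subr0 ?subrr.
  by rewrite /= addrAC subrr add0r normrN ger0_norm// prob_ge0.
exists 2^-1; first by apply/andP.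
exists 0%N => N m _ _ _; rewrite /= subr0.
have -> : prob R A m.*2 (fun s => prim s && cmp strict (ratio l N s)%:E -oo%E) = 0.
  rewrite -(@avg_cst R A A0 m.*2 0); apply: eq_avg => s _.
  by rewrite /cmp; case: strict; rewrite ?ltNge ?leNye ?leeNy_eq /= andbF.
by rewrite normr0 ltW.
Qed.

End OneSided.

(** * The Gaussian integral over an interval *)

Section GaussianIntegral.
Variable R : realType.

Lemma normal_prob_set1 (s a : R) : s != 0 -> normal_prob 0 s [set a] = 0%E.
Proof.
move=> s0; have /null_content_dominatesP := @normal_prob_dominates R 0 s; apply => //.
exact: lebesgue_measure_set1.
Qed.

Lemma normal_prob_le (s : R) (b : \bar R) :
  measurable [set x : R | (x%:E <= b)%E] /\
  fine (normal_prob 0 s [set x : R | (x%:E <= b)%E]) = gcdfe s b.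
Proof.
case: b => [b| |] /=.
- have -> : [set x : R | (x%:E <= b%:E)%E] = `]-oo, b]%classic.
    by apply/seteqP; split => x /=; rewrite lee_fin in_itv.
  by split => //; exact: measurable_itv.
- have -> : [set x : R | (x%:E <= +oo)%E] = setT.
    by apply/seteqP; split => x //= _; rewrite leey.
  by split => //; rewrite (@probability_setT _ _ R (normal_prob 0 s)).
have -> : [set x : R | (x%:E <= -oo)%E] = set0.
  by apply/seteqP; split => x //=; rewrite leeNy_eq.
by split => //; rewrite measure0.
Qed.

Lemma normal_prob_lt (s : R) (a : \bar R) : s != 0 ->
  measurable [set x : R | (x%:E < a)%E] /\
  fine (normal_prob 0 s [set x : R | (x%:E < a)%E]) = gcdfe s a.
Proof.
move=> s0; case: a => [a| |] /=.
- have -> : [set x : R | (x%:E < a%:E)%E] = `]-oo, a[%classic.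
    by apply/seteqP; split => x /=; rewrite lte_fin in_itv.
  split; first exact: measurable_itv.
  have -> : gcdf s a = fine (normal_prob 0 s `]-oo, a[%classic + normal_prob 0 s [set a])%E; last first.
    by rewrite normal_prob_set1// adde0.
  rewrite /gcdf -(@setUitv1 _ _ -oo%O a true)//; congr fine; apply: measureU => //.
  by apply/seteqP; split => x //= [] /=; rewrite in_itv /= => xa xE; rewrite xE ltxx in xa.
- have -> : [set x : R | (x%:E < +oo)%E] = setT.
    by apply/seteqP; split => x //= _; rewrite ltry.
  by split => //; rewrite (@probability_setT _ _ R (normal_prob 0 s)).
have -> : [set x : R | (x%:E < -oo)%E] = set0.
  by apply/seteqP; split => x //=; rewrite ltNge leNye.
by split => //; rewrite measure0.
Qed.

Lemma gcdfe_itv (s : R) (x : \bar R) : 0 <= gcdfe s x <= 1.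
Proof.
by case: x => [x| |] /=; rewrite ?gcdf_ge0 ?gcdf_le1 ?lexx ?ler01.
Qed.

Lemma le_gcdfe (s : R) (x y : \bar R) : (x <= y)%E -> gcdfe s x <= gcdfe s y.
Proof.
case: x y => [x| |] [y| |] //=; rewrite ?leye_eq ?leeNy_eq ?gcdf_le1 ?gcdf_ge0 ?ler01//.
by rewrite lee_fin; exact: le_gcdf.
Qed.

(** Writing the interval as a difference of two half-lines treats finite and infinite bounds
    alike. *)
Lemma gaussian_integral (sigma2 : R) (a b : \bar R) : 0 < sigma2 -> (a < b)%E ->
  (Num.sqrt (2 * pi * sigma2))^-1 *
    \int[lebesgue_measure]_(x in [set x : R | (a <= x%:E <= b)%E]) expR (- x ^+ 2 / (2 * sigma2)) =
  gcdfe (Num.sqrt sigma2) b - gcdfe (Num.sqrt sigma2) a.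
Proof.
move=> s20 ab; set s := Num.sqrt sigma2.
have s0 : s != 0 by rewrite gt_eqF// sqrtr_gt0.
have ss : s ^+ 2 = sigma2 by rewrite sqr_sqrtr// ltW.
have [ma Ea] := normal_prob_lt a s0; have [mb Eb] := normal_prob_le s b.
set Va := [set x : R | (x%:E < a)%E] in ma Ea; set Vb := [set x : R | (x%:E <= b)%E] in mb Eb.
have -> : [set x : R | (a <= x%:E <= b)%E] = Vb `\` Va.
  apply/seteqP; split => x /=; first by move=> /andP[h1 h2]; split => //; apply/negP; rewrite -leNgt.
  by move=> [h1 /negP]; rewrite -leNgt => h2; rewrite h1 h2.
have mV : measurable (Vb `\` Va) by exact: measurableD.
rewrite -Ea -Eb.
have abV : Vb `&` Va = Va.
  by apply/setIidr => x /= xa; apply/ltW; exact: lt_trans ab.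
have -> : fine (normal_prob 0 s Vb) - fine (normal_prob 0 s Va) = fine (normal_prob 0 s (Vb `\` Va)).
  have -> : normal_prob 0 s (Vb `\` Va) = (normal_prob 0 s Vb - normal_prob 0 s Va)%E.
    rewrite -{2}abV; apply: measureD => //.
    by rewrite (le_lt_trans (probability_le1 (normal_prob 0 s) mb)) ?ltry.
  by rewrite (fineB (gcdf_fin s mb) (gcdf_fin s ma)).
have peakE : normal_peak s = (Num.sqrt (2 * pi * sigma2))^-1.
  by rewrite /normal_peak ss -mulr_natr; congr (Num.sqrt _)^-1; ring.
have pk : 0 < normal_peak s by exact: normal_peak_gt0.
have funE (x : R) : expR (- x ^+ 2 / (2 * sigma2)) = (normal_peak s)^-1 * normal_pdf 0 s x.
  rewrite normal_pdfE// mulKf ?gt_eqF// /normal_fun subr0 ss.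
  by congr (expR (_ / _)); rewrite mulr_natl.
rewrite -peakE -RintegralZl//.
  rewrite /Rintegral /normal_prob; congr fine; apply: eq_integral => x _.
  by rewrite funE mulrA mulfV ?gt_eqF// mul1r.
have -> : EFin \o (fun x : R => expR (- x ^+ 2 / (2 * sigma2))) =
    (fun x => ((normal_peak s)^-1)%:E * (normal_pdf 0 s x)%:E)%E.
  by apply/funext => x /=; rewrite funE EFinM.
apply: integrableZl => //; apply: integrableS (integrable_normal_pdf 0 s) => //.
Qed.

End GaussianIntegral.

Theorem theorem1p9 (R : realType) (A : nat) (hA : (1 < A)%N)
    (l : standard_length) :
  exists2 sigma2 : R, 0 < sigma2 &
    forall a b : \bar R, (a < b)%E ->
      (fun N : nat =>
         (ncard [set C | Pi_ A N C /\
            (a <= ((winding C)%:~R / Num.sqrt (length_of l N C))%:E <= b)%E])%:R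
         / (ncard (@Pi_ R A N))%:R : R) @ \oo -->
      (Num.sqrt (2 * pi * sigma2))^-1 *
        \int[lebesgue_measure]_(x in [set x : R | (a <= x%:E <= b)%E])
          expR (- x ^+ 2 / (2 * sigma2)).
Proof.
have A0 := ltnW hA.
have [c c0 Hc] := @length_lln R A hA l; have v0 := @letter_var_gt0 R A hA.
have s0 : 0 < letter_var R A / c by rewrite divr_gt0.
exists (letter_var R A / c) => // a b ab; rewrite gaussian_integral//.
set L := _ - _.
pose E N (C : set (R * R)) := (a <= ((winding C)%:~R / Num.sqrt (length_of l N C))%:E <= b)%E : Prop.
pose F N s := prim s && (a <= (ratio R l N s)%:E <= b)%E.
pose aa N m := prob R A m.*2 (F N).
pose bb m := prob R A m.*2 prim.
(* An exact identity for every [N]: each level is its weight times a probability, in the numerator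
   and in the denominator. *)
have -> : (fun N : nat => (ncard [set C | Pi_ A N C /\ E N C])%:R / (ncard (@Pi_ R A N))%:R : R) =
  (fun N => (\sum_(m <- iota 1 N./2) (A ^ m.*2)%:R / m%:R * aa N m) /
            (\sum_(m <- iota 1 N./2) (A ^ m.*2)%:R / m%:R * bb m)).
  apply/funext => N; rewrite card_Pi.
  have -> : @Pi_ R A N = [set C | Pi_ A N C /\ True] by apply/seteqP; split => C //= [].
  rewrite card_Pi !natr_sum; congr (_ / _).
    rewrite big_seq [RHS]big_seq; apply: eq_bigr => m; rewrite mem_iota => /andP[m0 _].
    rewrite card_level_prob//; congr (_ * _); apply: eq_avg => s ws; congr (_%:R).
    rewrite /F; case ps: (prim s) => //=; have vs := prim_valid ws ps.
    by rewrite /E /ratio winding_geod// asboolb.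
  rewrite big_seq [RHS]big_seq; apply: eq_bigr => m; rewrite mem_iota => /andP[m0 _].
  rewrite card_level_prob//; congr (_ * _); apply: eq_avg => s ws; congr (_%:R).
  by rewrite asboolT ?andbT.
apply: weighted_ratio => //.
- rewrite /L subr_ge0 (le_gcdfe _ (ltW ab)) /=.
  have /andP[_ h1] := gcdfe_itv (Num.sqrt (letter_var R A / c)) b.
  have /andP[h2 _] := gcdfe_itv (Num.sqrt (letter_var R A / c)) a.
  by rewrite lerBlDr; apply: le_trans h1 _; rewrite lerDl.
- by move=> N m; rewrite prob_ge0//=; apply: le_prob => // s _ /andP[].
- by move=> m; exact: prob_le1.
move=> rho r0; have r2 : 0 < rho / 2 by rewrite divr_gt0.
have [d1 d1P [N1 H1]] := one_sided hA false b c0 Hc r2.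
have [d2 d2P [N2 H2]] := one_sided hA true a c0 Hc r2.
have [n3 H3] := prim_prob hA r0 (R := R).
have /andP[d10 d11] := d1P; have /andP[d20 d21] := d2P.
(* One window has to serve both thresholds. *)
pose d3 : R := Num.min d1 d2.
have d30 : 0 < d3 by rewrite lt_min d10 d20.
have d31 : d3 <= d1 by rewrite ge_min lexx.
have d32 : d3 <= d2 by rewrite ge_min lexx orbT.
exists d3; first by rewrite d30 /=; exact: le_lt_trans d11.
have [K hK] : exists K : nat, (n3.*2)%:R / (1 - d3) <= K%:R.
  exists (Num.bound ((n3.*2)%:R / (1 - d3))); apply/ltW/archi_boundP.
  by rewrite divr_ge0// subr_ge0 ltW//; exact: le_lt_trans d11.
exists (N1 + N2 + K)%N => N m hN hm mN.
have [hN1 hN2 hNK] : [/\ (N1 <= N)%N, (N2 <= N)%N & (K <= N)%N].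
  by move: hN; clear => h; split; lia.
have NR : 0 <= N%:R :> R by [].
have hm1 : (1 - d1) * N%:R <= m.*2%:R by apply: le_trans hm; rewrite ler_wpM2r// lerB.
have hm2 : (1 - d2) * N%:R <= m.*2%:R by apply: le_trans hm; rewrite ler_wpM2r// lerB.
have m3 : (n3 <= m)%N.
  rewrite -leq_double -(ler_nat R); apply: le_trans hm.
  rewrite mulrC -ler_pdivrMr; last by rewrite subr_gt0; exact: le_lt_trans d11.
  by apply: le_trans hK _; rewrite ler_nat.
split.
  have -> : aa N m = prob R A m.*2 (fun s => prim s && cmp false (ratio R l N s)%:E b) -
                     prob R A m.*2 (fun s => prim s && cmp true (ratio R l N s)%:E a).
    rewrite -avgB; apply: eq_avg => s _; rewrite /F /cmp.
    case: (prim s) => /=; last by rewrite subrr.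
    have [ya|ya] := leP a (ratio R l N s)%:E; first by rewrite subr0.
    by rewrite (ltW (lt_trans ya ab)) subrr.
  have h1 := H1 N m hN1 hm1 mN; have h2 := H2 N m hN2 hm2 mN.
  rewrite /L (_ : _ - _ - _ = (prob R A m.*2 (fun s => prim s && cmp false (ratio R l N s)%:E b) - gcdfe (Num.sqrt (letter_var R A / c)) b)
     - (prob R A m.*2 (fun s => prim s && cmp true (ratio R l N s)%:E a) - gcdfe (Num.sqrt (letter_var R A / c)) a)); last by ring.
  apply: le_trans (ler_normB _ _) _.
  by rewrite [leRHS]splitr; exact: lerD.
have -> : bb m = 1 - prob R A m.*2 (fun s => ~~ prim s).
  rewrite -[X in X - _](@avg_cst R A A0 m.*2 1) -avgB; apply: eq_avg => s _.
  by case: (prim s); rewrite /= ?subr0 ?subrr.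
by rewrite lerB// H3.
Qed.
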